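(* Let $n\ge 3$, let $R$ be a commutative ring with $1$, let $A$ be a quasi-finite $R$-algebra with identity, and let $I_i$, $i=0,\dots,m$, be two-sided ideals of $A$. Then $$\big[E(n,A,I_0),\mathrm{GL}(n,A,I_1),\mathrm{GL}(n,A,I_2),\ldots,\mathrm{GL}(n,A,I_m)\big]=\big[E(n,A,I_0),E(n,A,I_1),E(n,A,I_2),\ldots,E(n,A,I_m)\big],$$ where both sides are left-normed multiple commutator subgroups.
   Context: Rings are associative with $1$. An $R$-algebra $A$ ($R$ commutative, acting centrally) is module finite over $R$ if it is finitely generated as an $R$-module; it is quasi-finite over $R$ if there is a direct system of module finite $R$-subalgebras $A_i$ of $A$ with $\varinjlim A_i=A$. For $1\le i\ne j\le n$ and $\xi\in A$, $e_{ij}(\xi)=e+\xi e_{ij}$ is the elementary matrix ($e$ the identity matrix, $e_{ij}$ the standard matrix unit). $E(n,A)\le \mathrm{GL}(n,A)$ is the subgroup generated by all $e_{ij}(\xi)$, $\xi\in A$. For a two-sided ideal $I$ of $A$: $\mathrm{GL}(n,A,I)=\ker(\mathrm{GL}(n,A)\to\mathrm{GL}(n,A/I))$; $E(n,I)$ is the subgroup generated by all $e_{ij}(\xi)$ with $\xi\in I$; $E(n,A,I)$ is the normal closure of $E(n,I)$ in $E(n,A)$. For subgroups $H,K$ of a group, $[H,K]$ is the subgroup generated by all $[x,y]=xyx^{-1}y^{-1}$, $x\in H,y\in K$; and $[H_0,H_1,\dots,H_m]=[[H_0,\dots,H_{m-1}],H_m]$ is defined inductively (left-normed). *)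

(* Defs.v *)
(* All rings are [pzRingType]s: the zero ring is allowed. *)
From HB Require Import structures.
From mathcomp Require Import all_boot all_algebra.
From mathcomp Require Import boolp classical_sets.

Set Implicit Arguments.
Unset Strict Implicit.
Unset Printing Implicit Defensive.

Import GRing.Theory.

Local Open Scope classical_set_scope.
Local Open Scope ring_scope.
Local Open Scope quotient_scope.

Section Subgroups.
Local Open Scope group_scope.
Variable G : groupType.
Implicit Types (H K X : set G).

Definition is_subgroup H : Prop :=
  [/\ H 1,
      forall x y, H x -> H y -> H (x * y)
    & forall x, H x -> H x^-1].

Definition generated X : set G := smallest is_subgroup X.

Definition is_normal_subgroup K H : Prop :=
  [/\ is_subgroup H, H `<=` K
    & forall x h, K x -> H h -> H (x * h * x^-1)].

Definition normal_closure K X : set G := smallest (is_normal_subgroup K) X.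

(* The convention here is x y x^-1 y^-1, whereas the library's [~ x, y] is
   x^-1 y^-1 x y. *)
Definition commutator_subgroup H K : set G :=
  generated [set z | exists x y, [/\ H x, K y & z = x * y * x^-1 * y^-1]].

(* [H_0, H_1, ..., H_m] = [[H_0, ..., H_(m-1)], H_m], where [H i] is H_(i+1). *)
Definition multi_commutator (H0 : set G) m (H : 'I_m -> set G) : set G :=
  foldl commutator_subgroup H0 [seq H i | i <- enum 'I_m].

End Subgroups.

Record ideal (A : pzRingType) := Ideal {
  ideal_set :> set A;
  ideal0 : ideal_set 0;
  idealB : forall x y, ideal_set x -> ideal_set y -> ideal_set (x - y);
  idealMl : forall a x, ideal_set x -> ideal_set (a * x);
  idealMr : forall x a, ideal_set x -> ideal_set (x * a)
}.

Definition ideal_pred (A : pzRingType) (I : ideal A) : {pred A} :=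
  fun x => `[< ideal_set I x >].

Section QuotientRing.
Variables (A : pzRingType) (I : ideal A).

Fact ideal_pred_zmod_closed : zmod_closed (ideal_pred I).
Proof.
split; first by apply/asboolP/ideal0.
by move=> x y /asboolP Ix /asboolP Iy; apply/asboolP/idealB.
Qed.

HB.instance Definition _ :=
  GRing.isZmodClosed.Build A (ideal_pred I) ideal_pred_zmod_closed.

(* The library only equips quotients of commutative rings by proper ideals with
   a multiplication; its additive quotient is reused here. *)
Definition quotient_ring : Type := Quotient.quot (ideal_pred I).

HB.instance Definition _ := GRing.Zmodule.on quotient_ring.

Definition quotient_pi (x : A) : quotient_ring :=
  \pi_(Quotient.quot (ideal_pred I)) x.

Let rep (x : quotient_ring) : A := repr (x : Quotient.quot (ideal_pred I)).

Lemma quotient_pi_eq x y : quotient_pi x = quotient_pi y <-> ideal_set I (x - y).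
Proof.
have E := Quotient.idealrBE (ideal_pred I) x y.
split=> [e|Ixy]; first by apply/asboolP; move/eqP: e; rewrite -E.
by apply/eqP; rewrite /quotient_pi -E; apply/asboolP.
Qed.

Lemma quotient_repK x : quotient_pi (rep x) = x.
Proof. exact: reprK. Qed.

Definition quotient_one : quotient_ring := quotient_pi 1.
Definition quotient_mul (x y : quotient_ring) : quotient_ring :=
  quotient_pi (rep x * rep y).

Lemma quotient_piM : {morph quotient_pi : x y / x * y >-> quotient_mul x y}.
Proof.
move=> x y; apply/quotient_pi_eq.
have Ix : ideal_set I (x - rep (quotient_pi x)) by apply/quotient_pi_eq; rewrite quotient_repK.
have Iy : ideal_set I (rep (quotient_pi y) - y) by apply/quotient_pi_eq; rewrite quotient_repK.
set x' := rep _ in Ix *; set y' := rep _ in Iy *.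
have -> : x * y - x' * y' = (x - x') * y - x' * (y' - y).
  by rewrite mulrBl mulrBr opprB addrA subrK.
by apply: idealB; [apply: idealMr|apply: idealMl].
Qed.

Lemma quotient_piB : {morph quotient_pi : x y / x - y}.
Proof. by move=> x y; rewrite /quotient_pi raddfB. Qed.

Lemma quotient_piD : {morph quotient_pi : x y / x + y}.
Proof. by move=> x y; rewrite /quotient_pi raddfD. Qed.

Fact quotient_mulA : associative quotient_mul.
Proof.
move=> x y z; rewrite -[x]quotient_repK -[y]quotient_repK -[z]quotient_repK.
by rewrite -!quotient_piM mulrA.
Qed.

Fact quotient_mul1 : left_id quotient_one quotient_mul.
Proof. by move=> x; rewrite -[x]quotient_repK -quotient_piM mul1r. Qed.

Fact quotient_mulr1 : right_id quotient_one quotient_mul.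
Proof. by move=> x; rewrite -[x]quotient_repK -quotient_piM mulr1. Qed.

Fact quotient_mulDl : left_distributive quotient_mul +%R.
Proof.
move=> x y z; rewrite -[x]quotient_repK -[y]quotient_repK -[z]quotient_repK.
by rewrite -!(quotient_piM, quotient_piD) mulrDl.
Qed.

Fact quotient_mulDr : right_distributive quotient_mul +%R.
Proof.
move=> x y z; rewrite -[x]quotient_repK -[y]quotient_repK -[z]quotient_repK.
by rewrite -!(quotient_piM, quotient_piD) mulrDr.
Qed.

HB.instance Definition _ := GRing.Zmodule_isPzRing.Build quotient_ring
  quotient_mulA quotient_mul1 quotient_mulr1 quotient_mulDl quotient_mulDr.

HB.instance Definition _ :=
  GRing.isZmodMorphism.Build A quotient_ring quotient_pi quotient_piB.
HB.instance Definition _ := GRing.isMonoidMorphism.Build A quotient_ring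
  quotient_pi (erefl, quotient_piM).

End QuotientRing.

Section GeneralLinearGroup.
Variable n : nat.

(* The library's [unitmx] and ['GL_n] are for commutative coefficients, so an
   element is a matrix packed with its (unique) two-sided inverse. *)
Definition inverse_pair (A : pzRingType) (p : 'M[A]_n * 'M[A]_n) : bool :=
  (p.1 *m p.2 == 1%:M) && (p.2 *m p.1 == 1%:M).

Record GL (A : pzRingType) := MkGL {
  GL_pair : 'M[A]_n * 'M[A]_n;
  GL_pairP : inverse_pair GL_pair
}.

HB.instance Definition _ (A : pzRingType) := [isSub for @GL_pair A].
HB.instance Definition _ (A : pzRingType) := [Choice of GL A by <:].

Definition GL_mx (A : pzRingType) (g : GL A) : 'M[A]_n := (GL_pair g).1.

Section Group.
Variable A : pzRingType.
Implicit Types g h : GL A.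

Lemma GL_mx_inj : injective (@GL_mx A).
Proof.
move=> [[M N] /= MN] [[M' N'] /= MN']; rewrite /GL_mx /= => eM.
apply/val_inj => /=; congr (_, _) => //.
move: MN MN'; rewrite /inverse_pair /= -eM => /andP[_ /eqP NM] /andP[/eqP MN' _].
by rewrite -[N]mulmx1 -MN' mulmxA NM mul1mx.
Qed.

Fact GL_one_subproof : inverse_pair (1%:M : 'M[A]_n, 1%:M).
Proof. by rewrite /inverse_pair /= !mul1mx !eqxx. Qed.

Fact GL_inv_subproof g : inverse_pair ((GL_pair g).2, (GL_pair g).1).
Proof. by rewrite /inverse_pair /= andbC; apply: GL_pairP. Qed.

Fact GL_mul_subproof g h : inverse_pair
  ((GL_pair g).1 *m (GL_pair h).1, (GL_pair h).2 *m (GL_pair g).2).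
Proof.
case: g h => [[M N] /= /andP[/eqP /= MN /eqP NM]].
move=> [[M' N'] /= /andP[/eqP /= MN' /eqP NM']].
apply/andP; split; apply/eqP => /=.
  by rewrite mulmxA -[M *m M' *m N']mulmxA MN' mulmx1.
by rewrite mulmxA -[N' *m N *m M]mulmxA NM mulmx1.
Qed.

Definition GL_one : GL A := MkGL GL_one_subproof.
Definition GL_inv g : GL A := MkGL (GL_inv_subproof g).
Definition GL_mul g h : GL A := MkGL (GL_mul_subproof g h).

Fact GL_mulA : associative GL_mul.
Proof. by move=> g h k; apply: GL_mx_inj; rewrite /GL_mx /= mulmxA. Qed.

Fact GL_mul1 : left_id GL_one GL_mul.
Proof. by move=> g; apply: GL_mx_inj; rewrite /GL_mx /= mul1mx. Qed.

Fact GL_mulr1 : right_id GL_one GL_mul.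
Proof. by move=> g; apply: GL_mx_inj; rewrite /GL_mx /= mulmx1. Qed.

Fact GL_mulV : left_inverse GL_one GL_inv GL_mul.
Proof.
by move=> g; apply: GL_mx_inj; apply/eqP; case/andP: (GL_pairP g).
Qed.

Fact GL_mulrV : right_inverse GL_one GL_inv GL_mul.
Proof.
by move=> g; apply: GL_mx_inj; apply/eqP; case/andP: (GL_pairP g).
Qed.

HB.instance Definition _ := isGroup.Build (GL A)
  GL_mulA GL_mul1 GL_mulr1 GL_mulV GL_mulrV.

End Group.

Fact GL_map_subproof (A B : pzRingType) (f : {rmorphism A -> B}) (g : GL A) :
  inverse_pair (map_mx f (GL_pair g).1, map_mx f (GL_pair g).2).
Proof.
case/andP: (GL_pairP g) => /eqP MN /eqP NM.
by rewrite /inverse_pair /= -!map_mxM MN NM map_mx1 !eqxx.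
Qed.

Definition GL_map (A B : pzRingType) (f : {rmorphism A -> B}) (g : GL A) :
  GL B := MkGL (GL_map_subproof f g).

Variable A : pzRingType.

Definition GL_ideal (I : ideal A) : set (GL A) :=
  [set g | GL_map (@quotient_pi A I) g = 1%g].

Lemma GL_idealP (I : ideal A) (g : GL A) :
  GL_ideal I g <-> forall i j, ideal_set I (GL_mx g i j - (1%:M : 'M[A]_n) i j).
Proof.
have mx_1 : GL_mx (1%g : GL (quotient_ring I)) = 1%:M by [].
have -> : GL_ideal I g <-> map_mx (@quotient_pi A I) (GL_mx g)
                           = map_mx (@quotient_pi A I) 1%:M.
  rewrite map_mx1; split=> e; last exact: GL_mx_inj.
  by rewrite -mx_1 -(e : GL_map _ g = 1%g).
split=> [/matrixP e i j|e].
  by apply/quotient_pi_eq; have := e i j; rewrite !mxE.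
by apply/matrixP => i j; rewrite !mxE; apply/quotient_pi_eq; have := e i j;
  rewrite !mxE.
Qed.

Definition elementary_mx (i j : 'I_n) (xi : A) : 'M[A]_n :=
  1%:M + xi *: delta_mx i j.

Fact elementary_subproof i j xi : i != j ->
  inverse_pair (elementary_mx i j xi, elementary_mx i j (- xi)).
Proof.
move=> ij.
have E a b : elementary_mx i j a *m elementary_mx i j b
             = elementary_mx i j (a + b).
  rewrite /elementary_mx mulmxDl mul1mx mulmxDr mulmx1 -addrA; congr (_ + _).
  have -> : a *: delta_mx i j *m (b *: delta_mx i j) = 0 :> 'M[A]_n.
    apply/matrixP => k l; rewrite !mxE big1 // => s _; rewrite !mxE.
    case: (eqVneq s j) => [->|_]; last by rewrite andbF mulr0 mul0r.
    by rewrite (negPf (_ : j != i)) 1?eq_sym //= mulr0 mulr0.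
  by rewrite addr0 scalerDl addrC.
have E0 : elementary_mx i j 0 = 1%:M by rewrite /elementary_mx scale0r addr0.
by rewrite /inverse_pair /= !E subrr addNr E0 !eqxx.
Qed.

Definition elementary i j xi (ij : i != j) : GL A :=
  MkGL (elementary_subproof xi ij).

Definition E_gen (X : set A) : set (GL A) := generated
  [set g | exists (i j : 'I_n) (ij : i != j) (xi : A),
             X xi /\ g = elementary xi ij].

Definition E_full : set (GL A) := E_gen setT.

Definition E_ideal (I : ideal A) : set (GL A) :=
  normal_closure E_full (E_gen I).

End GeneralLinearGroup.

Arguments GL_ideal n {A} I.
Arguments E_gen n {A} X.
Arguments E_full n A : clear implicits.
Arguments E_ideal n {A} I.

(* An R-algebra structure on A is a ring morphism from R to A whose image is
   central; r acts on A as multiplication by [alg r]. *)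
Section QuasiFinite.
Variables (R : comPzRingType) (A : pzRingType) (alg : {rmorphism R -> A}).

Definition central_morphism : Prop := forall r a, alg r * a = a * alg r.

Definition is_subalgebra (B : set A) : Prop :=
  [/\ B 1,
      forall x y, B x -> B y -> B (x - y),
      forall x y, B x -> B y -> B (x * y)
    & forall r x, B x -> B (alg r * x)].

Definition module_finite (B : set A) : Prop :=
  exists (k : nat) (b : 'I_k -> A), (forall i, B (b i)) /\
    forall x, B x -> exists c : 'I_k -> R, x = \sum_(i < k) alg (c i) * b i.

(* The transition maps of a direct system of subalgebras are the inclusions, so
   that its direct limit is the union. *)
Definition quasi_finite : Prop :=
  exists (J : Type) (le : J -> J -> Prop) (B : J -> set A),
    [/\ [/\ (exists j : J, True),
            (forall i, le i i),
            (forall i j k, le i j -> le j k -> le i k)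
          & (forall i j, exists k, le i k /\ le j k)],
        (forall i j, le i j -> B i `<=` B j),
        (forall j, is_subalgebra (B j) /\ module_finite (B j))
      & \bigcup_j B j = setT].

End QuasiFinite.

(* Main.v *)
Require Import Defs.
From mathcomp Require Import all_boot all_algebra.
From HB Require Import structures.
From mathcomp Require Import boolp classical_sets.

(* Write E(I), GL(I) for E(n,A,I), GL(n,A,I), and IoJ for the ideal IJ + JI.

   The case m = 1 reduces to [GL(I), E(A)] <= E(I). Indeed, modulo [E(I), E(J)],
   for g in GL(J), x in E(I), e in E(A) one has g [x, e] g^-1 = [c x, k e] with
   c = [g, x] in GL(IoJ), which commutes with E(A), and k = [g, e] in E(J), which
   commutes with E(I); hence g [x, e] g^-1 = [x, e], and such [x, e] generate E(I).

   For m >= 2 both [[E(I), E(J)], GL(K)] and [[E(I), E(J)], E(K)] turn out to be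
   equal to N = [E(IoJ), E(K)], so that the theorem follows by induction on m. The
   point is that z = [e_ij(a), e_ji(b)] with a in I, b in J commutes with every g
   in GL(K) modulo N.

   Both [GL(I), E(A)] <= E(I) and this last fact are proved by localization in R
   without inverting anything. The r in R for which they hold with a replaced by
   r a form an ideal, so for every maximal ideal M one has to find such an r
   outside M. Since A / M A has finite length, it has stable rank 1, so after
   multiplication of g by an element of E(I) (resp. E(K)) a diagonal entry g_pp
   divides some s in R \ M, and the pivot g_pp allows an explicit Gauss
   elimination in which denominators are cleared by powers of s. *)

Set Implicit Arguments.
Unset Strict Implicit.
Unset Printing Implicit Defensive.
Import GRing.Theory.
Local Open Scope classical_set_scope.
Local Open Scope ring_scope.

(** * Stable rank of rings of finite length *)

(** The obstacle is that [E(I), E(J)] need not equal E(IoJ): the commutators z of opposite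
    elementary matrices have to be controlled as well. What makes them tractable modulo N is that
    [1 + v a e_p, 1 + e_p b u], with v or u over K, depends only on the scalar u v. Conjugation by g
    preserves such scalars, so after elimination at a pivot g_pp, with p a third index, the
    commutator of the conjugated matrices can be compared with z itself.

    Quasi-finiteness enters only through finiteness of data: [g, e_ij(x)] and [z, g] involve
    finitely many elements of A, and these lie in one module finite subalgebra B. Ideals are pulled
    back to B and the membership obtained there is pushed forward to A. For this reason both local
    facts are proved for single generators and only afterwards extended to whole subgroups. *)

Lemma ex_minimizer (T : Type) (f : T -> nat) (P : T -> Prop) :
  (exists x, P x) -> exists2 x, P x & forall y, P y -> (f x <= f y)%N.
Proof.
case=> x Px; have [k] := ubnP (f x); elim: k x Px => // k IH x Px xk.
have [[y [Py yx]]|no] := pselect (exists y, P y /\ (f y < f x)%N).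
  by apply: (IH y) => //; apply: leq_trans yx _.
exists x => // y Py; rewrite leqNgt; apply/negP => yx; apply: no.
by exists y.
Qed.

Section FiniteLength.

Definition left_ideal (B : pzRingType) (U : set B) : Prop :=
  [/\ U 0, forall x y, U x -> U y -> U (x - y) & forall a x, U x -> U (a * x)].

(* The left B-module B has length at most d: such a mu exists iff every strictly
   increasing chain of left ideals has at most d inclusions. *)
Definition length_le (B : pzRingType) (d : nat) : Prop :=
  exists mu : set B -> nat,
    (forall U, left_ideal U -> (mu U <= d)%N) /\
    forall U V, left_ideal U -> left_ideal V -> U `<=` V ->
      (mu U <= mu V)%N /\ (mu U = mu V -> V `<=` U).

Variable B : pzRingType.
Implicit Types (U V : set B) (a b x y z : B).

Lemma left_idealD U x y : left_ideal U -> U x -> U y -> U (x + y).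
Proof.
by case=> U0 UB _ Ux Uy; rewrite -[y]opprK; apply: (UB) => //;
  rewrite -sub0r; apply: UB.
Qed.

Lemma left_idealI U V : left_ideal U -> left_ideal V -> left_ideal (U `&` V).
Proof.
move=> [U0 UB UM] [V0 VB VM]; split=> [|x y [? ?] [? ?]|c x [? ?]] //.
  by split; [apply: UB|apply: VB].
by split; [apply: UM|apply: VM].
Qed.

Lemma left_ideal0 : left_ideal [set 0 : B].
Proof. by split=> [|x y -> ->|a x ->]; rewrite ?subrr ?mulr0. Qed.

Lemma left_ideal_image U a : left_ideal U -> left_ideal [set x * a | x in U].
Proof.
move=> [U0 UB UM]; split; first by exists 0; rewrite ?mul0r.
  by move=> _ _ [x Ux <-] [y Uy <-]; exists (x - y); rewrite ?mulrBl //; apply: UB.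
by move=> c _ [x Ux <-]; exists (c * x); rewrite ?mulrA //; apply: UM.
Qed.

Lemma left_idealT : left_ideal [set: B].
Proof. by []. Qed.

Lemma left_ideal_ann U a : left_ideal U -> left_ideal [set x | U x /\ x * a = 0].
Proof.
move=> [U0 UB UM]; split; first by rewrite /= mul0r.
  by move=> x y [Ux xa] [Uy ya]; split; [exact: UB|rewrite mulrBl xa ya subr0].
by move=> c x [Ux xa]; split; [exact: UM|rewrite -mulrA xa mulr0].
Qed.

Variable d : nat.
Hypothesis lenB : length_le B d.

Lemma chain_up (U : nat -> set B) : (forall k, left_ideal (U k)) ->
  (forall k, U k `<=` U k.+1) -> exists k, U k.+1 `<=` U k.
Proof.
move=> lU sU; have [mu [mud mono]] := lenB; apply: contrapT => /forallNP no.
have: forall k, (k <= mu (U k))%N.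
  elim=> // k IH; have [le eq] := mono _ _ (lU k) (lU k.+1) (sU k).
  apply: leq_ltn_trans IH _; rewrite ltn_neqAle le andbT.
  by apply/negP => /eqP /eq; apply: no.
by move=> /(_ d.+1) /leq_trans/(_ (mud _ (lU _))); rewrite ltnn.
Qed.

Lemma chain_down (U : nat -> set B) : (forall k, left_ideal (U k)) ->
  (forall k, U k.+1 `<=` U k) -> exists k, U k `<=` U k.+1.
Proof.
move=> lU sU; have [mu [mud mono]] := lenB; apply: contrapT => /forallNP no.
have: forall k, (mu (U k) + k <= d)%N.
  elim=> [|k IH]; first by rewrite addn0 mud.
  have [le eq] := mono _ _ (lU k.+1) (lU k) (sU k).
  apply: leq_trans IH; rewrite addnS -addSn leq_add2r ltn_neqAle le andbT.
  by apply/negP => /eqP /eq; apply: no.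
by move=> /(_ d.+1) /(leq_trans (leq_addl _ _)); rewrite ltnn.
Qed.

(** Fitting's argument: the annihilators of the powers of [a] in [U] stabilize, say at [k]. Write
    [z = x a^k] with [x] in [U]; then [x a^(k+1) = z a = 0] forces [x a^k = 0]. *)
Lemma onto_inj U a : left_ideal U -> U `<=` [set x * a | x in U] ->
  forall z, U z -> z * a = 0 -> z = 0.
Proof.
move=> lU onto z Uz za.
pose W k : set B := [set x | U x /\ x * a ^+ k = 0].
have [|k x|k Wk] := @chain_up W; first by move=> k; apply: left_ideal_ann.
  by rewrite /W /= => -[Ux xa]; rewrite exprSr mulrA xa mul0r.
have [x Ux xz] : exists2 x, U x & x * a ^+ k = z.
  elim: k {Wk} z Uz {za} => [|k IH] z Uz; first by exists z; rewrite ?mulr1.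
  have [y Uy <-] := onto z Uz; have [x Ux <-] := IH y Uy.
  by exists x; rewrite // exprSr mulrA.
have /Wk[_] : W k.+1 x by split=> //; rewrite exprSr mulrA xz.
by rewrite xz.
Qed.

Lemma dedekind_finite z c : z * c = 1 -> c * z = 1.
Proof.
move=> zc; apply/eqP; rewrite -subr_eq0; apply/eqP.
apply: (@onto_inj setT c) => //; last by rewrite mulrBl mul1r -mulrA zc mulr1 subrr.
by move=> x _; exists (x * z); rewrite // -mulrA zc mulr1.
Qed.

(** The chain of the [B a^k] stabilizes, so [a^k = x a^(k+1)] for some [x], and [a^k] can be
    cancelled on the right. *)
Lemma inj_left_inv a : (forall z, z * a = 0 -> z = 0) -> exists x, x * a = 1.
Proof.
move=> inj; pose W k := [set x * a ^+ k | x in [set: B]].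
have [|k _ [x _ <-]|k Wk] := @chain_down W; first by move=> k; apply: left_ideal_image.
  by exists (x * a); rewrite // exprS mulrA.
have [x _ E] : W k.+1 (a ^+ k) by apply: Wk; exists 1; rewrite ?mul1r.
exists x; apply/eqP; rewrite -subr_eq0; apply/eqP.
have injk j z : z * a ^+ j = 0 -> z = 0.
  by elim: j z => [|j IH] z; rewrite ?mulr1 // exprS mulrA => /IH/inj.
by apply: (injk k); rewrite mulrBl -mulrA -exprS E mul1r subrr.
Qed.

Hypothesis semiprime : forall m, (forall x, m * x * m = 0) -> m = 0.

(** Take an idempotent [e] of [U] with the smallest annihilator [U0] in [U]. If [U0] were nonzero,
    it would contain a nonzero idempotent [f], and combining [e] with [f] would make the annihilator
    smaller. *)
Lemma left_ideal_idempotent U : left_ideal U ->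
  exists2 e, U e & forall u, U u -> u * e = u.
Proof.
move=> lU; have [mu [mud mono]] := lenB.
have [e [Ue ee] emin] := @ex_minimizer _
  (fun e => mu [set u | U u /\ u * e = 0]) (fun e => U e /\ e * e = e)
  (ex_intro _ 0 (conj (let: And3 U0 _ _ := lU in U0) (mul0r 0))).
exists e => // u Uu; have [_ UB UM] := lU.
pose U0 := [set u | U u /\ u * e = 0].
have lU0 : left_ideal U0 by apply: left_ideal_ann.
suff U00 : forall x, U0 x -> x = 0.
  apply/eqP; rewrite -subr_eq0; apply/eqP/U00; split; last by rewrite mulrBl -mulrA ee subrr.
  by apply: UB => //; apply: UM.
move=> x0 U0x0; apply: contrapT => x00.
pose good M := [/\ left_ideal M, M `<=` U0 & exists2 x, M x & x <> 0].
have [M [lM MU0 [m0 Mm0 m00]] Mmin] : exists2 M, good M & forall M', good M' -> (mu M <= mu M')%N.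
  by apply: ex_minimizer; exists U0; split=> //; exists x0.
have [M0 MB MM] := lM.
have Msub M' : good M' -> M' `<=` M -> M `<=` M'.
  move=> gM' sM; have [lM' _ _] := gM'; have [le eq] := mono _ _ lM' lM sM.
  by apply: eq; apply/eqP; rewrite eqn_leq le Mmin.
(* Semiprimeness gives [M M <> 0]; Brauer's lemma then yields an idempotent in the minimal left
   ideal [M]. *)
have [m [m' [Mm Mm' mm']]] : exists m m', [/\ M m, M m' & m * m' <> 0].
  apply: contrapT => no; apply: m00; apply: semiprime => x.
  apply: contrapT => nz; apply: no; exists m0, (x * m0); split => //.
    exact: MM.
  by rewrite mulrA.
have m'0 : m' <> 0 by move=> E; apply: mm'; rewrite E mulr0.
(* [M m'] is nonzero and contained in [M], hence equal to [M]. So [m' = f m'] for some [f], and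
   since right multiplication by [m'] is injective on [M], [f] is idempotent. *)
have [f Mf fm'] : [set x * m' | x in M] m'.
  apply: Msub => //; last by move=> _ [x Mx <-]; apply: MM.
  split; [exact: left_ideal_image| |by exists (m * m') => //; exists m].
  by move=> _ [x Mx <-]; apply/MU0/MM.
have f0 : f <> 0 by move=> E; apply: m'0; rewrite -fm' E mul0r.
have ann0 x : M x -> x * m' = 0 -> x = 0.
  move=> Mx xm'; apply: contrapT => x0'.
  pose M' := [set x | M x /\ x * m' = 0].
  have : M `<=` M'.
    apply: Msub; last by move=> y [].
    by split; [exact: left_ideal_ann|move=> y [/MU0]|exists x].
  by move=> /(_ m Mm) [].
have ff : f * f = f.
  apply/eqP; rewrite -subr_eq0; apply/eqP/ann0; first by apply: MB => //; apply: MM.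
  by rewrite mulrBl -mulrA !fm' subrr.
have [Uf fe] := MU0 _ Mf.
(* Because [f e = 0], this is an idempotent with [e' e = e] and [e' f = f]. Its annihilator lies in
   [U0] and misses [f]. *)
pose e' := e + f - e * f.
have e'e : e' * e = e by rewrite /e' mulrBl mulrDl ee -mulrA fe mulr0 subr0 addr0.
have e'f : e' * f = f by rewrite /e' mulrBl mulrDl -mulrA ff [e * f + _]addrC addrK.
have Ue' : U e' by apply: (UB); [exact: left_idealD|exact: UM].
have e'e' : e' * e' = e' by rewrite {2}/e' mulrBr mulrDr mulrA e'e e'f.
have fe' : f * e' = f by rewrite /e' mulrBr mulrDr mulrA fe ff mul0r subr0 add0r.
pose V := [set u | U u /\ u * e' = 0].
have lV : left_ideal V by apply: left_ideal_ann.
have VU0 : V `<=` U0.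
  by move=> v [Uv ve']; split=> //; rewrite -e'e mulrA ve' mul0r.
have [le eq] := mono _ _ lV lU0 VU0.
have /eq/(_ f (conj Uf fe)) : mu V = mu U0.
  by apply/eqP; rewrite eqn_leq le emin.
by case=> _; rewrite fe'.
Qed.

(** Choose [t] so that the left annihilator of [a' = a + t b] is smallest. If it were nonzero, a
    further multiple of [b] from a complement of [B a'] could be added to shrink it. *)
Lemma semiprime_stable_range a b x y : x * a + y * b = 1 ->
  exists t z, z * (a + t * b) = 1.
Proof.
move=> ab1; have [mu [mud mono]] := lenB.
pose K a' : set B := [set z | setT z /\ z * a' = 0].
have lK a' : left_ideal (K a') by apply: left_ideal_ann.
have [t _ tmin] := @ex_minimizer _ (fun t => mu (K (a + t * b))) (fun=> True) (ex_intro _ 0 I).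
exists t; set a' := a + t * b in tmin *.
have a'b1 : x * a' + (y - x * t) * b = 1.
  by rewrite /a' mulrDr mulrBl mulrA -addrA [x * t * b + _]addrC subrK.
have lM c : left_ideal [set z * c | z in [set: B]] by apply: left_ideal_image.
have [e [[ea _ eE] [eb _ ebE]] Ve] := left_ideal_idempotent (left_idealI (lM a') (lM b)).
(* [e] generates the intersection of [B a'] and [B b], so [C] is a complement of it in [B b]. Hence
   [B] is the direct sum of [B a'] and [C = B c]. *)
pose C := [set z * (b - b * e) | z in [set: B]].
have Cb z : C z -> exists q, z = q * b.
  by move=> [q _ <-]; exists (q - q * b * eb); rewrite mulrBr mulrA -ebE mulrBl !mulrA.
have [c Cc Cz] := left_ideal_idempotent (lM (b - b * e)).
have [r cr] := Cb _ Cc.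
have disj q q' : q * a' = q' * c -> q * a' = 0.
  move=> E.
  have [p _ Ep] : C (q * a') by rewrite E; have [_ _] := lM (b - b * e); apply.
  rewrite -(Ve (q * a')); last first.
    split; [by exists q|]; rewrite /= E; exists (q' * r) => //.
    by rewrite cr mulrA.
  have ee : e * e = e by apply: Ve; split; [exists ea|exists eb].
  by rewrite -Ep -mulrA mulrBl -mulrA ee subrr mulr0.
have [x' [y' a'c1]] : exists x' y', x' * a' + y' * c = 1.
  have [s _ sb] : exists2 s, True & b = s * a' + (b - b * e) * c.
    exists (b * ea) => //; rewrite (Cz (b - b * e)); last by exists 1; rewrite ?mul1r.
    by rewrite -mulrA eE addrC subrK.
  exists (x + (y - x * t) * s), ((y - x * t) * (b - b * e)).
  by rewrite mulrDl -addrA -!mulrA -mulrDr -sb.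
(* Replacing [t] by [t + p r] turns [a'] into [a' + p c]. As [B a'] meets [B c] in 0, this can only
   shrink the annihilator; by minimality it does not, so [p c] is killed by [z] too. *)
have KBc z p : K a' z -> z * p * c = 0.
  move=> Kz; pose a'' := a + (t + p * r) * b.
  have a''E : a'' = a' + p * c by rewrite /a'' mulrDl addrA -mulrA -cr.
  have sub : K a'' `<=` K a'.
    move=> w [_]; rewrite a''E mulrDr => /eqP; rewrite addr_eq0 => /eqP E.
    split=> //; apply: (@disj _ (- (w * p))).
    by rewrite E mulNr mulrA.
  have [le eq] := mono _ _ (lK a'') (lK a') sub.
  have /eq/(_ z Kz) : mu (K a'') = mu (K a') by apply/eqP; rewrite eqn_leq le tmin.
  by case=> _; rewrite a''E mulrDr (let: conj _ h := Kz in h) add0r mulrA.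
apply: inj_left_inv => z za'.
(* T is a two-sided ideal containing the annihilator of a', on which right
   multiplication by a' is onto, because T c = 0 and B a' + B c = B. *)
pose T := [set w | forall p, w * p * c = 0].
have lT : left_ideal T.
  split=> [p|w w' Tw Tw' p|q w Tw p]; first by rewrite !mul0r.
    by rewrite !mulrBl Tw Tw' subrr.
  by rewrite -(mulrA q) -(mulrA q) Tw mulr0.
apply: (onto_inj lT _ _ za'); last by move=> p; apply: KBc.
move=> w Tw; exists (w * x'); first by move=> p; rewrite -(mulrA w) Tw.
by rewrite -[RHS]mulr1 -a'c1 [RHS]mulrDr [w * (y' * c)]mulrA Tw addr0 mulrA.
Qed.

End FiniteLength.

(** * Generated two-sided ideals and reduction to the semiprime case *)

Section GeneratedIdeal.
Variables (A : pzRingType) (X : set A).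

Definition span_set : set A :=
  smallest (fun S => exists J : ideal A, S = J) X.

Lemma span_sub (J : ideal A) : X `<=` J -> span_set `<=` J.
Proof. by move=> XJ x; apply; split => //; exists J. Qed.

Lemma sub_span : X `<=` span_set.
Proof. exact: sub_smallest. Qed.

Fact span_set0 : span_set 0.
Proof. by move=> _ [[J ->] XJ]; apply: ideal0. Qed.
Fact span_setB x y : span_set x -> span_set y -> span_set (x - y).
Proof. by move=> Sx Sy _ [[J ->] XJ]; apply: idealB; [apply: Sx|apply: Sy]; split=> //; exists J. Qed.
Fact span_setMl a x : span_set x -> span_set (a * x).
Proof. by move=> Sx _ [[J ->] XJ]; apply: idealMl; apply: Sx; split=> //; exists J. Qed.
Fact span_setMr x a : span_set x -> span_set (x * a).
Proof. by move=> Sx _ [[J ->] XJ]; apply: Defs.idealMr; apply: Sx; split=> //; exists J. Qed.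

Definition span_ideal : ideal A := Ideal span_set0 span_setB span_setMl span_setMr.

End GeneratedIdeal.

(** Left ideals of the quotient are measured by their preimages. These contain the nonzero ideal
    [P], so their measure is positive and lowering it by 1 loses no strict inclusion. *)
Lemma quotient_length (B : pzRingType) (P : ideal B) d : length_le B d.+1 ->
  (exists2 m, ideal_set P m & m <> 0) -> length_le (quotient_ring P) d.
Proof.
move=> [mu [mud mono]] [m Pm m0].
pose pre (U : set (quotient_ring P)) : set B := [set x | U (quotient_pi P x)].
have lpre U : left_ideal U -> left_ideal (pre U).
  move=> [U0 UB UM]; split; rewrite /pre /=; first by rewrite rmorph0.
    by move=> x y; rewrite rmorphB; apply: UB.
  by move=> c x; rewrite rmorphM; apply: UM.
have Ppre U : left_ideal U -> P `<=` pre U.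
  move=> [U0 _ _] x Px; rewrite /pre /=.
  suff -> : quotient_pi P x = 0 by [].
  by rewrite -[RHS](rmorph0 (quotient_pi P)); apply/quotient_pi_eq; rewrite subr0.
have lP : left_ideal P by split; [exact: ideal0|exact: idealB|exact: idealMl].
have pos U : left_ideal U -> (0 < mu (pre U))%N.
  move=> lU; have [le1 eq1] : _ /\ _ := mono _ _ (@left_ideal0 B) lP (ltac:(by move=> _ ->; apply: ideal0)).
  have [le2 _] := mono _ _ lP (lpre _ lU) (Ppre _ lU).
  apply: leq_trans le2; rewrite lt0n; apply/negP => /eqP E.
  by apply: m0; apply: (eq1 _ m Pm); apply/eqP; rewrite eqn_leq le1 E.
exists (fun U => (mu (pre U)).-1); split.
  by move=> U lU; rewrite -ltnS prednK ?pos // mud //; apply: lpre.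
move=> U V lU lV UV.
have [le eq] := mono _ _ (lpre _ lU) (lpre _ lV) (fun x => UV _).
split; first by rewrite -ltnS !prednK ?pos.
move=> E x; rewrite -[x]quotient_repK => Vx; apply: (eq _ _ Vx).
by rewrite -[LHS]prednK ?pos // E prednK ?pos.
Qed.

(** If [B] is not semiprime, some [m <> 0] has [m B m = 0]. The ideal [P] it generates has square
    zero, the quotient by [P] is shorter, and invertibility lifts modulo [P]. *)
Lemma finite_length_stable_range (d : nat) (B : pzRingType) (a b x y : B) :
  length_le B d -> x * a + y * b = 1 ->
  exists t z, z * (a + t * b) = 1 /\ (a + t * b) * z = 1.
Proof.
move=> lenB ab1; suff [t [z E]] : exists t z, z * (a + t * b) = 1.
  by exists t, z; split=> //; exact: (dedekind_finite lenB E).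
elim: d B a b x y lenB ab1 => [|d IH] B a b x y lenB ab1.
  exists 0, 0; have [mu [mud mono]] := lenB.
  have [_ eq] := mono _ _ (@left_ideal0 B) (left_idealT B) (fun _ _ => I).
  have z1 : (1 : B) = 0.
    apply: eq => //; have := mud _ (@left_ideal0 B); have := mud _ (left_idealT B).
    by rewrite !leqn0 => /eqP -> /eqP ->.
  by rewrite mul0r z1.
have [sp|] := pselect (forall m : B, (forall x, m * x * m = 0) -> m = 0).
  exact: semiprime_stable_range lenB sp _ _ _ _ ab1.
move=> /existsNP[m /not_implyP[mm m0]].
pose P := span_ideal [set m].
have Pm : ideal_set P m by apply: sub_span.
(* [P P = 0] is shown in two steps: [P] lies in [J1], so [P m = 0], so [m] and with it [P] lies in
   the right annihilator [J2] of [P]. *)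
have [J1 J1E] : exists J : ideal B, J = [set p | forall x, p * x * m = 0] :> set B.
  unshelve eexists (Ideal (ideal_set := [set p | forall x, p * x * m = 0]) _ _ _ _) => //=.
  - by move=> w; rewrite !mul0r.
  - by move=> u v Hu Hv w; rewrite !mulrBl Hu Hv subrr.
  - by move=> c u Hu w; rewrite -!mulrA (mulrA u) Hu mulr0.
  - by move=> u c Hu w; rewrite -(mulrA u) Hu.
have PJ1 : P `<=` J1 by apply: span_sub => _ ->; rewrite J1E.
have [J2 J2E] : exists J : ideal B, J = [set q | forall p, ideal_set P p -> p * q = 0] :> set B.
  unshelve eexists (Ideal (ideal_set := [set q | forall p, ideal_set P p -> p * q = 0]) _ _ _ _) => //=.
  - by move=> p Pp; rewrite mulr0.
  - by move=> u v Hu Hv p Pp; rewrite mulrBr Hu // Hv // subrr.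
  - by move=> c u Hu p Pp; rewrite mulrA Hu //; apply: span_setMr.
  - by move=> u c Hu p Pp; rewrite mulrA Hu // mul0r.
have PJ2 : P `<=` J2.
  apply: span_sub => _ ->; rewrite J2E => p /PJ1; rewrite J1E => /(_ 1).
  by rewrite mulr1.
have PP p q : ideal_set P p -> ideal_set P q -> p * q = 0.
  by move=> Pp /PJ2; rewrite J2E; apply.
pose f := quotient_pi P.
have [||t [z]] := IH (quotient_ring P) (f a) (f b) (f x) (f y).
- by apply: quotient_length lenB _; exists m.
- by rewrite -!rmorphM -rmorphD ab1 rmorph1.
rewrite -[t]quotient_repK -[z]quotient_repK -rmorphM -rmorphD -rmorphM -(rmorph1 f).
set z' := repr _; set t' := repr _ => /quotient_pi_eq Pq.
(* [z' (a + t' b) = 1 + p] with [p] in [P], and [1 - p] inverts [1 + p] because [p p = 0]. *)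
exists t', ((1 - (z' * (a + t' * b) - 1)) * z').
rewrite -mulrA; set w := z' * (a + t' * b) in Pq *.
rewrite -{2}[w](subrK 1); set p := w - 1 in Pq *.
move: p Pq => p Pp.
have pp : p * p = 0 by exact: (PP p p Pp Pp).
by rewrite mulrBl mul1r mulrDr mulr1 pp add0r [p + 1]addrC addrK.
Qed.

(** * Localization of module finite algebras *)

Section IdealTheory.
Variables (A : pzRingType) (I : ideal A).

Lemma idealN x : ideal_set I x -> ideal_set I (- x).
Proof. by move=> Ix; rewrite -sub0r; apply: idealB => //; apply: ideal0. Qed.

Lemma idealD x y : ideal_set I x -> ideal_set I y -> ideal_set I (x + y).
Proof. by move=> Ix Iy; rewrite -[y]opprK; apply: idealB => //; apply: idealN. Qed.

Lemma ideal_sum (T : Type) (r : seq T) (P : pred T) (F : T -> A) :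
  (forall i, P i -> ideal_set I (F i)) -> ideal_set I (\sum_(i <- r | P i) F i).
Proof. by move=> IF; elim/big_ind: _ => //; [exact: ideal0|exact: idealD]. Qed.

End IdealTheory.

Lemma ideal_inj (A : pzRingType) : injective (@ideal_set A).
Proof.
move=> [U U1 U2 U3 U4] [V V1 V2 V3 V4] /= E; subst V.
by congr Ideal; apply: Prop_irrelevance.
Qed.

(** Maximality in the form in which it is applied: every element outside [M] is invertible modulo
    [M]. *)
Definition maximal_ideal (R : comPzRingType) (M : ideal R) : Prop :=
  ~ ideal_set M 1 /\ forall x, ~ ideal_set M x -> exists y, ideal_set M (1 - y * x).

Lemma maximal_ideal_prime (R : comPzRingType) (M : ideal R) (x y : R) :
  maximal_ideal M -> ~ ideal_set M x -> ~ ideal_set M y -> ~ ideal_set M (x * y).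
Proof.
move=> [_ inv] Mx My Mxy; apply: My; have [w Mw] := inv _ Mx.
rewrite -[y]mul1r -[1](subrK (w * x)) mulrDl.
by apply: idealD; [apply: Defs.idealMr|rewrite -mulrA; apply: idealMl].
Qed.

Lemma exists_maximal_ideal (R : comPzRingType) (S : ideal R) :
  ~ ideal_set S 1 -> exists2 M : ideal R, maximal_ideal M & S `<=` M.
Proof.
move=> S1; pose good (J : ideal R) := S `<=` J /\ ~ ideal_set J 1.
pose T := {J : ideal R | good J}.
pose le (u v : T) : bool := `[< ideal_set (sval u) `<=` ideal_set (sval v) >].
have [|||F totF|[M [SM M1]] Mmax] := @Zorn T le.
- by move=> u; apply/asboolP.
- by move=> u v w /asboolP uv /asboolP vw; apply/asboolP => x /uv/vw.
- move=> [U gU] [V gV] /asboolP UV /asboolP VU; apply: eq_exist => /=.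
  by apply: ideal_inj; rewrite eqEsubset.
- have [[u0 Fu0]|F0] := pselect (exists u, F u); last first.
    by exists (exist _ S (conj (fun x => id) S1)) => u Fu; case: F0; exists u.
  have [J JE] : exists J : ideal R, J = [set x | exists2 u, F u & ideal_set (sval u) x] :> set R.
    unshelve eexists (Ideal (ideal_set := [set x | exists2 u, F u & ideal_set (sval u) x]) _ _ _ _) => //=.
    + by exists u0 => //; apply: ideal0.
    + move=> x y [u Fu ux] [v Fv vy].
      have [/asboolP uv|/asboolP vu] := totF u v Fu Fv.
        by exists v => //; apply: idealB => //; apply: uv.
      by exists u => //; apply: idealB => //; apply: vu.
    + by move=> a x [u Fu ux]; exists u => //; apply: idealMl.
    + by move=> x a [u Fu ux]; exists u => //; apply: Defs.idealMr.
  have gJ : good J.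
    split; rewrite JE; last by case=> -[U [? U1]].
    by move=> x Sx; exists u0 => //; case: (u0) => U []/= + _; apply.
  by exists (exist _ J gJ) => u Fu; apply/asboolP => x ux /=; rewrite JE; exists u.
exists M => //; split=> // x Mx; apply: contrapT => no.
(* [J] is [M + R x]. It is proper if [x] has no inverse modulo [M], which contradicts the maximality
   of [M]. *)
have [J JE] : exists J : ideal R, J = [set z | exists y, ideal_set M (z - y * x)] :> set R.
  unshelve eexists (Ideal (ideal_set := [set z | exists y, ideal_set M (z - y * x)]) _ _ _ _) => //=.
  + by exists 0; rewrite mul0r subr0; apply: ideal0.
  + move=> z w [y My] [y' My']; exists (y - y').
    have -> : z - w - (y - y') * x = z - y * x - (w - y' * x).
      by rewrite mulrBl !opprB addrACA [RHS]addrACA [- w + _]addrC.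
    exact: idealB.
  + by move=> a z [y My]; exists (a * y); rewrite -mulrA -mulrBr; apply: idealMl.
  + by move=> z a [y My]; exists (a * y); rewrite mulrC -mulrA -mulrBr; apply: idealMl.
have MJ : M `<=` J by move=> z Mz; rewrite JE; exists 0; rewrite mul0r subr0.
have gJ : good J.
  split=> [z /SM/MJ //|]; rewrite JE => -[y My]; apply: no; exists y => //.
have /(congr1 sval)/= JM : exist good J gJ = exist good M (conj SM M1).
  by apply: Mmax; apply/asboolP.
apply: Mx; rewrite -JM JE; exists 1; rewrite mul1r subrr; exact: ideal0.
Qed.

Section ModuleFinite.
Variables (R : comPzRingType) (A : pzRingType) (alg : {rmorphism R -> A}).
Hypothesis alg_central : central_morphism alg.
Variables (k : nat) (b : 'I_k -> A).
Hypothesis b_gen : forall x, exists c : 'I_k -> R, x = \sum_(i < k) alg (c i) * b i.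
Variable M : ideal R.
Hypothesis maxM : maximal_ideal M.

Let MA : set A := [set x | exists2 c : 'I_k -> R, forall i, ideal_set M (c i) &
  x = \sum_(i < k) alg (c i) * b i].

Let MA_alg r x : ideal_set M r -> MA (alg r * x).
Proof.
move=> Mr; have [c ->] := b_gen x; exists (fun i => r * c i).
  by move=> i; apply: Defs.idealMr.
by rewrite mulr_sumr; apply: eq_bigr => i _; rewrite rmorphM mulrA.
Qed.

Let MA0 : MA 0.
Proof. by rewrite -[0](mul0r 0) -(rmorph0 alg); apply: MA_alg; apply: ideal0. Qed.

Let MAB x y : MA x -> MA y -> MA (x - y).
Proof.
move=> [c Mc ->] [c' Mc' ->]; exists (fun i => c i - c' i).
  by move=> i; apply: idealB.
by rewrite -sumrB; apply: eq_bigr => i _; rewrite rmorphB mulrBl.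
Qed.

Let MA_sum (F : 'I_k -> A) : (forall i, MA (F i)) -> MA (\sum_i F i).
Proof.
move=> MF; elim/big_ind: _ => // x y Mx My.
by rewrite -[y]opprK; apply: MAB => //; rewrite -sub0r; apply: MAB.
Qed.

Let MAMl a x : MA x -> MA (a * x).
Proof.
move=> [c Mc ->]; rewrite mulr_sumr; apply: MA_sum => i.
by rewrite mulrA -alg_central -mulrA; apply: MA_alg.
Qed.

Let MAMr x a : MA x -> MA (x * a).
Proof.
by move=> [c Mc ->]; rewrite mulr_suml; apply: MA_sum => i; rewrite -mulrA; apply: MA_alg.
Qed.

Let J : ideal A := Ideal MA0 MAB MAMl MAMr.

(* mu U counts the i such that b_i is the leading term of an element of U. *)
Let residue_length : length_le (quotient_ring J) k.
Proof.
have f0 x : MA x -> quotient_pi J x = 0.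
  by move=> Mx; rewrite -[RHS](rmorph0 (quotient_pi J)); apply/quotient_pi_eq; rewrite subr0.
have fD x y : quotient_pi J (x + y) = quotient_pi J x + quotient_pi J y by exact: quotient_piD.
have fB x y : quotient_pi J (x - y) = quotient_pi J x - quotient_pi J y by exact: quotient_piB.
have fM x y : quotient_pi J (x * y) = quotient_pi J x * quotient_pi J y by exact: quotient_piM.
pose lead (U : set (quotient_ring J)) (i : 'I_k) := `[< exists c : 'I_k -> R,
  U (quotient_pi J (b i + \sum_(j < k | (j < i)%N) alg (c j) * b j)) >].
exists (fun U => #|lead U|); split=> [U _|U V [U0 UB UM] [V0 VB VM] UV].
  by rewrite -[X in (_ <= X)%N]card_ord max_card.
have sub : lead U \subset lead V.
  by apply/fintype.subsetP => i /asboolP[c Uc]; apply/asboolP; exists c; apply: UV.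
split; first exact: subset_leq_card.
move=> E; have {E sub}leadE : lead V =i lead U.
  by move=> i; rewrite -(elimT (subset_cardP E) sub).
(* Reduction of an element of [V] by its leading term. A leading coefficient in [M] vanishes in the
   quotient; any other one is invertible modulo [M], and since [U] has the same leading indices as
   [V], an element of [U] cancels it. *)
suff key j (c : 'I_k -> R) : (j <= k)%N -> V (quotient_pi J (\sum_(i < k | (i < j)%N) alg (c i) * b i)) ->
    U (quotient_pi J (\sum_(i < k | (i < j)%N) alg (c i) * b i)).
  move=> x; rewrite -[x]quotient_repK; set y := repr _; have [c ->] := b_gen y.
  have := key k c (leqnn k); rewrite (eq_bigl predT) //.
  by move=> i; rewrite /= ltn_ord.
have UD x y : U x -> U y -> U (x + y) by apply: left_idealD.
elim: j c => [|j IH] c jk; first by rewrite big_pred0 // f0.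
pose i := Ordinal jk.
have split_sum (d : 'I_k -> R) : \sum_(l < k | (l < j.+1)%N) alg (d l) * b l
    = alg (d i) * b i + \sum_(l < k | (l < j)%N) alg (d l) * b l.
  rewrite (bigD1 i) //=; congr (_ + _); apply: eq_bigl => l.
  by rewrite ltnS -val_eqE /= andbC -ltn_neqAle.
have [Mc|Mc] := pselect (ideal_set M (c i)).
  rewrite split_sum fD [quotient_pi J (alg _ * _)]f0 ?add0r; last exact: MA_alg.
  by apply: IH; apply: ltnW.
have [_ /(_ _ Mc) [y My]] := maxM.
move=> Vx; have : i \in lead V.
  apply/asboolP; exists (fun l => y * c l).
  have /(VM (quotient_pi J (alg y))) := Vx; rewrite -fM mulr_sumr.
  congr (V _); apply/quotient_pi_eq.
  have -> : \sum_(l < k | (l < j.+1)%N) alg y * (alg (c l) * b l)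
    = \sum_(l < k | (l < j.+1)%N) alg (y * c l) * b l.
    by apply: eq_bigr => l _; rewrite rmorphM mulrA.
  rewrite split_sum /= [b i + _]addrC addrKA -[X in _ - X]mul1r -(rmorph1 alg) -mulrBl -rmorphB.
  by rewrite -opprB rmorphN mulNr; apply: (@idealN _ J); apply: MA_alg.
rewrite leadE => /asboolP[d Ud].
set u := quotient_pi J _ in Ud; set v := quotient_pi J _ in Vx *.
rewrite -[v](subrK (quotient_pi J (alg (c i)) * u)); apply: UD; last exact: UM.
have vuE : v - quotient_pi J (alg (c i)) * u = quotient_pi J (\sum_(l < k | (l < j)%N) alg (c l - c i * d l) * b l).
  rewrite /u /v -fM -fB split_sum mulrDr opprD addrACA subrr add0r mulr_sumr -sumrB.
  by congr (quotient_pi J _); apply: eq_bigr => l _; rewrite rmorphB rmorphM mulrBl mulrA.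
rewrite vuE; apply: IH; first exact: ltnW.
by rewrite -vuE; apply: VB => //; apply/VM/UV.
Qed.

Let det_cong (D : 'M[R]_k) : (forall i j, ideal_set M (D i j - (1%:M : 'M_k) i j)) ->
  ideal_set M (\det D - 1).
Proof.
move=> MD; rewrite -(det1 R k) /determinant.
elim/big_ind2: _ => [|x x' y y' Hx Hy|s _].
- by rewrite subrr; apply: ideal0.
- by rewrite opprD addrACA; apply: idealD.
rewrite -mulrBr; apply: idealMl; elim/big_ind2: _ => [|x' x y' y Hx Hy|i _].
- by rewrite subrr; apply: ideal0.
- suff: ideal_set M ((x - x') * y + x' * (y - y')) by rewrite mulrBl mulrBr addrA subrK.
  by apply: idealD; [apply: Defs.idealMr|apply: idealMl].
exact: MD.
Qed.

(** Determinant trick: on the generators [phi] is given by a matrix [DM] congruent to 1 modulo [M],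
    and the adjugate produces a preimage of [det DM]. An abstract [phi] covers left and right
    multiplications alike. *)
Let nakayama (phi : A -> A) : {morph phi : x y / x + y} -> phi 0 = 0 ->
  (forall r x, phi (alg r * x) = alg r * phi x) -> (forall x, MA (phi x - x)) ->
  exists2 s, ~ ideal_set M s & exists y, phi y = alg s.
Proof.
move=> phiD phi0 phiZ phi1.
have /choice[D MD] i : exists d : 'I_k -> R, (forall j, ideal_set M (d j - (1%:M : 'M_k) i j)) /\
    phi (b i) = \sum_(j < k) alg (d j) * b j.
  have [c Mc E] := phi1 (b i); exists (fun j => c j + (1%:M : 'M_k) i j).
  split=> [j|]; first by rewrite addrK.
  rewrite -[LHS](subrK (b i)) E.
  under [RHS]eq_bigr do rewrite rmorphD mulrDl; rewrite big_split; congr (_ + _).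
  rewrite (bigD1 i) //= mxE eqxx rmorph1 mul1r big1 ?addr0 // => j ji.
  by rewrite mxE eq_sym (negPf ji) rmorph0 mul0r.
pose DM : 'M[R]_k := \matrix_(i, j) D i j.
exists (\det DM) => [Md|].
  have [M1 _] := maxM; apply: M1; rewrite -[1](subKr (\det DM)).
  by apply: idealB => //; apply: det_cong => i j; rewrite mxE; apply: (MD i).1.
have [e e1] := b_gen 1.
exists (\sum_l \sum_i alg (e l * (\adj DM) l i) * b i).
rewrite (big_morph _ phiD phi0); under eq_bigr => l _.
  rewrite (big_morph _ phiD phi0); under eq_bigr => i _ do rewrite phiZ (MD i).2 mulr_sumr.
  rewrite exchange_big /=.
  have -> : \sum_j \sum_i alg (e l * (\adj DM) l i) * (alg (D i j) * b j)
      = alg (\det DM) * (alg (e l) * b l).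
    transitivity (\sum_j alg (e l * (\adj DM *m DM) l j) * b j).
      apply: eq_bigr => j _; rewrite mxE mulr_sumr rmorph_sum mulr_suml.
      by apply: eq_bigr => i _; rewrite [DM i j]mxE !rmorphM !mulrA.
    rewrite mul_adj_mx (bigD1 l) //= big1 ?addr0; last first.
      by move=> j jl; rewrite mxE eq_sym (negPf jl) mulr0n mulr0 rmorph0 mul0r.
    by rewrite mxE eqxx mulr1n [e l * _]mulrC rmorphM mulrA.
  over.
by rewrite -mulr_sumr -e1 mulr1.
Qed.

Lemma local_stable_range (a c x y : A) : x * a + y * c = 1 ->
  exists t u s, [/\ ~ ideal_set M s, u * (a + t * c) = alg s & (a + t * c) * u = alg s].
Proof.
move=> ac1; pose f := quotient_pi J.
have [||t' [z' []]] := @finite_length_stable_range k (quotient_ring J) (f a) (f c) (f x) (f y).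
- exact: residue_length.
- by rewrite -!(rmorphM (quotient_pi J)) -(rmorphD (quotient_pi J)) ac1 rmorph1.
have [t tE] : exists t, quotient_pi J t = t' by exists (repr (t' : Quotient.quot _)); exact: quotient_repK.
have [z zE] : exists z, quotient_pi J z = z' by exists (repr (z' : Quotient.quot _)); exact: quotient_repK.
set d' := _ + _ * _ => zd dz; exists t; set d := a + t * c.
have dE : quotient_pi J d = d' by rewrite rmorphD rmorphM /d' -tE.
have Jz : ideal_set J (z * d - 1).
  by apply/quotient_pi_eq; rewrite rmorphM rmorph1 -zd -dE -zE.
have Jz' : ideal_set J (d * z - 1).
  by apply/quotient_pi_eq; rewrite rmorphM rmorph1 -dz -dE -zE.
have [||||s1 Ms1 [y1 E1]] := nakayama (phi := fun w => w * (z * d)).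
- by move=> u v; rewrite mulrDl.
- by rewrite mul0r.
- by move=> r w; rewrite -mulrA.
- by move=> w; rewrite /= -{2}[w]mulr1 -mulrBr; apply: MAMl.
have [||||s2 Ms2 [y2 E2]] := nakayama (phi := fun w => d * z * w).
- by move=> u v; rewrite mulrDr.
- by rewrite mulr0.
- by move=> r w; rewrite /= mulrA -alg_central -mulrA.
- by move=> w; rewrite /= -{2}[w]mul1r -mulrBl; apply: MAMr.
rewrite /= in E1 E2.
(* [y1 z] is a left inverse of [d] up to [s1] and [z y2] a right inverse up to [s2]. As for genuine
   inverses they agree, after scaling, and give one element that works on both sides. *)
have LR : alg s1 * (z * y2) = y1 * z * alg s2.
  by rewrite -E1 -E2 !mulrA.
exists (alg s1 * (z * y2)), (s1 * s2); split.
- exact: maximal_ideal_prime.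
- by rewrite LR -mulrA alg_central mulrA -(mulrA y1) E1 rmorphM.
- by rewrite mulrA -alg_central -mulrA (mulrA d) E2 rmorphM.
Qed.

End ModuleFinite.

(** * Groups *)

(** Brings words to reduced form. This closes the goals that are identities of the free group and
    normalizes the others. *)
Ltac free_group :=
  rewrite ?(invgM, invgK, mul1g, mulg1, invg1);
  repeat (rewrite -?mulgA ?(mulKg, mulVKg, mulVg, mulgV, mul1g, mulg1)); try by [].

Section GroupTheory.
Local Open Scope group_scope.
Variable G : groupType.
Implicit Types (x y z g : G) (H K X : set G).

Definition cmt x y := x * y * x^-1 * y^-1.

Lemma cmt_eq1 x y : cmt x y = 1 <-> commute x y.
Proof.
rewrite /cmt /commute; split=> [E|->]; last by free_group.
by rewrite -[RHS]mul1g -E; free_group.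
Qed.

Lemma cmtMl x x' y : cmt (x * x') y = x * cmt x' y * x^-1 * cmt x y.
Proof. by rewrite /cmt; free_group. Qed.

Lemma cmtMr x y y' : cmt x (y * y') = cmt x y * (y * cmt x y' * y^-1).
Proof. by rewrite /cmt; free_group. Qed.

Lemma cmtV x y : (cmt x y)^-1 = cmt y x.
Proof. by rewrite /cmt; free_group. Qed.

Lemma cmtJ g x y : g * cmt x y * g^-1 = cmt (g * x * g^-1) (g * y * g^-1).
Proof. by rewrite /cmt; free_group. Qed.

Lemma mulg_cmt g x : g * x * g^-1 = cmt g x * x.
Proof. by rewrite /cmt; free_group. Qed.

Lemma conjV_cmt g x : g^-1 * x * g = (cmt x g^-1)^-1 * x.
Proof. by rewrite /cmt; free_group. Qed.

Lemma commute_conj x y : commute x y -> x * y * x^-1 = y.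
Proof. by move->; free_group. Qed.

Lemma commuteMl x y z : commute x z -> commute y z -> commute (x * y) z.
Proof. by move=> /commute_sym xz /commute_sym yz; apply/commute_sym/commuteM. Qed.

Lemma commuteVl x y : commute x y -> commute x^-1 y.
Proof. by move=> /commute_sym/commuteV/commute_sym. Qed.

Lemma commute_cmt x y z : commute x z -> commute y z -> commute (cmt x y) z.
Proof.
by move=> xz yz; rewrite /cmt; do 2![apply: commuteMl; last exact: commuteVl]; apply: commuteMl.
Qed.

Lemma commuteJ g x y : commute x (g * y * g^-1) <-> commute (g^-1 * x * g) y.
Proof.
rewrite /commute; split=> E.
  by have /(congr1 (fun w => g^-1 * w * g)) := E; free_group.
by have /(congr1 (fun w => g * w * g^-1)) := E; free_group.
Qed.

(** A form of the Hall-Witt identity: conjugation by [w] turns [[x, y]] into [[x j, y l]], in which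
    [l] cancels because it commutes with [x j]. *)
Lemma cmt_exchange x y w j l : w * x * w^-1 = x * j -> w * y * w^-1 = y * l ->
  commute l x -> commute l j -> cmt (cmt x y) w = x * cmt y j * x^-1.
Proof.
move=> wx wy lx lj.
have E : cmt (x * j) (y * l) = x * j * y * j^-1 * x^-1 * y^-1.
  have lxj : (x * j)^-1 * l^-1 = l^-1 * (x * j)^-1.
    by rewrite -!invgM; congr (_^-1); apply: commuteM.
  rewrite /cmt [(y * l)^-1]invgM -[_ * (x * j)^-1 * _]mulgA [(x * j)^-1 * _]mulgA lxj.
  by free_group.
have -> : cmt (cmt x y) w = cmt x y * (cmt (x * j) (y * l))^-1.
  by rewrite -wx -wy /cmt; free_group.
by rewrite E /cmt; free_group.
Qed.

Lemma cmt_absorb x y a b : commute a y -> commute a b -> commute b x ->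
  cmt (x * a) (y * b) = cmt x y.
Proof.
move=> ay ab bx; have ayb : cmt a (y * b) = 1 by apply/cmt_eq1/commuteM.
have xb : cmt x b = 1 by apply/cmt_eq1/commute_sym.
by rewrite cmtMl ayb mulg1 mulgV mul1g cmtMr xb mulg1 mulgV mulg1.
Qed.

(** The form of the right-hand side matters: it is a product of conjugates of [[x, j]^-1] and
    [[l, y j]^-1]. When these commute with E(K) modulo the kernel at hand, the conjugating elements
    count only modulo E(K). *)
Lemma cmt_cmt_expand x y w l j : w * x * w^-1 = x * l -> w * y * w^-1 = y * j ->
  cmt (cmt x y) w = (x * y * x^-1) * (cmt x j)^-1 * (x * y * x^-1)^-1
                    * (x * (cmt l (y * j))^-1 * x^-1).
Proof.
move=> wx wy; have -> : cmt (cmt x y) w = cmt x y * (cmt (x * l) (y * j))^-1.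
  by rewrite -wx -wy /cmt; free_group.
by rewrite /cmt; free_group.
Qed.

Lemma generated_subgroup X : is_subgroup (generated X).
Proof.
split=> [H [[]]//|x y Gx Gy H HX|x Gx H HX].
  by have [[_ HM _] _] := HX; apply: HM; [apply: Gx|apply: Gy].
by have [[_ _ HV] _] := HX; apply: HV; apply: Gx.
Qed.

Lemma generated_sub X H : is_subgroup H -> X `<=` H -> generated X `<=` H.
Proof. by move=> sH XH; apply: smallest_sub. Qed.

Lemma sub_generated X : X `<=` generated X.
Proof. exact: sub_smallest. Qed.

Lemma normal_closure_normal K X : is_subgroup K -> X `<=` K ->
  is_normal_subgroup K (normal_closure K X).
Proof.
move=> sK XK; have nK : is_normal_subgroup K K.
  split=> // x h Kx Kh; have [_ KM KV] := sK.
  by apply: (KM); [apply: (KM)|apply: KV].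
split; last first.
- move=> x h Kx Gh H HX; have [[_ _ HN] _] := HX.
  by apply: HN => //; apply: Gh.
- by apply: smallest_sub.
split=> [H [[[]]]//|x y Gx Gy H HX|x Gx H HX].
  by have [[[_ HM _] _ _] _] := HX; apply: HM; [apply: Gx|apply: Gy].
by have [[[_ _ HV] _ _] _] := HX; apply: HV; apply: Gx.
Qed.

Lemma sub_normal_closure K X : X `<=` normal_closure K X.
Proof. exact: sub_smallest. Qed.

Lemma normal_closure_sub K X H : is_normal_subgroup K H -> X `<=` H ->
  normal_closure K X `<=` H.
Proof. by move=> sH XH; apply: smallest_sub. Qed.

Lemma commutator_in H K x y : H x -> K y -> commutator_subgroup H K (cmt x y).
Proof. by move=> Hx Ky; apply: sub_generated; exists x, y. Qed.

Lemma commutator_sub H K X : is_subgroup X ->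
  (forall x y, H x -> K y -> X (cmt x y)) -> commutator_subgroup H K `<=` X.
Proof.
move=> sX HX; apply: generated_sub => // _ [x [y [Hx Ky ->]]].
exact: HX.
Qed.

(** Turns memberships of commutators in [H] into commutations in a group [Q], where one can
    rewrite. *)
Lemma exists_quotient_group H : is_normal_subgroup setT H ->
  exists (Q : groupType) (f : G -> Q),
    {morph f : x y / x * y} /\ forall x, f x = 1 <-> H x.
Proof.
move=> [[H1 HM HV] _ HN].
pose e x y := `[< H (x * y^-1) >].
have er : reflexive e by move=> x; apply/asboolP; rewrite mulgV.
have eV x y : e x y -> e y x.
  by move=> /asboolP /HV Exy; apply/asboolP; move: Exy; free_group.
have es : symmetric e by move=> x y; apply/idP/idP => /eV.
have et : transitive e.
  move=> y x z /asboolP xy /asboolP yz; apply/asboolP.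
  by have := HM _ _ xy yz; free_group.
pose E := EquivRel e er es et.
pose Q : choiceType := {eq_quot E}%qT.
pose pi x : Q := (\pi_Q x)%qT.
have piE x y : pi x = pi y <-> H (x * y^-1).
  split=> [|Hxy]; first by move=> /eqmodP/asboolP.
  by apply/eqmodP/asboolP.
have rK (a : Q) : pi (repr a) = a by exact: reprK.
pose mul (a b : Q) := pi (repr a * repr b).
pose inv (a : Q) := pi (repr a)^-1.
have mulE x y : mul (pi x) (pi y) = pi (x * y).
  apply/piE; have /piE Hx := rK (pi x); have /piE Hy := rK (pi y).
  by have := HM _ _ (HN (repr (pi x)) _ I Hy) Hx; free_group.
have invE x : inv (pi x) = pi x^-1.
  apply/piE; have /piE/HV Hx := rK (pi x).
  by have := HN (repr (pi x))^-1 _ I Hx; free_group.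
have mA : associative mul.
  by move=> a b c; rewrite -[a]rK -[b]rK -[c]rK !mulE mulgA.
have m1 : left_id (pi 1) mul by move=> a; rewrite -[a]rK mulE mul1g.
have mr1 : right_id (pi 1) mul by move=> a; rewrite -[a]rK mulE mulg1.
have mV : left_inverse (pi 1) inv mul by move=> a; rewrite -[a]rK invE mulE mulVg.
have mrV : right_inverse (pi 1) inv mul by move=> a; rewrite -[a]rK invE mulE mulgV.
pose gm := isGroup.Build Q mA m1 mr1 mV mrV.
pose gQ : groupType := HB.pack Q gm.
exists gQ, pi; split=> [x y|x]; first by rewrite -mulE.
by split=> [/piE|Hx]; [rewrite invg1 mulg1|apply/piE; rewrite invg1 mulg1].
Qed.

End GroupTheory.

(** * Transvections and elementary subgroups *)

Section Transvections.
Variables (n : nat) (A : pzRingType).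
Implicit Types (g h : GL n A) (v : 'cV[A]_n) (u : 'rV[A]_n) (i j k p q : 'I_n) (I J K L : ideal A).

Definition ec i : 'cV[A]_n := delta_mx i 0.
Definition er i : 'rV[A]_n := delta_mx 0 i.

Lemma GL_mxM g h : GL_mx (g * h)%g = GL_mx g *m GL_mx h. Proof. by []. Qed.
Lemma GL_mx1 : GL_mx (1%g : GL n A) = 1%:M. Proof. by []. Qed.
Lemma GL_mxV g : GL_mx g *m GL_mx g^-1%g = 1%:M.
Proof. by rewrite -GL_mxM mulgV. Qed.
Lemma GL_mxVl g : GL_mx g^-1%g *m GL_mx g = 1%:M.
Proof. by rewrite -GL_mxM mulVg. Qed.

Fact transv_subproof v u : u *m v = 0 ->
  inverse_pair (1%:M + v *m u, 1%:M - v *m u).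
Proof.
move=> uv; have vv : v *m u *m (v *m u) = 0.
  by rewrite mulmxA -(mulmxA v) uv mulmx0 mul0mx.
by rewrite /inverse_pair /= !(mulmxDl, mulmxDr, mulmxN, mulNmx, mul1mx, mulmx1)
  vv oppr0 !addr0 addrK subrK !eqxx.
Qed.

(* The junk value 1 is taken when u v <> 0. *)
Definition transv v u : GL n A :=
  if @idP (u *m v == 0) is ReflectT uv then MkGL (transv_subproof (eqP uv)) else 1%g.

Lemma transvE v u : u *m v = 0 -> GL_mx (transv v u) = 1%:M + v *m u.
Proof. by rewrite /transv => uv; case: {-}_ / idP => //; rewrite uv eqxx. Qed.

Lemma transv_congr v u v' u' : u *m v = 0 -> u' *m v' = 0 ->
  v *m u = v' *m u' -> transv v u = transv v' u'.
Proof. by move=> uv uv' E; apply: GL_mx_inj; rewrite !transvE // E. Qed.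

Lemma mulmx_1D (X Y : 'M[A]_n) :
  (1%:M + X) *m (1%:M + Y) = 1%:M + (X + Y + X *m Y).
Proof.
rewrite mulmxDl mul1mx mulmxDr mulmx1 -!addrA; congr (_ + _); exact: addrCA.
Qed.

Lemma transvDl v v' u : u *m v = 0 -> u *m v' = 0 ->
  transv (v + v') u = (transv v u * transv v' u)%g.
Proof.
move=> uv uv'; have uD : u *m (v + v') = 0 by rewrite mulmxDr uv uv' addr0.
apply: GL_mx_inj; rewrite GL_mxM !transvE //.
by rewrite mulmx_1D mulmxDl mulmxA -(mulmxA v) uv' mulmx0 mul0mx addr0.
Qed.

Lemma transvDr v u u' : u *m v = 0 -> u' *m v = 0 ->
  transv v (u + u') = (transv v u * transv v u')%g.
Proof.
move=> uv uv'; have uD : (u + u') *m v = 0 by rewrite mulmxDl uv uv' addr0.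
apply: GL_mx_inj; rewrite GL_mxM !transvE //.
by rewrite mulmx_1D mulmxDr mulmxA -(mulmxA v) uv mulmx0 mul0mx addr0.
Qed.

Lemma transv0l u : transv 0 u = 1%g.
Proof. by apply: GL_mx_inj; rewrite transvE ?mulmx0 // mul0mx addr0. Qed.

Lemma transv0r v : transv v 0 = 1%g.
Proof. by apply: GL_mx_inj; rewrite transvE ?mul0mx // mulmx0 addr0. Qed.

Lemma transvNr v u : u *m v = 0 -> transv v (- u) = (transv v u)^-1%g.
Proof.
move=> uv; apply/esym/mulg1_eq; rewrite -transvDr // ?mulNmx ?uv ?oppr0 //.
by rewrite subrr transv0r.
Qed.

Lemma transvNl v u : u *m v = 0 -> transv (- v) u = (transv v u)^-1%g.
Proof.
by move=> uv; rewrite -transvNr //; apply: transv_congr; rewrite ?mulmxN ?mulNmx ?uv ?oppr0.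
Qed.

Lemma transvJ g v u : u *m v = 0 ->
  (g * transv v u * g^-1)%g = transv (GL_mx g *m v) (u *m GL_mx g^-1%g).
Proof.
move=> uv; apply: GL_mx_inj; rewrite !GL_mxM !transvE //; last first.
  by rewrite mulmxA -(mulmxA u) GL_mxVl mulmx1.
by rewrite mulmxDr mulmx1 mulmxDl GL_mxV !mulmxA.
Qed.

Lemma transvJV g v u : u *m v = 0 ->
  (g^-1 * transv v u * g)%g = transv (GL_mx g^-1%g *m v) (u *m GL_mx g).
Proof. by move=> uv; have := @transvJ g^-1%g v u uv; rewrite invgK. Qed.

Lemma er_ec i j : er i *m ec j = (i == j)%:R%:M.
Proof.
rewrite /er /ec; case: eqVneq => [->|ij].
  by rewrite mul_delta_mx; apply/matrixP => k l; rewrite !mxE !ord1.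
rewrite mul_delta_mx_0 //; apply/matrixP => k l; rewrite !mxE !ord1; by [].
Qed.

Lemma er_mul i v : er i *m v = (v i 0)%:M.
Proof.
rewrite -rowE; apply/matrixP => k l; rewrite !mxE !ord1 eqxx; by [].
Qed.

Lemma mul_ec u j : u *m ec j = (u 0 j)%:M.
Proof.
rewrite -colE; apply/matrixP => k l; rewrite !mxE !ord1 eqxx; by [].
Qed.

(** The means by which [1 + v u] is recognized as elementary: a common zero coordinate [k] of [v]
    and [u] splits it into a column and a row transvection through [k]. *)
Lemma cmt_transv_block v u k : v k 0 = 0 -> u 0 k = 0 -> u *m v = 0 ->
  cmt (transv v (er k)) (transv (ec k) u) = transv v u.
Proof.
move=> vk uk uv.
have kv : er k *m v = 0 by rewrite er_mul vk; apply/matrixP => i j; rewrite !mxE mul0rn.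
have uk' : u *m ec k = 0 by rewrite mul_ec uk; apply/matrixP => i j; rewrite !mxE mul0rn.
have -> : cmt (transv v (er k)) (transv (ec k) u) =
    (transv v (er k) * transv (ec k) u * (transv v (er k))^-1 * (transv (ec k) u)^-1)%g by [].
rewrite transvJ // -transvNr // !transvE ?mulNmx ?kv ?oppr0 //.
rewrite mulmxN mulmxBr mulmx1 mulmxA uv mul0mx subr0 mulmxDl mul1mx -mulmxA er_ec eqxx mulmx1.
by rewrite [ec k + v]addrC transvDl // mulgK.
Qed.

Definition elem i j (x : A) : GL n A := transv (ec i) (x *: er j).

Lemma elem_ortho i j x : i != j -> (x *: er j) *m ec i = 0.
Proof. by move=> ij; rewrite -scalemxAl er_ec eq_sym (negPf ij) scale_scalar_mx mulr0 -scalemx1 scale0r. Qed.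

Lemma elementaryE i j x (ij : i != j) : elementary x ij = elem i j x.
Proof.
apply: GL_mx_inj; rewrite transvE ?elem_ortho // /GL_mx /= /elementary_mx; congr (_ + _).
rewrite /ec /er -[x *: delta_mx 0 j]mul_scalar_mx.
apply/matrixP => k l; rewrite !mxE big_ord1 !mxE big_ord1 !mxE !eqxx mulr1n andbT /=.
by case: (k == i); rewrite /= ?mul1r ?mulr0 ?mul0r.
Qed.

Lemma elemD i j x y : i != j -> elem i j (x + y) = (elem i j x * elem i j y)%g.
Proof. by move=> ij; rewrite /elem scalerDl transvDr // elem_ortho. Qed.

Lemma elemN i j x : i != j -> elem i j (- x) = (elem i j x)^-1%g.
Proof. by move=> ij; rewrite /elem scaleNr transvNr // elem_ortho. Qed.

Lemma elem0 i j : elem i j 0 = 1%g.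
Proof. by rewrite /elem scale0r transv0r. Qed.

(** Columns are scaled on the right, so that over a noncommutative ring a scalar can still cross the
    product: [(v c) u = v (c u)]. *)
Definition colZ v (c : A) : 'cV[A]_n := \col_i (v i 0 * c).

Lemma colZE v c : colZ v c = v *m c%:M.
Proof. by apply/matrixP => i j; rewrite !mxE big_ord1 !mxE !ord1 eqxx. Qed.

Lemma colZD v v' c : colZ (v + v') c = colZ v c + colZ v' c.
Proof. by apply/matrixP => i j; rewrite !mxE mulrDl. Qed.

Lemma mul_colZ (B : 'M[A]_n) v c : B *m colZ v c = colZ (B *m v) c.
Proof. by rewrite !colZE mulmxA. Qed.

Lemma colZ_mul v c u : colZ v c *m u = v *m (c *: u).
Proof. by rewrite colZE -mulmxA mul_scalar_mx. Qed.

Lemma row_colZ u v c : u *m v = 0 -> u *m colZ v c = 0.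
Proof. by move=> uv; rewrite colZE mulmxA uv mul0mx. Qed.

Lemma rowZ_col u v c : u *m v = 0 -> (c *: u) *m v = 0.
Proof. by move=> uv; rewrite -scalemxAl uv scaler0. Qed.

Lemma elem_col i j x : i != j -> elem i j x = transv (colZ (ec i) x) (er j).
Proof.
move=> ij; apply: transv_congr; rewrite ?colZ_mul ?elem_ortho //.
by rewrite row_colZ // -[er j]scale1r elem_ortho.
Qed.

Lemma transv_colZ v u c : u *m v = 0 -> transv (colZ v c) u = transv v (c *: u).
Proof. by move=> uv; apply: transv_congr; rewrite ?row_colZ ?rowZ_col ?colZ_mul. Qed.

Lemma cmt_elem i j k x y : i != j -> j != k -> i != k ->
  cmt (elem i j x) (elem j k y) = elem i k (x * y).
Proof.
move=> ij jk ik; rewrite [elem i j x]elem_col // /elem cmt_transv_block //.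
- by rewrite transv_colZ ?elem_ortho // scalerA.
- by rewrite !mxE eq_sym (negPf ij) mul0r.
- by rewrite !mxE (negPf jk) andbF mulr0.
by rewrite row_colZ // elem_ortho.
Qed.

Section Generation.
Variable H : set (GL n A).
Hypothesis sH : is_subgroup H.

Lemma transv_col_mem v p : v p 0 = 0 ->
  (forall i, i != p -> H (elem i p (v i 0))) -> H (transv v (er p)).
Proof.
move=> vp Hv; have [H1 HM _] := sH.
have -> : v = \sum_(i | i != p) colZ (ec i) (v i 0).
  apply/matrixP => k l; rewrite ord1 summxE.
  have [->|kp] := eqVneq k p.
    rewrite vp big1 // => i ip; rewrite !mxE eq_sym (negPf ip) mul0r; by [].
  rewrite (bigD1 k) //= !mxE !eqxx mul1r big1 ?addr0 // => i /andP[_ ik].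
  by rewrite !mxE eq_sym (negPf ik) mul0r.
(* Orthogonality of the partial sums is carried along, because [transvDl] requires it. *)
suff [] : er p *m (\sum_(i | i != p) colZ (ec i) (v i 0)) = 0 /\
  H (transv (\sum_(i | i != p) colZ (ec i) (v i 0)) (er p)) by [].
elim/big_ind: _ => [|x y [px Hx] [py Hy]|i ip]; first by rewrite mulmx0 transv0l.
  by rewrite mulmxDr px py addr0 transvDl //; split=> //; apply: HM.
rewrite -elem_col //; split; last exact: Hv.
by rewrite row_colZ // -[er p]scale1r elem_ortho.
Qed.

Lemma transv_row_mem u p : u 0 p = 0 ->
  (forall i, p != i -> H (elem p i (u 0 i))) -> H (transv (ec p) u).
Proof.
move=> up Hu; have [H1 HM _] := sH.
have -> : u = \sum_(i | p != i) u 0 i *: er i.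
  apply/matrixP => l k; rewrite ord1 summxE.
  have [->|kp] := eqVneq k p.
    by rewrite up big1 // => i ip; rewrite !mxE (negPf ip) andbF mulr0.
  rewrite (bigD1 k) 1?eq_sym //= !mxE !eqxx mulr1 big1 ?addr0 // => i /andP[_ ik].
  by rewrite !mxE [k == i]eq_sym (negPf ik) andbF mulr0.
suff [] : (\sum_(i | p != i) u 0 i *: er i) *m ec p = 0 /\
  H (transv (ec p) (\sum_(i | p != i) u 0 i *: er i)) by [].
elim/big_ind: _ => [|x y [px Hx] [py Hy]|i ip]; first by rewrite mul0mx transv0r.
  by rewrite mulmxDl px py addr0 transvDr //; split=> //; apply: HM.
by split; [rewrite elem_ortho|apply: Hu].
Qed.

End Generation.


End Transvections.

Arguments ec {n A} i.
Arguments er {n A} i.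

(** * Congruence subgroups and relative elementary subgroups *)

Section ElementarySubgroups.
Variables (n : nat) (A : pzRingType).
Implicit Types (g h : GL n A) (v : 'cV[A]_n) (u : 'rV[A]_n) (i j k p q : 'I_n) (I J K L : ideal A).
Implicit Types (H : set (GL n A)).

Section Congruence.
Variable I : ideal A.

Lemma GL_mapM (B : pzRingType) (f : {rmorphism A -> B}) :
  {morph @GL_map n A B f : g h / (g * h)%g}.
Proof. by move=> g h; apply: GL_mx_inj; rewrite GL_mxM /GL_mx /= map_mxM. Qed.

Lemma GL_map1 (B : pzRingType) (f : {rmorphism A -> B}) : @GL_map n A B f 1%g = 1%g.
Proof. by apply: GL_mx_inj; rewrite /GL_mx /= map_mx1. Qed.

Lemma GL_mapV (B : pzRingType) (f : {rmorphism A -> B}) g :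
  GL_map f g^-1%g = (GL_map f g)^-1%g.
Proof. by apply/esym/mulg1_eq; rewrite -GL_mapM mulgV GL_map1. Qed.

Lemma GL_ideal_subgroup : is_subgroup (GL_ideal n I).
Proof.
split=> [|g h|g]; rewrite /GL_ideal /=; first exact: GL_map1.
  by rewrite GL_mapM => -> ->; rewrite mul1g.
by rewrite GL_mapV => ->; rewrite invg1.
Qed.

Lemma GL_ideal_conj g h : GL_ideal n I h -> GL_ideal n I (g * h * g^-1)%g.
Proof. by rewrite /GL_ideal /= !GL_mapM GL_mapV => ->; rewrite mulg1 mulgV. Qed.

Lemma GL_ideal_congr g i j : GL_ideal n I g ->
  exists2 x, ideal_set I x & GL_mx g i j = (i == j)%:R + x.
Proof.
move=> /GL_idealP/(_ i j); rewrite mxE => Ig.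
by exists (GL_mx g i j - (i == j)%:R) => //; rewrite addrC subrK.
Qed.

Lemma mulmx_idealr (B C : 'M[A]_n) :
  (forall i j, ideal_set I (B i j)) -> forall i j, ideal_set I ((B *m C) i j).
Proof. by move=> IB i j; rewrite mxE; apply: ideal_sum => k _; apply: Defs.idealMr. Qed.

End Congruence.

(** With [g = 1 + X] and [h = 1 + Y] one has [g h - h g = X Y - Y X], hence [[g, h] - 1 = (X Y - Y
    X) g^-1 h^-1]. *)
Lemma GL_ideal_cmt I J L g h :
  (forall x y, ideal_set I x -> ideal_set J y -> ideal_set L (x * y) /\ ideal_set L (y * x)) ->
  GL_ideal n I g -> GL_ideal n J h -> GL_ideal n L (cmt g h).
Proof.
move=> IJ /GL_idealP Ig /GL_idealP Jh; apply/GL_idealP.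
pose X : 'M[A]_n := GL_mx g - 1%:M; pose Y : 'M[A]_n := GL_mx h - 1%:M.
have -> : GL_mx (cmt g h) = 1%:M + (X *m Y - Y *m X) *m (GL_mx g^-1 *m GL_mx h^-1)%g.
  have -> : X *m Y - Y *m X = GL_mx (g * h)%g - GL_mx (h * g)%g.
    have E (U V : 'M[A]_n) : (U - 1%:M) *m (V - 1%:M) = U *m V - (U + V) + 1%:M.
      by rewrite mulmxBl mul1mx mulmxBr mulmx1 opprB opprD !addrA [RHS]addrAC.
    rewrite !GL_mxM /X /Y !E [GL_mx h + _]addrC.
    move: (GL_mx g + _) => s; by rewrite opprD addrACA subrr addr0 opprD addrACA subrr addr0.
  rewrite mulmxBl -!GL_mxM /cmt.
  have -> : (h * g * (g^-1 * h^-1) = 1)%g by free_group.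
  by rewrite GL_mx1 addrC subrK !mulgA.
move=> i j; rewrite mxE addrAC subrr add0r; apply: mulmx_idealr => {}i {}j.
have IX k l : ideal_set I (X k l) by rewrite !mxE; have := Ig k l; rewrite mxE.
have JY k l : ideal_set J (Y k l) by rewrite !mxE; have := Jh k l; rewrite mxE.
have -> : (X *m Y - Y *m X) i j = \sum_k (X i k * Y k j - Y i k * X k j).
  by rewrite !mxE sumrB.
by apply: ideal_sum => k _; apply: idealB; [apply: (IJ _ _ _ _).1|apply: (IJ _ _ _ _).2].
Qed.

Lemma E_gen_sub (X : set A) H : is_subgroup H ->
  (forall i j x, i != j -> X x -> H (elem i j x)) -> E_gen n X `<=` H.
Proof.
move=> sH HX; apply: generated_sub => // _ [i [j [ij [x [Xx ->]]]]].
by rewrite elementaryE; apply: HX.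
Qed.

Lemma E_gen_elem (X : set A) i j x : i != j -> X x -> E_gen n X (elem i j x).
Proof.
move=> ij Xx; apply: sub_generated; exists i, j, ij, x; split=> //.
by rewrite elementaryE.
Qed.

Lemma E_gen_subgroup (X : set A) : is_subgroup (E_gen n X).
Proof. exact: generated_subgroup. Qed.

Lemma E_full_subgroup : is_subgroup (E_full n A).
Proof. exact: generated_subgroup. Qed.

Lemma E_full_elem i j x : i != j -> E_full n A (elem i j x).
Proof. by move=> ij; apply: E_gen_elem. Qed.

Lemma E_gen_col (X : set A) v p : v p 0 = 0 -> (forall i, i != p -> X (v i 0)) ->
  E_gen n X (transv v (er p)).
Proof.
move=> vp Xv; apply: transv_col_mem vp _; first exact: E_gen_subgroup.
by move=> i ip; apply: E_gen_elem => //; apply: Xv.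
Qed.

Lemma E_gen_row (X : set A) u p : u 0 p = 0 -> (forall i, p != i -> X (u 0 i)) ->
  E_gen n X (transv (ec p) u).
Proof.
move=> up Xu; apply: transv_row_mem up _; first exact: E_gen_subgroup.
by move=> i ip; apply: E_gen_elem => //; apply: Xu.
Qed.

Variable I : ideal A.

Lemma E_gen_full (X : set A) : E_gen n X `<=` E_full n A.
Proof.
by apply: E_gen_sub => [|i j x ij _]; [exact: E_full_subgroup|exact: E_full_elem].
Qed.

Lemma E_ideal_normal : is_normal_subgroup (E_full n A) (E_ideal n I).
Proof.
by apply: normal_closure_normal; [exact: E_full_subgroup|exact: E_gen_full].
Qed.

Lemma E_ideal_subgroup : is_subgroup (E_ideal n I).
Proof. by case: E_ideal_normal. Qed.

Lemma E_ideal_full : E_ideal n I `<=` E_full n A.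
Proof. by case: E_ideal_normal. Qed.

Lemma E_ideal_conj g h : E_full n A g -> E_ideal n I h -> E_ideal n I (g * h * g^-1)%g.
Proof. by case: E_ideal_normal => _ _; apply. Qed.

Lemma E_gen_ideal : E_gen n I `<=` E_ideal n I.
Proof. exact: sub_normal_closure. Qed.

Lemma E_ideal_elem i j x : i != j -> ideal_set I x -> E_ideal n I (elem i j x).
Proof. by move=> ij Ix; apply: E_gen_ideal; apply: E_gen_elem. Qed.

Lemma E_ideal_sub H : is_subgroup H ->
  (forall g h, E_full n A g -> H h -> H (g * h * g^-1)%g) ->
  (forall i j x, i != j -> ideal_set I x -> H (elem i j x)) -> E_ideal n I `<=` H.
Proof.
move=> [H1 HM HV] HJ Hel; have [F1 FM FV] := E_full_subgroup.
(* [H] need not lie in E(A), whereas the subgroups in the definition of the normal closure must. *)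
suff: E_ideal n I `<=` (H `&` E_full n A) by move=> S g /S[].
apply: normal_closure_sub.
  split; [split=> [|x y [? ?] [? ?]|x [? ?]]|by move=> x []|move=> x h Fx [? ?]].
  - by [].
  - by split; [apply: HM|apply: FM].
  - by split; [apply: HV|apply: FV].
  - by split; [apply: HJ|apply: (FM); [apply: (FM)|apply: FV]].
apply: E_gen_sub => [|i j x ij Ix].
  split=> [|x y [? ?] [? ?]|x [? ?]]; first by [].
    by split; [apply: HM|apply: FM].
  by split; [apply: HV|apply: FV].
by split; [apply: Hel|apply: E_full_elem].
Qed.

Lemma elem_GL_ideal i j x : i != j -> ideal_set I x -> GL_ideal n I (elem i j x).
Proof.
move=> ij Ix; apply/GL_idealP => k l; rewrite transvE ?elem_ortho // mxE addrAC subrr add0r.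
by rewrite mxE big_ord1 !mxE; apply/idealMl/Defs.idealMr.
Qed.

Lemma E_ideal_GL : E_ideal n I `<=` GL_ideal n I.
Proof.
apply: E_ideal_sub => [|g h _|i j x]; [exact: GL_ideal_subgroup|exact: GL_ideal_conj|].
exact: elem_GL_ideal.
Qed.

End ElementarySubgroups.

(** * Relative normality of the elementary subgroup *)

Lemma exists_third n (i j : 'I_n) : (3 <= n)%N -> exists2 k, k != i & k != j.
Proof.
move=> n3; have : (#|[set i; j]%SET| < #|'I_n|)%N.
  by rewrite card_ord (leq_ltn_trans _ n3) // cards2; case: (i != j).
rewrite ltnNge => /negP ij; have /subsetPn[k _] : ~~ ([set: 'I_n]%SET \subset [set i; j]%SET).
  by apply/negP => /subset_leq_card; rewrite cardsT.
by rewrite !inE negb_or => /andP[]; exists k.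
Qed.

Lemma normal_cmt_congr (G : groupType) (F H : set G) (x y a b : G) :
  is_subgroup F -> is_normal_subgroup F H -> F x -> F y -> H a -> H b ->
  H (cmt (x * a) (y * b) * (cmt x y)^-1)%g.
Proof.
move=> [F1 FM FV] [[H1 HM HV] HF HN] Fx Fy Ha Hb.
have -> : (cmt (x * a) (y * b) * (cmt x y)^-1 =
  (x * a * x^-1) * ((x * y) * (b * a^-1) * (x * y)^-1) * ((x * y * x^-1) * b^-1 * (x * y * x^-1)^-1))%g.
  by rewrite /cmt; free_group.
apply: (HM); [apply: (HM)|]; apply: HN => //; rewrite ?Fx; try exact: HV.
- by apply: FM.
- by apply: HM => //; apply: HV.
by apply: (FM); [apply: FM|apply: FV].
Qed.

Section RelativeNormality.
Variables (n : nat) (A : pzRingType) (I : ideal A).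
Hypothesis n3 : (3 <= n)%N.
Implicit Types (g : GL n A) (i j k : 'I_n).

Let EM g h : E_ideal n I g -> E_ideal n I h -> E_ideal n I (g * h)%g.
Proof. by have [_ + _] := E_ideal_subgroup n I; apply. Qed.
Let EV g : E_ideal n I g -> E_ideal n I g^-1%g.
Proof. by have [_ _] := E_ideal_subgroup n I; apply. Qed.

Section Pivot.
Variables (g : GL n A) (i j : 'I_n) (s y : A).
Hypothesis g_I : GL_ideal n I g.
Hypothesis ij : i != j.
Hypothesis sC : forall x, s * x = x * s.
Hypotheses (gy : GL_mx g i i * y = s) (yg : y * GL_mx g i i = s).

Let v : 'cV[A]_n := GL_mx g *m ec i.
Let w : 'rV[A]_n := er j *m GL_mx g^-1%g.
(* Rows orthogonal to v and supported on two columns: s w is a combination of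
   them, and 1 + v c u_k is a commutator because u_k has a zero entry. *)
Let u k : 'rV[A]_n := s *: er k - (v k 0 * y) *: er i.

Let vE k : v k 0 = GL_mx g k i.
Proof. by rewrite /v /ec -colE mxE. Qed.

Let v_I k : k != i -> ideal_set I (v k 0).
Proof.
by move=> ki; rewrite vE; have [x Ix ->] := GL_ideal_congr k i g_I; rewrite (negPf ki) add0r.
Qed.

Let wv : w *m v = 0.
Proof. by rewrite /w /v mulmxA -(mulmxA (er j)) GL_mxVl mulmx1 er_ec eq_sym (negPf ij); apply/matrixP => a b; rewrite !mxE mul0rn. Qed.

Let uv k : u k *m v = 0.
Proof.
rewrite /u mulmxBl -!scalemxAl !er_mul !scale_scalar_mx [v i 0]vE -mulrA yg sC.
by rewrite subrr.
Qed.

Let uE k l : u k 0 l = s * (l == k)%:R - v k 0 * y * (l == i)%:R.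
Proof. by rewrite /u !mxE eqxx. Qed.

Let sw : s *: w = \sum_(k | k != i) w 0 k *: u k.
Proof.
have Z c k l : (c *: u k) 0 l = c * u k 0 l by rewrite mxE.
apply/matrixP => a l; rewrite ord1 {a} summxE [LHS]mxE.
have [->|li] := eqVneq l i; last first.
  rewrite (bigD1 l) //= Z uE eqxx (negPf li) mulr0 subr0 mulr1 sC big1 ?addr0 //.
  move=> k /andP[ki kl]; rewrite Z uE [l == k]eq_sym (negPf kl) (negPf li).
  by rewrite !mulr0 subr0 mulr0.
(* Only the [i]-th coordinate is not immediate: solve [w v = 0] for [w_i v_i] and multiply by [y] on
   the right, which turns [v_i y] into [s]. *)
have : (w *m v) 0 0 = 0 by rewrite wv mxE.
rewrite mxE (bigD1 i) //= => /eqP; rewrite addr_eq0 => /eqP wvi.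
rewrite sC -{1}gy -vE mulrA wvi mulNr mulr_suml -sumrN; apply: eq_bigr => k ki.
by rewrite Z uE eqxx [i == k]eq_sym (negPf ki) mulr0 mulr1 sub0r mulrN mulrA.
Qed.

(** [u k] vanishes at a third index [h], but [v] need not. Splitting off the [h]-th entry of [v]
    makes [cmt_transv_block] applicable and leaves one row transvection with coefficient [v_h] in
    [I]. *)
Let third_split k c : k != i -> exists2 h, (h != i) && (h != k) &
  let v' := v - colZ (ec h) (v h 0) in
  [/\ v' h 0 = 0, (forall l, l != h -> v' l 0 = v l 0) &
  transv v (c *: u k) = (cmt (transv (colZ v' c) (er h)) (transv (ec h) (u k)) *
     transv (ec h) ((v h 0 * c) *: u k))%g].
Proof.
move=> ki; have [h hi hk] := exists_third i k n3; exists h; first by rewrite hi.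
move=> v'; have v'h : v' h 0 = 0 by rewrite !mxE !eqxx mul1r subrr.
have uh : u k 0 h = 0.
  by rewrite uE (negPf hi) (negPf hk) !mulr0 subr0.
have uch : u k *m ec h = 0 by rewrite mul_ec uh; apply/matrixP => a b; rewrite !mxE mul0rn.
have uch' : u k *m colZ (ec h) (v h 0) = 0 by apply: row_colZ.
have uv' : u k *m v' = 0 by rewrite mulmxBr uv uch' subr0.
split=> //; first by move=> l lh; rewrite !mxE (negPf lh) mul0r subr0.
rewrite cmt_transv_block //; last exact: row_colZ.
  rewrite transv_colZ // -scalerA -[transv (ec h) (_ *: (_ *: _))]transv_colZ; last exact: rowZ_col.
  rewrite -transvDl ?subrK //; exact: rowZ_col.
by rewrite mxE v'h mul0r.
Qed.

Let row_mem k c : k != i -> ideal_set I (v k 0 * c) -> forall h, (h != i) && (h != k) ->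
  E_ideal n I (transv (ec h) ((v h 0 * c) *: u k)).
Proof.
move=> ki _ h /andP[hi hk]; apply: E_gen_ideal; apply: E_gen_row.
  by rewrite mxE uE (negPf hi) (negPf hk) !mulr0 subr0 mulr0.
by move=> l _; rewrite mxE; do 2!apply: Defs.idealMr; apply: v_I.
Qed.

Let transv_I k c : k != i -> ideal_set I c -> E_ideal n I (transv v (c *: u k)).
Proof.
move=> ki Ic; have [h hik [v'h v'l ->]] := third_split c ki.
apply: EM; last by apply: row_mem => //; apply: idealMl.
set X := transv _ _; set Y := transv _ _.
have IX : E_ideal n I X.
  apply: E_gen_ideal; apply: E_gen_col; first by rewrite mxE v'h mul0r.
  by move=> l lh; rewrite mxE; apply: idealMl.
have FY : E_full n A Y.
  apply: E_gen_row => //; have /andP[hi hk] := hik.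
  by rewrite uE (negPf hi) (negPf hk) !mulr0 subr0.
rewrite /cmt -!mulgA; apply: EM => //; rewrite mulgA.
by apply: (E_ideal_conj FY); apply: EV.
Qed.

(** Modulo [I], [v] is [e_i] and [u_j] is [s e_j], so the commutator from [third_split] is congruent
    to [[e_ih(x), e_hj(s)] = e_ij(s x)]. *)
Let transv_elem x : E_ideal n I (transv v (x *: u j) * (elem i j (s * x))^-1)%g.
Proof.
have ji : j != i by rewrite eq_sym.
have [h hij [v'h v'l ->]] := third_split x ji.
have /andP[hi hj] := hij; move: (v - _) v'h v'l => v' v'h v'l.
set c := transv (ec h) (_ *: _).
have Ic : E_ideal n I c by apply: row_mem => //; apply/Defs.idealMr/v_I.
pose d := colZ v' x - colZ (ec i) x.
have dh : d h 0 = 0 by rewrite !mxE !v'h (negPf hi) !mul0r subr0.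
have -> : transv (colZ v' x) (er h) = (elem i h x * transv d (er h))%g.
  rewrite elem_col 1?eq_sym // -transvDl ?er_mul ?dh; last 2 first.
  - by rewrite mxE !mxE (negPf hi) mul0r; apply/matrixP => a b; rewrite !mxE mul0rn.
  - by apply/matrixP => a b; rewrite !mxE mul0rn.
  by rewrite addrC subrK.
have -> : transv (ec h) (u j) = (elem h j s * transv (ec h) (- (v j 0 * y) *: er i))%g.
  rewrite -transvDr ?elem_ortho //; by rewrite scaleNr.
set X := transv d _; set Y := transv (ec h) _.
have IX : E_ideal n I X.
  apply: E_gen_ideal; apply: E_gen_col => // l lh; rewrite mxE [X in _ + X]mxE !mxE.
  rewrite v'l // eqxx andbT -mulrBl; apply: Defs.idealMr; rewrite vE.
  by have [z Iz ->] := GL_ideal_congr l i g_I; rewrite addrC addKr.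
have IY : E_ideal n I Y.
  apply: E_ideal_elem => //; rewrite -mulNr; apply: Defs.idealMr.
  by apply: idealN; apply: v_I.
set e := elem i j _.
have E : cmt (elem i h x) (elem h j s) = e by rewrite cmt_elem // 1?eq_sym // -sC.
set q := cmt _ _; have -> : (q * c * e^-1 = (q * e^-1) * (e * c * e^-1))%g by free_group.
rewrite /q {q}.
apply: EM; last exact: (E_ideal_conj (E_full_elem _ ij) Ic).
rewrite -E; apply: (@normal_cmt_congr _ (E_full n A) (E_ideal n I) _ _ X Y _ (E_ideal_normal n I)) => //.
- exact: E_full_subgroup.
- by apply: E_full_elem; rewrite eq_sym.
- exact: E_full_elem.
Qed.

(** The conjugate is [1 + v x (s w)], and [s w] is the sum of the [w_k u_k]. Since [w] is [e_j]
    modulo [I], everything except [1 + v x u_j] has a coefficient in [I]. *)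
Lemma relative_normality_pivot x :
  E_ideal n I (g * elem i j (s * x) * g^-1 * (elem i j (s * x))^-1)%g.
Proof.
have ji : j != i by rewrite eq_sym.
have uZ k c : (c *: u k) *m v = 0 by apply: rowZ_col.
pose t := \sum_(k | (k != i) && (k != j)) (x * w 0 k) *: u k.
have [tv It] : t *m v = 0 /\ E_ideal n I (transv v t).
  rewrite /t; elim/big_ind: _ => [|a b [av Ia] [bv Ib]|k /andP[ki kj]].
  - by rewrite mul0mx transv0r; split=> //; have [] := E_ideal_subgroup n I.
  - by rewrite mulmxDl av bv addr0 transvDr //; split=> //; apply: EM.
  split=> //; apply: transv_I => //; apply: idealMl.
  have -> : w 0 k = GL_mx g^-1%g j k by rewrite /w /er -rowE mxE.
  have [_ _ /(_ _ g_I)] := GL_ideal_subgroup n I.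
  by move=> /(GL_ideal_congr j k)[z Iz ->]; rewrite eq_sym (negPf kj) add0r.
have [z Iz wj] : exists2 z, ideal_set I z & w 0 j = 1 + z.
  have -> : w 0 j = GL_mx g^-1%g j j by rewrite /w /er -rowE mxE.
  have [_ _ /(_ _ g_I)] := GL_ideal_subgroup n I.
  by move=> /(GL_ideal_congr j j)[z Iz ->]; exists z; rewrite ?eqxx.
have -> : (g * elem i j (s * x) * g^-1)%g =
    (transv v (x *: u j) * (transv v ((x * z) *: u j) * transv v t))%g.
  rewrite {1}/elem transvJ ?elem_ortho // -/v -scalemxAl -/w -transvDr // -transvDr //; last first.
    by rewrite mulmxDl uZ tv addr0.
  congr transv; rewrite sC -scalerA sw scaler_sumr (bigD1 j) //= addrA -scalerDl.
  rewrite wj scalerA mulrDr mulr1; congr (_ + _).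
  by apply: eq_bigr => k _; rewrite scalerA.
set a := transv v (x *: u j); set b := (transv v _ * _)%g; set e := elem i j _.
have -> : (a * b * e^-1 = (a * e^-1) * (e * b * e^-1))%g by free_group.
apply: EM; first exact: transv_elem.
apply: (E_ideal_conj (E_full_elem _ ij)).
by apply: EM => //; apply: transv_I => //; apply: idealMl.
Qed.

End Pivot.
End RelativeNormality.

Lemma local_global (R : comPzRingType) (S : set R) : S 0 ->
  (forall r r', S r -> S r' -> S (r + r')) -> (forall t r, S r -> S (t * r)) ->
  (forall M : ideal R, maximal_ideal M -> exists2 s, ~ ideal_set M s & S s) -> S 1.
Proof.
move=> S0 SD SM Smax.
have SB r r' : S r -> S r' -> S (r - r').
  by move=> Sr Sr'; apply: SD => //; rewrite -mulN1r; apply: SM.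
have SMr r t : S r -> S (r * t) by rewrite mulrC; apply: SM.
apply: contrapT => S1; have [M maxM SM'] := @exists_maximal_ideal R (Ideal S0 SB SM SMr) S1.
by have [s Ms /SM'] := Smax M maxM.
Qed.

Lemma E_full_cmt n (A : pzRingType) (I : ideal A) (g e : GL n A) :
  (forall (i j : 'I_n) x, i != j -> E_ideal n I (cmt g (elem i j x))) ->
  E_full n A e -> E_ideal n I (cmt g e).
Proof.
move=> Hel; pose H : set (GL n A) := [set e | E_full n A e /\ E_ideal n I (cmt g e)].
suff sub : E_full n A `<=` H by move=> /sub[].
have [E1 EM EV] := E_ideal_subgroup n I; have [F1 FM FV] := E_full_subgroup n A.
apply: E_gen_sub => [|i j x ij _]; last by split; [exact: E_full_elem|exact: Hel].
split=> [|a b [Fa Ha] [Fb Hb]|a [Fa Ha]].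
- by split=> //; rewrite /cmt invg1 !mulg1 mulgV.
- by split; [exact: FM|rewrite cmtMr; apply: (EM) => //; apply: E_ideal_conj].
split; first exact: FV.
have -> : cmt g a^-1 = (a^-1 * (cmt g a)^-1 * a^-1^-1)%g by rewrite /cmt; free_group.
by apply: E_ideal_conj; [exact: FV|exact: EV].
Qed.

(** * Relative normality over module finite algebras *)

Section ModuleFiniteGL.
Variables (n : nat) (R : comPzRingType) (A : pzRingType) (alg : {rmorphism R -> A}).
Hypothesis n3 : (3 <= n)%N.
Hypothesis alg_central : central_morphism alg.
Hypothesis finA : module_finite alg [set: A].
Implicit Types (g : GL n A) (i j k : 'I_n) (I : ideal A).

(** [local_stable_range] is applied to a unimodular pair built from column [i] of [g], arranged so
    that the resulting row operation has coefficients in [I]. *)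
Lemma exists_pivot I g i (M : ideal R) : maximal_ideal M -> GL_ideal n I g ->
  exists e y s, [/\ E_gen n I e, ~ ideal_set M s,
    GL_mx (e * g)%g i i * y = alg s & y * GL_mx (e * g)%g i i = alg s].
Proof.
move=> maxM Ig; have [m [b [_ b_gen]]] := finA.
have {b_gen} b_gen x : exists c : 'I_m -> R, x = \sum_(i < m) alg (c i) * b i by apply: b_gen.
pose z := GL_mx g i i - 1; pose x k := GL_mx g^-1%g i k.
have Iz : ideal_set I z.
  by rewrite /z; have [w Iw ->] := GL_ideal_congr i i Ig; rewrite eqxx addrC addKr.
(* From [1 = g_ii - z] and [z = z] times the sum of the [x_k g_ki]: every [g_ki] with [k != i] now
   carries the factor [z], which lies in [I]. *)
pose c := \sum_(k | k != i) (- z * x k) * GL_mx g k i.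
have xg : \sum_k x k * GL_mx g k i = 1.
  by have /matrixP/(_ i i) := GL_mxVl g; rewrite !mxE eqxx.
have E : (1 - z * x i) * GL_mx g i i + 1 * c = 1.
  rewrite mul1r mulrBl mul1r -addrA.
  have -> : - (z * x i * GL_mx g i i) + c = - z * \sum_k x k * GL_mx g k i.
    rewrite mulr_sumr [RHS](bigD1 i) //= !mulNr mulrA; congr (_ + _).
    by apply: eq_bigr => k _; rewrite mulrA.
  by rewrite xg mulr1 /z opprB addrC subrK.
have [t [y [s [Ms E1 E2]]]] := local_stable_range alg_central b_gen maxM E.
pose r : 'rV[A]_n := \row_k (if k == i then 0 else t * (- z * x k)).
have ri : r 0 i = 0 by rewrite mxE eqxx.
have rei : r *m ec i = 0 by rewrite mul_ec ri; apply/matrixP => ? ?; rewrite !mxE mul0rn.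
have pivE : GL_mx (transv (ec i) r * g)%g i i = GL_mx g i i + t * c.
  rewrite GL_mxM transvE // mulmxDl mul1mx mxE -mulmxA [(ec i *m _) i i]mxE big_ord1 mxE eqxx mul1r.
  congr (_ + _); rewrite mxE (bigD1 i) //= ri mul0r add0r mulr_sumr.
  by apply: eq_bigr => k ki; rewrite [r 0 k]mxE (negPf ki) !mulrA.
exists (transv (ec i) r), y, s; split; rewrite ?pivE //.
apply: E_gen_row => // k ik; rewrite mxE eq_sym (negPf ik).
by apply/idealMl/Defs.idealMr/idealN.
Qed.

Lemma elem_relative_normality I g i j x : GL_ideal n I g -> i != j ->
  E_ideal n I (cmt g (elem i j x)).
Proof.
move=> Ig ij; have [E1 EM EV] := E_ideal_subgroup n I.
pose S := [set r | forall x, E_ideal n I (cmt g (elem i j (alg r * x)))].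
suff /(_ x) : S 1 by rewrite rmorph1 mul1r.
apply: local_global => [y|r r' Sr Sr' y|t r Sr y|M maxM].
- by rewrite rmorph0 mul0r elem0 /cmt invg1 !mulg1 mulgV.
- rewrite rmorphD mulrDl elemD // cmtMr; apply: EM => //.
  exact: (E_ideal_conj (E_full_elem _ ij)).
- by rewrite mulrC rmorphM -mulrA.
have [e [y [s [Ee Ms E2 E3]]]] := exists_pivot i maxM Ig.
exists s => // z.
have {}Ee : E_ideal n I e by apply: E_gen_ideal.
have Ieg : GL_ideal n I (e * g)%g.
  have [_ GM _] := GL_ideal_subgroup n I; apply: GM => //; exact: E_ideal_GL.
have := relative_normality_pivot n3 Ieg ij (alg_central s) E2 E3 z.
set l := elem i j _ => H.
have -> : cmt g l = (e^-1 * cmt (e * g) l * (l * e * l^-1))%g by rewrite /cmt; free_group.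
apply: (EM); last exact: (E_ideal_conj (E_full_elem _ ij)).
by apply: EM => //; apply: EV.
Qed.

Lemma finite_relative_normality I g e : GL_ideal n I g -> E_full n A e -> E_ideal n I (cmt g e).
Proof. by move=> Ig; apply: E_full_cmt => i j x ij; apply: elem_relative_normality. Qed.

End ModuleFiniteGL.

(** * Commutators of relative elementary subgroups *)

Definition sym_product (A : pzRingType) (I J : ideal A) : ideal A :=
  span_ideal [set x | exists a b, [/\ ideal_set I a, ideal_set J b & x = a * b \/ x = b * a]].

Lemma sym_productl (A : pzRingType) (I J : ideal A) a b :
  ideal_set I a -> ideal_set J b -> ideal_set (sym_product I J) (a * b).
Proof. by move=> Ia Jb; apply: sub_span; exists a, b; split=> //; left. Qed.

Lemma sym_productr (A : pzRingType) (I J : ideal A) a b :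
  ideal_set I a -> ideal_set J b -> ideal_set (sym_product I J) (b * a).
Proof. by move=> Ia Jb; apply: sub_span; exists a, b; split=> //; right. Qed.

Lemma ideal_map (A : pzRingType) (P : A -> Prop) : P 0 ->
  (forall x y, P x -> P y -> P (x - y)) ->
  (forall a x, P x -> P (a * x)) -> (forall x a, P x -> P (x * a)) ->
  exists J : ideal A, J = P :> set A.
Proof. by move=> P0 PB PMl PMr; exists (Ideal P0 PB PMl PMr). Qed.

Lemma commutator_normal (G : groupType) (H K : set G) :
  is_normal_subgroup setT H -> is_normal_subgroup setT K ->
  is_normal_subgroup setT (commutator_subgroup H K).
Proof.
move=> [_ _ HN] [_ _ KN]; have [C1 CM CV] : is_subgroup (commutator_subgroup H K) by apply: generated_subgroup.
split=> // x h _; move: h.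
apply: commutator_sub.
  split=> [|y z Cy Cz|y Cy] /=.
  - by rewrite mulg1 mulgV.
  - by have := CM _ _ Cy Cz; free_group.
  - by have := CV _ Cy; free_group.
by move=> y z Hy Kz /=; rewrite cmtJ; apply: commutator_in; [apply: HN|apply: KN].
Qed.

(** * Normality in the general linear group and commutators of E(L) with GL(K) *)

Section Normality.
Variables (n : nat) (A : pzRingType).
Hypothesis n3 : (3 <= n)%N.
(** Kept abstract, to be instantiated for module finite algebras and later for quasi-finite ones. *)
Hypothesis relative_normality : forall (I : ideal A) (g e : GL n A),
  GL_ideal n I g -> E_full n A e -> E_ideal n I (cmt g e).
Implicit Types (g h : GL n A) (i j k : 'I_n) (I J K L : ideal A).

Lemma exists_unit_ideal : exists U : ideal A, forall x, ideal_set U x.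
Proof. by have [U UE] := @ideal_map A (fun=> True) I (fun _ _ _ _ => I) (fun _ _ _ => I) (fun _ _ _ => I); exists U; rewrite UE. Qed.

Lemma E_full_normal g e : E_full n A e -> E_full n A (g * e * g^-1)%g.
Proof.
move=> Ee; have [U HU] := exists_unit_ideal; rewrite mulg_cmt.
have [_ FM _] := E_full_subgroup n A; apply: FM => //.
apply: (@E_ideal_full n A U); apply: relative_normality => //.
by apply/GL_idealP => i j.
Qed.

(** A generator [e_ij(x)] is [[e_ik(x), e_kj(1)]], and its conjugate by [g] is a commutator of an
    element of GL(I) with one of E(A). *)
Lemma E_ideal_normal_GL I : is_normal_subgroup setT (E_ideal n I).
Proof.
have [E1 EM EV] := E_ideal_subgroup n I.
split=> // g h _ Eh; pose H : set (GL n A) := [set h | forall g, E_ideal n I (g * h * g^-1)%g].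
suff: E_ideal n I `<=` H by move=> /(_ h Eh); apply.
apply: E_ideal_sub => [|a b _ Hb c|i j x ij Ix c].
- split=> [a|a b Ha Hb c|a Ha c]; first by rewrite mulg1 mulgV.
    by have := EM _ _ (Ha c) (Hb c); free_group.
  by have := EV _ (Ha c); free_group.
- by have := Hb (c * a)%g; free_group.
have [k ki kj] := exists_third i j n3.
rewrite -[x]mulr1 -(cmt_elem _ _ (_ : i != k) kj ij) 1?eq_sym // cmtJ.
apply: relative_normality; first by apply: GL_ideal_conj; apply: elem_GL_ideal; rewrite // eq_sym.
by apply: E_full_normal; apply: E_full_elem.
Qed.

Variables (L K : ideal A).
Let N := commutator_subgroup (E_ideal n L) (E_ideal n K).

Lemma E_commutator_normal : is_normal_subgroup setT N.
Proof. by apply: commutator_normal; apply: E_ideal_normal_GL. Qed.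

Lemma E_commutator_elem i j x : i != j -> ideal_set (sym_product L K) x -> N (elem i j x).
Proof.
have [[N1 NM NV] _ _] := E_commutator_normal.
have [k ki kj] := exists_third i j n3 => ij.
(* The multipliers [a] and [b] make this set a two-sided ideal, so that it suffices to test the
   generators of [sym_product L K]. *)
have [J JE] : exists J : ideal A, J = [set x | forall a b, N (elem i j (a * x * b))] :> set A.
  apply: ideal_map => [a b|y z Hy Hz a b|c y Hy a b|y c Hy a b] /=.
  - by rewrite mulr0 mul0r elem0.
  - by rewrite mulrBr mulrBl elemD // elemN //; apply: NM => //; apply: NV.
  - by rewrite mulrA.
  - by rewrite mulrA -mulrA.
have sub : sym_product L K `<=` J.
  apply: span_sub => x' [l [c [Ll Kc xE]]]; rewrite JE => a b.
  have ik : i != k by rewrite eq_sym.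
  case: xE => xE.
    have -> : a * x' * b = (a * l) * (c * b) by rewrite xE !mulrA.
    rewrite -(cmt_elem _ _ ik kj ij).
    by apply: commutator_in; apply: E_ideal_elem => //; [apply: idealMl|apply: Defs.idealMr].
  have -> : a * x' * b = (a * c) * (l * b) by rewrite xE !mulrA.
  rewrite -(cmt_elem _ _ ik kj ij) -cmtV; apply: NV.
  by apply: commutator_in; apply: E_ideal_elem => //; [apply: Defs.idealMr|apply: idealMl].
by move=> /sub; rewrite JE => /(_ 1 1); rewrite mul1r mulr1.
Qed.

Lemma sym_product_commutator : E_ideal n (sym_product L K) `<=` N.
Proof.
have [sN _ NJ] := E_commutator_normal.
by apply: E_ideal_sub => // [g h _|i j x]; [exact: NJ|exact: E_commutator_elem].
Qed.

Lemma E_GL_commutator g e : E_ideal n L e -> GL_ideal n K g -> N (cmt e g).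
Proof.
move=> Le Kg; have nN := E_commutator_normal; have [[N1 NM NV] _ NJ] := nN.
have [Q [f [fM fN]]] := exists_quotient_group nN.
have f1 : f 1%g = 1%g by apply/fN.
have fV x : f x^-1%g = (f x)^-1%g by apply/esym/mulg1_eq; rewrite -fM mulgV f1.
have fC x y : f (cmt x y) = cmt (f x) (f y) by rewrite /cmt !fM !fV.
have fcE x y : N (cmt x y) <-> commute (f x) (f y).
  by rewrite -fN fC; apply: cmt_eq1.
have cE x y : E_ideal n L x -> E_ideal n K y -> commute (f x) (f y).
  by move=> Lx Ky; apply/fcE; exact: commutator_in.
have key x a : E_ideal n L x -> E_full n A a -> commute (f (cmt x a)) (f g).
  move=> Lx Fa; pose c := cmt g x; pose k := cmt g a.
  have Kk : E_ideal n K k by apply: relative_normality.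
  have cF z : E_full n A z -> commute (f c) (f z).
    move=> Fz; apply/fcE; apply: sym_product_commutator; apply: relative_normality => //.
    apply: (GL_ideal_cmt _ Kg (E_ideal_GL Lx)) => b d Kb Ld.
    by split; [apply: sym_productr|apply: sym_productl].
  have kx : commute (f k) (f x) by apply/commute_sym/cE.
  have kxa : commute (f k) (f (cmt x a)).
    apply/commute_sym/cE => //; rewrite -cmtV; have [_ LM LV] := E_ideal_subgroup n L.
    by apply: (LV); rewrite /cmt; apply: (LM); [exact: E_ideal_conj|exact: LV].
  have E : (g * cmt x a * g^-1)%g = cmt (c * x)%g (k * a)%g.
    by rewrite cmtJ !mulg_cmt.
  have cka : commute (f c) (f (k * a)%g).
    have [_ FM _] := E_full_subgroup n A; apply: cF; apply: FM => //; exact: E_ideal_full Kk.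
  have xka : cmt (f x) (f (k * a)%g) = f (cmt x a).
    by rewrite fM cmtMr (proj2 (cmt_eq1 _ _) (commute_sym kx)) mul1g -fC (commute_conj kxa).
  have : (f g * f (cmt x a) * (f g)^-1 = f (cmt x a))%g.
    rewrite -fV -!fM E fC fM cmtMl (proj2 (cmt_eq1 _ _) cka) mulg1 xka.
    apply: commute_conj; apply: cF.
    have [_ FM FV] := E_full_subgroup n A; have Fx := E_ideal_full Lx.
    by rewrite /cmt; do 2?[apply: (FM); last exact: FV]; apply: FM.
  by move/(congr1 (fun z => z * f g))%g; rewrite mulgVK.
pose H : set (GL n A) := [set e | E_ideal n L e /\ commute (f e) (f g)].
apply/fcE; suff: E_ideal n L `<=` H by move=> /(_ _ Le)[].
have [L1 LM LV] := E_ideal_subgroup n L.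
apply: E_ideal_sub => {e Le} [|a b Fa [Lb Hb]|i j x ij Lx].
- split=> [|a b [La Ha] [Lb Hb]|a [La Ha]].
  + by rewrite /H /= f1; split=> //; apply/commute_sym/commute1.
  + by split; [exact: LM|rewrite fM; apply: commuteMl].
  + by split; [exact: LV|rewrite fV; apply: commuteVl].
- split; first exact: E_ideal_conj.
  rewrite mulg_cmt -cmtV fM fV; apply: commuteMl => //; apply: commuteVl; exact: key.
have [k ki kj] := exists_third i j n3; have ik : i != k by rewrite eq_sym.
split; first exact: E_ideal_elem.
rewrite -[x]mulr1 -(cmt_elem _ _ ik kj ij); apply: key; first exact: E_ideal_elem.
exact: E_full_elem.
Qed.

End Normality.

(** * Commutators of opposite elementary matrices *)

Lemma cmt_square_zero (T : pzRingType) (X Y : T) : X * X = 0 -> Y * Y = 0 ->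
  (1 + X) * (1 + Y) * (1 - X) * (1 - Y) =
    1 + (X * Y + X * Y * X * Y - X * Y * X + Y * X * Y - Y * X).
Proof.
move=> XX YY.
have -> : (1 + X) * (1 + Y) = 1 + X + Y + X * Y.
  by rewrite mulrDr mulr1 mulrDl mul1r addrA.
have -> : (1 + X + Y + X * Y) * (1 - X) = 1 + Y + X * Y - Y * X - X * Y * X.
  rewrite mulrBr mulr1 [_ * X]mulrDl [(_ + Y) * X]mulrDl [(1 + X) * X]mulrDl XX mul1r addr0.
  move: (X * Y * X) (X * Y) (Y * X) => c a b.
  by rewrite !opprD !addrA (addrAC 1 X) (addrAC _ X a) addrK.
rewrite mulrBr mulr1 [(_ - X * Y * X) * Y]mulrBl [(_ - Y * X) * Y]mulrBl [(_ + X * Y) * Y]mulrDl.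
rewrite [(1 + Y) * Y]mulrDl YY mul1r addr0 -[X * Y * Y]mulrA YY mulr0 addr0.
move: (Y * X) (X * Y) (Y * X * Y) (X * Y * X) (X * Y * X * Y) => b a d c e.
rewrite !opprB (addrC 1 Y) !addrA.
have -> : Y + 1 + a - b - c + e + d - Y = 1 + a - b - c + e + d.
  by rewrite -!addrA addrC -!addrA addNr addr0.
by rewrite -!addrA; congr (_ + (_ + _)); rewrite addrC -!addrA addrCA; congr (_ + _);
   rewrite addrC -!addrA addrC -!addrA.
Qed.

Section Entries.
Variables (n : nat) (A : pzRingType).
Implicit Types (i j k p q : 'I_n) (a b x y : A).

Lemma elem_mx i j x : i != j -> GL_mx (elem i j x) = 1%:M + x *: delta_mx i j.
Proof. by move=> ij; rewrite -(elementaryE x ij). Qed.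

Lemma mul_scale_delta i j k l x y :
  (x *: delta_mx i j) *m (y *: delta_mx k l) = ((j == k)%:R * (x * y)) *: delta_mx i l :> 'M[A]_n.
Proof.
apply/matrixP => s t; rewrite !mxE (bigD1 j) //= big1 ?addr0; last first.
  by move=> r rj; rewrite !mxE (negPf rj) andbF mulr0 mul0r.
rewrite !mxE eqxx andbT; case: (s == i); case: (j == k); case: (t == l);
  by rewrite /= ?(mulr0, mul0r, mulr1, mul1r).
Qed.

Lemma elem_commute i j k l x y : i != j -> k != l -> j != k -> i != l ->
  commute (elem i j x) (elem k l y).
Proof.
move=> ij kl jk il.
suff E : (elem i j x * elem k l y * (elem i j x)^-1)%g = elem k l y.
  by rewrite /commute -{2}E mulgVK.
rewrite /elem transvJ ?elem_ortho // -/(elem i j x) -elemN //; congr transv.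
  by rewrite transvE ?elem_ortho // mulmxDl mul1mx -mulmxA -scalemxAl er_ec (negPf jk) -scalemx1 scale0r scaler0 mulmx0 addr0.
rewrite -scalemxAl; congr (_ *: _); rewrite transvE ?elem_ortho // mulmxDr mulmx1 mulmxA er_ec eq_sym (negPf il).
by rewrite -scalemx1 scale0r mul0mx addr0.
Qed.

Lemma elem_conjr l p j x y : l != p -> p != j -> l != j ->
  (elem p j y * elem l p x * (elem p j y)^-1)%g = (elem l p x * elem l j (- (x * y)))%g.
Proof.
move=> lp pj lj; rewrite elemN // -(cmt_elem _ _ lp pj lj).
have c : commute (elem l p x) (cmt (elem l p x) (elem p j y))^-1%g.
  by apply: commuteV; rewrite cmt_elem //; apply: elem_commute; rewrite // eq_sym.
by rewrite c cmtV /cmt; free_group.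
Qed.

Definition zcmt j p a b : GL n A := cmt (elem j p a) (elem p j b).

Lemma zcmtE j p a b : j != p -> GL_mx (zcmt j p a b) = 1%:M +
  ((a * b + a * b * a * b) *: delta_mx j j - (a * b * a) *: delta_mx j p
   + (b * a * b) *: delta_mx p j - (b * a) *: delta_mx p p).
Proof.
move=> jp; have pj : p != j by rewrite eq_sym.
rewrite /zcmt /cmt !GL_mxM -!elemN // !elem_mx // !scaleNr.
set X : 'M[A]_n := a *: _; set Y : 'M[A]_n := b *: _.
have XX : X *m X = 0 by rewrite mul_scale_delta (negPf pj) mul0r scale0r.
have YY : Y *m Y = 0 by rewrite mul_scale_delta (negPf jp) mul0r scale0r.
have := @cmt_square_zero 'M[A]_n X Y XX YY; rewrite /GRing.mul /= => ->.
by rewrite !(mul_scale_delta, eqxx, mul1r) scalerDl.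
Qed.

End Entries.

Section EntryFormulas.
Variables (n : nat) (A : pzRingType) (j p : 'I_n) (a b : A).
Hypothesis jp : j != p.
Let pj : p != j. Proof. by rewrite eq_sym. Qed.

Lemma zcmt_col k : GL_mx (zcmt j p a b) k p - (k == p)%:R =
  - (a * b * a * (k == j)%:R) - b * a * (k == p)%:R.
Proof.
by rewrite zcmtE // !mxE (negPf pj) eqxx !andbF !andbT !mulr0 add0r addr0 addrAC subrr add0r.
Qed.

Lemma zcmt_rowp k : GL_mx (zcmt j p a b) p k - (p == k)%:R =
  b * a * b * (k == j)%:R - b * a * (k == p)%:R.
Proof.
by rewrite zcmtE // !mxE (negPf pj) eqxx /= !mulr0 subrr add0r addrAC subrr add0r.
Qed.

Lemma zcmt_rowj k : GL_mx (zcmt j p a b) j k - (j == k)%:R =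
  (a * b + a * b * a * b) * (k == j)%:R - a * b * a * (k == p)%:R.
Proof.
by rewrite zcmtE // !mxE (negPf jp) eqxx /= !mulr0 addr0 subr0 addrAC subrr add0r.
Qed.

Lemma er_elem_mul i k q (x : A) : i != k -> q != i -> er q *m GL_mx (elem i k x) = er q :> 'rV[A]_n.
Proof.
move=> ik qi; rewrite transvE ?elem_ortho // mulmxDr mulmx1 mulmxA er_ec (negPf qi).
by rewrite mul_scalar_mx scale0r addr0.
Qed.

Lemma elem_ec_mul i k q (x : A) : i != k -> q != k -> GL_mx (elem i k x) *m ec q = ec q :> 'cV[A]_n.
Proof.
move=> ik qk; rewrite transvE ?elem_ortho // mulmxDl mul1mx -mulmxA -scalemxAl er_ec eq_sym (negPf qk).
by rewrite scale_scalar_mx mulr0 -scalemx1 scale0r mulmx0 addr0.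
Qed.

Lemma er_zcmt q : q != j -> q != p -> er q *m GL_mx (zcmt j p a b) = er q.
Proof.
move=> qj qp; rewrite /zcmt /cmt !GL_mxM -!elemN // !mulmxA !er_elem_mul //.
Qed.

Lemma zcmt_ec q : q != j -> q != p -> GL_mx (zcmt j p a b) *m ec q = ec q.
Proof.
move=> qj qp; rewrite /zcmt /cmt !GL_mxM -!elemN // -!mulmxA !elem_ec_mul //.
Qed.

End EntryFormulas.

Section ElementaryCommutators.
Variables (n : nat) (A : pzRingType).
Implicit Types (m : GL n A) (p q i : 'I_n) (x : A).

(** As [m] fixes the row [e_q], so does its inverse; hence conjugation by [m] changes [e_pq(x)] only
    in column [q]. *)
Lemma cmt_elem_col m p q x : p != q -> er q *m GL_mx m = er q ->
  exists v : 'cV[A]_n, [/\ v q 0 = 0, forall i, v i 0 = (GL_mx m i p - (i == p)%:R) * x &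
    cmt m (elem p q x) = transv v (er q)].
Proof.
move=> pq qm; have qmV : er q *m GL_mx m^-1%g = er q.
  by rewrite -{1}qm -mulmxA GL_mxV mulmx1.
pose d := GL_mx m *m ec p - ec p.
have dE i : d i 0 = GL_mx m i p - (i == p)%:R by rewrite /d /ec -colE !mxE andbT.
have dq : d q 0 = 0.
  rewrite dE; have /matrixP/(_ 0 p) := qm; rewrite /er -rowE !mxE /= => ->.
  by rewrite eq_sym subrr.
have qd : er q *m d = 0 by rewrite er_mul dq -scalemx1 scale0r.
exists (colZ d x); split=> [|i|]; first by rewrite mxE dq mul0r.
  by rewrite mxE dE.
have E : (m * elem p q x * m^-1 = transv (colZ d x) (er q) * elem p q x)%g.
  rewrite transvJ ?elem_ortho // -scalemxAl qmV.
  rewrite -[GL_mx m *m ec p](subrK (ec p)) -/d transvDl ?elem_ortho ?rowZ_col //.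
  by rewrite transv_colZ.
by rewrite /cmt E mulgK.
Qed.

(** The commutator of the inverses is taken, so that the entries of [m] appear and not those of its
    inverse. *)
Lemma cmt_elem_row m p q x : p != q -> GL_mx m *m ec p = ec p ->
  exists u : 'rV[A]_n, [/\ u 0 p = 0, forall i, u 0 i = x * (GL_mx m q i - (q == i)%:R) &
    ((elem p q x)^-1 * m^-1 * elem p q x * m)%g = transv (ec p) u].
Proof.
move=> pq mp; have mVp : GL_mx m^-1%g *m ec p = ec p.
  by rewrite -{1}mp mulmxA GL_mxVl mul1mx.
pose d := er q *m GL_mx m - er q.
have dE i : d 0 i = GL_mx m q i - (q == i)%:R by rewrite /d /er -rowE !mxE eq_sym.
have dp : d 0 p = 0.
  rewrite dE; have /matrixP/(_ q 0) := mp; rewrite /ec -colE !mxE andbT => ->.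
  by rewrite subrr.
have dp' : d *m ec p = 0 by rewrite mul_ec dp -scalemx1 scale0r.
exists (x *: d); split=> [|i|]; first by rewrite mxE dp mulr0.
  by rewrite mxE dE.
have E : (m^-1 * elem p q x * m = elem p q x * transv (ec p) (x *: d))%g.
  rewrite transvJV ?elem_ortho // -scalemxAl mVp.
  rewrite -[er q *m GL_mx m](subrK (er q)) -/d addrC scalerDr transvDr ?elem_ortho //.
  exact: rowZ_col.
by rewrite -!mulgA [(m^-1 * _)%g]mulgA E mulKg.
Qed.

End ElementaryCommutators.

(** * Calculus of the commutators z modulo the kernel of f *)

Section LocalCommutators.
Variables (n : nat) (A : pzRingType).
Hypothesis n3 : (3 <= n)%N.
Hypothesis relative_normality : forall (I : ideal A) (g e : GL n A),
  GL_ideal n I g -> E_full n A e -> E_ideal n I (cmt g e).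
Variables (I J K L P : ideal A).
Hypothesis IJ : forall a b, ideal_set I a -> ideal_set J b ->
  ideal_set L (a * b) /\ ideal_set L (b * a).
Hypothesis LK : forall l k, ideal_set L l -> ideal_set K k ->
  ideal_set P (l * k) /\ ideal_set P (k * l).
(* f is reduction modulo [E(L), E(K)] or, when K = A, modulo E(L). *)
Variables (Q : groupType) (f : GL n A -> Q).
Hypothesis fM : {morph f : x y / (x * y)%g}.
Hypothesis fP : forall i j x, i != j -> ideal_set P x -> f (elem i j x) = 1%g.
Hypothesis fLK : forall x y, E_ideal n L x -> E_ideal n K y -> commute (f x) (f y).
Implicit Types (g h m : GL n A) (i j l p q : 'I_n) (a b x y k : A) (v : 'cV[A]_n) (u : 'rV[A]_n).

Let f1 : f 1%g = 1%g.
Proof. by apply: (mulgI (f 1%g)); rewrite -fM !mulg1. Qed.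
Let fV g : f g^-1%g = (f g)^-1%g.
Proof. by apply/esym/mulg1_eq; rewrite -fM mulgV f1. Qed.
Let fC g h : f (cmt g h) = cmt (f g) (f h).
Proof. by rewrite /cmt !fM !fV. Qed.

Let ker_subgroup : is_subgroup [set g | f g = 1%g].
Proof.
split=> [|x y /= Hx Hy|x /= Hx]; first exact: f1.
  by rewrite fM Hx Hy mulg1.
by rewrite fV Hx invg1.
Qed.

Let centralizer_subgroup (q : Q) : is_subgroup [set g | commute q (f g)].
Proof.
split=> [|x y /= Hx Hy|x /= Hx]; first by rewrite /= f1; exact: commute1.
  by rewrite fM; apply: commuteM.
by rewrite fV; apply: commuteV.
Qed.

Let f_col v p : v p 0 = 0 -> (forall i, i != p -> ideal_set P (v i 0)) ->
  f (transv v (er p)) = 1%g.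
Proof.
move=> vp Pv; apply: (transv_col_mem ker_subgroup vp) => i ip.
by apply: fP => //; apply: Pv.
Qed.

Let f_row u p : u 0 p = 0 -> (forall i, p != i -> ideal_set P (u 0 i)) ->
  f (transv (ec p) u) = 1%g.
Proof.
move=> up Pu; apply: (transv_row_mem ker_subgroup up) => i ip.
by apply: fP => //; apply: Pu.
Qed.

Lemma commute_elem_col m p q x : p != q -> er q *m GL_mx m = er q ->
  (forall i, ideal_set P ((GL_mx m i p - (i == p)%:R) * x)) ->
  commute (f m) (f (elem p q x)).
Proof.
move=> pq qm Pm; have [v [vq vE E]] := cmt_elem_col x pq qm.
apply/cmt_eq1; rewrite -fC E; apply: f_col => // i _; rewrite vE; exact: Pm.
Qed.

Lemma commute_elem_row m p q x : p != q -> GL_mx m *m ec p = ec p ->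
  (forall i, ideal_set P (x * (GL_mx m q i - (q == i)%:R))) ->
  commute (f m) (f (elem p q x)).
Proof.
move=> pq mp Pm; have [u [up uE E]] := cmt_elem_row x pq mp.
suff: commute (f m)^-1%g (f (elem p q x))^-1%g.
  by move=> /commuteVl/commuteV; rewrite !invgK.
apply/commute_sym/cmt_eq1; rewrite -!fV -fC /cmt !invgK E.
by apply: f_row => // i _; rewrite uE; exact: Pm.
Qed.

Lemma zcmt_GL j p a b : j != p -> ideal_set I a -> ideal_set J b ->
  GL_ideal n L (zcmt j p a b).
Proof.
move=> jp Ia Jb; apply: (GL_ideal_cmt (I := I) (J := J)) => //.
  exact: elem_GL_ideal.
by apply: elem_GL_ideal => //; rewrite eq_sym.
Qed.

(** Conjugating [h] by [e] in E(A) amounts to changing z by an element of E(L), which commutes with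
    E(K). So only [e_p'q'(k)] matters; if [p'] or [q'] is outside [{j, p}], the commutator with z is
    a column or row transvection over [P]. *)
Lemma zcmt_commute j p a b h : j != p -> ideal_set I a -> ideal_set J b ->
  E_ideal n K h -> commute (f (zcmt j p a b)) (f h).
Proof.
move=> jp Ia Jb; have Lz := zcmt_GL jp Ia Jb.
have := @zcmt_ec n A j p a b jp; have := @er_zcmt n A j p a b jp.
move: (zcmt j p a b) Lz => z Lz zrow zcol.
have Lz' i l : ideal_set L (GL_mx z i l - (i == l)%:R).
  by have [x Lx ->] := GL_ideal_congr i l Lz; rewrite addrC addKr.
have [F1 FM FV] := E_full_subgroup n A; have [K1 KM KV] := E_ideal_subgroup n K.
have conj e h' : E_full n A e -> E_ideal n K h' -> commute (f z) (f h') ->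
    commute (f z) (f (e * h' * e^-1)%g).
  move=> Fe Kh' zh'; rewrite !fM fV; apply/commuteJ; rewrite -!fV -!fM.
  rewrite conjV_cmt.
  rewrite fM; apply: commuteMl => //; apply: fLK => //.
  have [_ _ LV] := E_ideal_subgroup n L; apply: LV.
  by apply: relative_normality => //; apply: FV.
have base1 k p' q' : p' != q' -> ideal_set K k -> (q' != j) && (q' != p) || (p' != j) && (p' != p) ->
    commute (f z) (f (elem p' q' k)).
  move=> pq Kk /orP[/andP[q1 q2]|/andP[p1 p2]].
    apply: commute_elem_col => // [|i]; first exact: zrow.
    by apply: (LK _ Kk).1.
  apply: commute_elem_row => // [|i]; first exact: zcol.
  by apply: (LK _ Kk).2.
pose H : set (GL n A) := [set h | E_ideal n K h /\ commute (f z) (f h)].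
suff sub : E_ideal n K `<=` H by move=> /sub[].
apply: E_ideal_sub => [|e h' Fe [Kh' zh']|p' q' k pq Kk].
- split=> [|x y [Kx zx] [Ky zy]|x [Kx zx]].
  + by split=> //; rewrite f1; apply: commute1.
  + by split; [exact: KM|rewrite fM; apply: commuteM].
  + by split; [exact: KV|rewrite fV; apply: commuteV].
- by split; [exact: E_ideal_conj|exact: conj].
split; first exact: E_ideal_elem.
have [h' hj hp] := exists_third j p n3.
have [good|] := boolP ((q' != j) && (q' != p) || (p' != j) && (p' != p)); first exact: base1.
rewrite negb_or !negb_and !negbK => /andP[qjp pjp].
have hp' : h' != p' by case/orP: pjp => /eqP ->.
have hq' : h' != q' by case/orP: qjp => /eqP ->.
have ph' : p' != h' by rewrite eq_sym.
rewrite -[k]mulr1 -(cmt_elem _ _ ph' hq' pq).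
(* With both indices in [{j, p}], pass through a third index: the factors are [e_p'h'(k)] and an
   E(A)-conjugate of [e_p'h'(-k)]. *)
have -> : cmt (elem p' h' k) (elem h' q' 1) =
    (elem p' h' k * (elem h' q' 1 * elem p' h' (- k) * (elem h' q' 1)^-1))%g.
  by rewrite elemN // /cmt !mulgA.
rewrite fM; apply: commuteM; first by apply: base1; rewrite // hj hp.
apply: conj; first exact: E_full_elem.
  by apply: E_ideal_elem => //; apply: idealN.
by apply: base1; rewrite // ?hj ?hp //; apply: idealN.
Qed.

(* Comes from e_jp(ca) = [e_jl(c), e_lp(a)] and conjugation by e_pj(b). *)
Let zcmt_exchange j l p a b c : j != l -> j != p -> l != p ->
  commute (f (elem l j (- (a * b)))) (f (elem j l c)) ->
  commute (f (elem l j (- (a * b)))) (f (elem p l (b * c))) ->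
  f (zcmt j p (c * a) b) = (f (elem j l c) * f (zcmt l p a (b * c)) * (f (elem j l c))^-1)%g.
Proof.
move=> jl jp lp c1 c2.
have lj : l != j by rewrite eq_sym.
have pj : p != j by rewrite eq_sym.
have pl : p != l by rewrite eq_sym.
rewrite /zcmt -(cmt_elem _ _ jl lp jp) !fC; apply: cmt_exchange c1 c2; rewrite -fV -!fM; congr f.
  by rewrite mulg_cmt cmt_elem //; apply: elem_commute.
by rewrite elem_conjr.
Qed.

Let exchange j l p a b k : j != l -> j != p -> l != p ->
  ideal_set I a -> ideal_set J b -> ideal_set K k ->
  f (zcmt j p (k * a) b) = f (zcmt l p a (b * k)).
Proof.
move=> jl jp lp Ia Jb Kk; have lj : l != j by rewrite eq_sym.
have pl : p != l by rewrite eq_sym.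
have Lab : E_ideal n L (elem l j (- (a * b))).
  by apply: E_ideal_elem => //; apply/idealN/(IJ Ia Jb).1.
rewrite (zcmt_exchange jl jp lp); last 2 first.
- by apply: fLK => //; apply: E_ideal_elem.
- by apply: fLK => //; apply: E_ideal_elem => //; apply: idealMl.
apply/commute_conj/commute_sym/zcmt_commute => //; first exact: Defs.idealMr.
exact: E_ideal_elem.
Qed.

(** [zcmt_exchange] with [c = 1]. Although 1 need not be in [K], the factor [k] already inside z
    puts [k a b] and the relevant entries of z into [P]. *)
Let reindex j l p a b k : j != l -> j != p -> l != p ->
  ideal_set I a -> ideal_set J b -> ideal_set K k ->
  f (zcmt j p (k * a) b) = f (zcmt l p (k * a) b).
Proof.
move=> jl jp lp Ia Jb Kk; have lj : l != j by rewrite eq_sym.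
have Pkab : ideal_set P (k * a * b) by rewrite -mulrA; apply: (LK (IJ Ia Jb).1 Kk).2.
have fab : f (elem l j (- (k * a * b))) = 1%g by apply: fP => //; apply: idealN.
have := @zcmt_exchange j l p (k * a) b 1 jl jp lp.
rewrite fab mul1r mulr1 => -> //; try by apply/commute_sym/commute1.
apply/commute_conj/commute_sym; apply: commute_elem_row => // [|i].
  by apply: zcmt_ec.
rewrite mul1r zcmt_rowj //.
by apply: idealB; apply: Defs.idealMr; [apply: idealD => //; do 2!apply: Defs.idealMr|apply: Defs.idealMr].
Qed.

Lemma zcmt_shift j l p a b k : j != p -> l != p ->
  ideal_set I a -> ideal_set J b -> ideal_set K k ->
  f (zcmt j p (k * a) b) = f (zcmt l p a (b * k)).
Proof.
move=> jp lp Ia Jb Kk; have [jl|] := eqVneq j l; last by move=> jl; apply: exchange.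
have [h hj hp] := exists_third j p n3; have jh : j != h by rewrite eq_sym.
by rewrite (reindex jh jp hp Ia Jb Kk) -jl; apply: exchange.
Qed.

Section Fixed.
Variables (a b : A) (p : 'I_n).
Hypotheses (Ia : ideal_set I a) (Jb : ideal_set J b).

Let zK_shift j l k : j != p -> l != p -> ideal_set K k ->
  f (zcmt j p a (b * k)) = f (zcmt l p a (b * k)).
Proof. by move=> jp lp Kk; rewrite -(zcmt_shift jp jp Ia Jb Kk) (zcmt_shift jp lp Ia Jb Kk). Qed.

(** [zcmt_shift] moves z away from the index [l] and puts [k] next to [a]. The commutator is then a
    column transvection whose entries contain [k (a y)], in [P]. *)
Let zK_commute_row j l k y : j != p -> l != p -> ideal_set K k -> ideal_set J y ->
  commute (f (zcmt j p a (b * k))) (f (elem p l y)).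
Proof.
move=> jp lp Kk Jy; have [h hl hp] := exists_third l p n3.
rewrite -(zcmt_shift hp jp Ia Jb Kk); apply: commute_elem_col => [||i]; first by rewrite eq_sym.
  by apply: er_zcmt; rewrite // eq_sym.
have Pkay : ideal_set P (k * (a * y)) by apply: (LK (IJ Ia Jy).1 Kk).2.
rewrite zcmt_col // mulrBl mulNr; apply: idealB; [apply: idealN|].
  have -> : k * a * b * (k * a) * (i == h)%:R * y = k * a * b * (k * (a * y)) * (i == h)%:R.
    by case: (i == h); rewrite /= ?mulr1 ?mulr0 ?mul0r // !mulrA.
  by apply: Defs.idealMr; apply: idealMl.
have -> : b * (k * a) * (i == p)%:R * y = b * (k * (a * y)) * (i == p)%:R.
  by case: (i == p); rewrite /= ?mulr1 ?mulr0 ?mul0r // !mulrA.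
by apply: Defs.idealMr; apply: idealMl.
Qed.

Let zK_commute_col j l k x : j != p -> l != p -> ideal_set K k -> ideal_set I x ->
  commute (f (zcmt j p a (b * k))) (f (elem l p x)).
Proof.
move=> jp lp Kk Ix; have [h hl hp] := exists_third l p n3.
rewrite (zK_shift jp hp Kk); apply: commute_elem_row => [//||i].
  by apply: zcmt_ec; rewrite // eq_sym.
have Pxbk : ideal_set P (x * b * k) by apply: (LK (IJ Ix Jb).1 Kk).1.
rewrite zcmt_rowp // mulrBr !mulrA; apply: idealB.
  by do 4!apply: Defs.idealMr.
by do 2!apply: Defs.idealMr.
Qed.

Variable j : 'I_n.
Hypothesis jp : j != p.
Let Y k := f (zcmt j p a (b * k)).

Let Y0 : Y 0 = 1%g.
Proof. by rewrite /Y mulr0 /zcmt elem0 /cmt invg1 !mulg1 mulgV. Qed.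

Let YD k k' : ideal_set K k -> ideal_set K k' -> Y (k + k') = (Y k * Y k')%g.
Proof.
move=> Kk Kk'; have pj : p != j by rewrite eq_sym.
rewrite /Y {1}/zcmt mulrDr elemD // fC fM cmtMr -!fC -/(zcmt j p a (b * k)) -/(zcmt j p a (b * k')).
congr (_ * _)%g; apply/commute_conj/commute_sym.
by apply: zK_commute_row => //; apply: Defs.idealMr.
Qed.

(** Of the entries of [u] only the one at [r] gives an opposite pair; the others contribute
    elementary matrices over [P]. By [zcmt_shift] the remaining pair is a value of the additive map
    [Y]. *)
Let cmt_single r c u : r != p -> u 0 p = 0 ->
  ideal_set K c \/ (forall i, ideal_set K (u 0 i)) ->
  f (cmt (elem r p (c * a)) (transv (ec p) (b *: u))) = Y (u 0 r * c).
Proof.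
move=> rp up Kcu; have pr : p != r by rewrite eq_sym.
pose u' := u - u 0 r *: er r.
have u'E i : u' 0 i = u 0 i - u 0 r * (i == r)%:R by rewrite !mxE eqxx.
have u'p : u' 0 p = 0 by rewrite u'E up (negPf pr) mulr0 subr0.
have u'o : u' *m ec p = 0 by rewrite mul_ec u'p; apply/matrixP => ? ?; rewrite !mxE mul0rn.
have -> : transv (ec p) (b *: u) = (elem p r (b * u 0 r) * transv (ec p) (b *: u'))%g.
  rewrite /elem -transvDr ?elem_ortho ?rowZ_col // -scalerA -scalerDr.
  by rewrite addrC subrK.
have c1 : commute (f (elem r p (c * a))) (f (transv (ec p) (b *: u'))).
  apply: (transv_row_mem (centralizer_subgroup _)) => [|i pi] /=; first by rewrite mxE u'p mulr0.
  rewrite mxE u'E; have [->|ir] := eqVneq i r.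
    by rewrite mulr1 subrr mulr0 elem0 f1; apply: commute1.
  have ri : r != i by rewrite eq_sym.
  rewrite mulr0 subr0; apply/cmt_eq1; rewrite -fC cmt_elem //; apply: fP => //.
  have Lab := (IJ Ia Jb).1; case: Kcu => [Kc|Ku].
    rewrite -mulrA (mulrA a) mulrA; apply: Defs.idealMr; exact: (LK Lab Kc).2.
  by rewrite -mulrA (mulrA a); apply: idealMl; exact: (LK Lab (Ku i)).1.
rewrite fC fM cmtMr (proj2 (cmt_eq1 _ _) c1) mulg1 mulgV mulg1 -fC -/(zcmt r p _ _).
case: Kcu => [Kc|Ku].
  rewrite (zcmt_shift rp jp) //; last exact: Defs.idealMr.
  by rewrite /Y mulrA.
rewrite -(zcmt_shift jp rp) //; last exact: idealMl.
rewrite mulrA (zcmt_shift jp jp) //; exact: Defs.idealMr.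
Qed.

(** Expand in the entries of [v]: the values of [Y] commute with the column factors met on the way,
    so the contributions add up to the scalar [u v]. *)
Let cmt_col_row v u : v p 0 = 0 -> u 0 p = 0 ->
  (forall i, ideal_set K (v i 0)) \/ (forall i, ideal_set K (u 0 i)) ->
  f (cmt (transv (colZ v a) (er p)) (transv (ec p) (b *: u))) = Y (\sum_i u 0 i * v i 0).
Proof.
move=> vp up Kvu.
have Kuv i : ideal_set K (u 0 i * v i 0).
  by case: Kvu => H; [apply: idealMl|apply: Defs.idealMr].
have -> : colZ v a = \sum_(i | i != p) colZ (ec i) (v i 0 * a).
  apply/matrixP => i z; rewrite ord1 {z} summxE.
  have [->|ip] := eqVneq i p.
    by rewrite mxE vp mul0r big1 // => i' ip; rewrite !mxE eq_sym (negPf ip) mul0r.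
  rewrite (bigD1 i) //= !mxE !eqxx mul1r big1 ?addr0 // => i' /andP[_ ii].
  by rewrite !mxE eq_sym (negPf ii) mul0r.
have -> : \sum_i u 0 i * v i 0 = \sum_(i | i != p) u 0 i * v i 0.
  by rewrite (bigD1 p) //= vp mulr0 add0r.
suff [] : er p *m (\sum_(i | i != p) colZ (ec i) (v i 0 * a)) = 0 /\
  f (cmt (transv (\sum_(i | i != p) colZ (ec i) (v i 0 * a)) (er p)) (transv (ec p) (b *: u)))
   = Y (\sum_(i | i != p) u 0 i * v i 0) by [].
elim: (index_enum _) => [|i s [IH1 IH2]].
  by rewrite !big_nil mulmx0 transv0l /cmt invg1 mul1g mulg1 mulgV f1 Y0.
rewrite !big_cons; case: ifP => // ip.
have io : er p *m colZ (ec i) (v i 0 * a) = 0 by rewrite row_colZ // -[er p]scale1r elem_ortho.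
split; first by rewrite mulmxDr io IH1 addr0.
have Ks : ideal_set K (\sum_(i <- s | i != p) u 0 i * v i 0) by apply: ideal_sum.
have IHs := IH2; move: IH1 IHs; set vs := \sum_(i <- s | _) _ => IH1 IHs.
rewrite transvDl // -elem_col // fC fM cmtMl -!fC IHs cmt_single //; last first.
  by case: Kvu => H; [left|right].
rewrite (addrC (u 0 i * _)) YD //; congr (_ * _)%g; apply/commute_conj/commute_sym.
by apply: zK_commute_col => //; apply: idealMl.
Qed.

(** Write [v = e_j s + v1] and [u = e_j + u1] with [v1], [u1] over [K]. The three mixed terms are
    values of [Y], and their arguments sum to [u v - s = 0]. *)
Lemma cmt_col_row_congr v u (s : A) : v p 0 = 0 -> u 0 p = 0 ->
  (forall i, ideal_set K (v i 0 - s * (i == j)%:R)) ->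
  (forall i, ideal_set K (u 0 i - (i == j)%:R)) -> (u *m v) 0 0 = s ->
  f (cmt (transv (colZ v a) (er p)) (transv (ec p) (b *: u))) = f (zcmt j p (s * a) b).
Proof.
move=> vp up Kv Ku uvs; have pj : p != j by rewrite eq_sym.
pose v0 := colZ (ec j) s; pose v1 := v - v0; pose u1 := u - er j.
have v0E i : v0 i 0 = s * (i == j)%:R.
  by rewrite !mxE andbT; case: (i == j); rewrite /= ?mul1r ?mul0r ?mulr1 ?mulr0.
have v1E i : v1 i 0 = v i 0 - s * (i == j)%:R by rewrite mxE -v0E [X in _ + X]mxE.
have u0E i : (er j : 'rV[A]_n) 0 i = (i == j)%:R by rewrite !mxE eqxx.
have u1E i : u1 0 i = u 0 i - (i == j)%:R by rewrite mxE -u0E [X in _ + X]mxE.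
have v0p : v0 p 0 = 0 by rewrite v0E (negPf pj) mulr0.
have u0p : (er j : 'rV[A]_n) 0 p = 0 by rewrite u0E (negPf pj).
have v1p : v1 p 0 = 0 by rewrite v1E vp (negPf pj) mulr0 subr0.
have u1p : u1 0 p = 0 by rewrite u1E up (negPf pj) subr0.
have Kv1 i : ideal_set K (v1 i 0) by rewrite v1E.
have Ku1 i : ideal_set K (u1 0 i) by rewrite u1E.
have o v' c : v' p 0 = 0 -> er p *m colZ v' c = 0.
  by move=> v'p; rewrite row_colZ // er_mul v'p; apply/matrixP => ? ?; rewrite !mxE mul0rn.
have o' u' : u' 0 p = 0 -> (b *: u') *m ec p = 0.
  by move=> u'p; rewrite rowZ_col // mul_ec u'p; apply/matrixP => ? ?; rewrite !mxE mul0rn.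
have -> : transv (colZ v a) (er p) = (elem j p (s * a) * transv (colZ v1 a) (er p))%g.
  have -> : elem j p (s * a) = transv (colZ v0 a) (er p).
    by rewrite elem_col //; congr transv; apply/matrixP => i z; rewrite !mxE mulrA.
  rewrite -transvDl ?o //; congr transv.
  by rewrite -colZD addrC subrK.
have -> : transv (ec p) (b *: u) = (elem p j b * transv (ec p) (b *: u1))%g.
  by rewrite /elem -transvDr ?o' // -scalerDr addrC subrK.
have E10 : f (cmt (transv (colZ v1 a) (er p)) (elem p j b)) = Y (v1 j 0).
  rewrite /elem cmt_col_row //; last by left.
  congr Y; rewrite (bigD1 j) //= u0E eqxx mul1r big1 ?addr0 // => i ij.
  by rewrite u0E (negPf ij) mul0r.
have E11 : f (cmt (transv (colZ v1 a) (er p)) (transv (ec p) (b *: u1))) = Y (\sum_i u1 0 i * v1 i 0).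
  by rewrite cmt_col_row //; left.
have E01 : f (cmt (elem j p (s * a)) (transv (ec p) (b *: u1))) = Y (u1 0 j * s).
  by rewrite cmt_single //; right.
have Jp y : ideal_set J y -> forall k, ideal_set K k -> commute (Y k) (f (elem p j y)).
  by move=> Jy k Kk; apply: zK_commute_row.
have Ip x : ideal_set I x -> forall k, ideal_set K k -> commute (Y k) (f (elem j p x)).
  by move=> Ix k Kk; apply: zK_commute_col.
have Isa : ideal_set I (s * a) by apply: idealMl.
have K10 : ideal_set K (v1 j 0) by [].
have K11 : ideal_set K (\sum_i u1 0 i * v1 i 0) by apply: ideal_sum => i _; apply: idealMl.
have K01 : ideal_set K (u1 0 j * s) by apply: Defs.idealMr.
have pickl (F : 'I_n -> A) : \sum_i (i == j)%:R * F i = F j.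
  rewrite (bigD1 j) //= eqxx mul1r big1 ?addr0 // => i ij.
  by rewrite (negPf ij) mul0r.
have pickr (F : 'I_n -> A) : \sum_i F i * (i == j)%:R = F j.
  rewrite (bigD1 j) //= eqxx mulr1 big1 ?addr0 // => i ij.
  by rewrite (negPf ij) mulr0.
have sum0 : v1 j 0 + \sum_i u1 0 i * v1 i 0 + u1 0 j * s = 0.
  have : \sum_i u 0 i * v i 0 = s by rewrite -uvs mxE.
  have -> : \sum_i u 0 i * v i 0 =
      \sum_i ((i == j)%:R * v i 0 + (u1 0 i * s * (i == j)%:R + u1 0 i * v1 i 0)).
    apply: eq_bigr => i _; rewrite -[u1 0 i * s * _]mulrA -mulrDr v1E.
    by rewrite [s * _ + _]addrC subrK -mulrDl u1E [(i == j)%:R + _]addrC subrK.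
  rewrite !big_split /= pickl pickr => E.
  rewrite v1E eqxx mulr1 -addrA [\sum_i _ + _]addrC addrAC E subrr; by [].
have [r rE] : exists r, r = f (zcmt j p (s * a) b) by eexists.
rewrite -rE fC !fM cmtMl !cmtMr -!fC E10 E11 E01.
rewrite (commute_conj (commute_sym (Jp _ Jb _ K11))) (commute_conj (commute_sym (Jp _ Jb _ K01))).
rewrite -YD // (commute_conj (commute_sym (Ip _ Isa _ _))); last exact: idealD.
have KS := idealD K10 K11.
have c : commute (Y (v1 j 0 + \sum_i u1 0 i * v1 i 0)) (f (zcmt j p (s * a) b)).
  by rewrite /zcmt fC; apply: commute_sym; apply: commute_cmt; apply: commute_sym; [apply: Ip|apply: Jp].
have Y1 : (Y (v1 j 0 + \sum_i u1 0 i * v1 i 0) * Y (u1 0 j * s) = 1)%g by rewrite -YD // sum0.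
have fin (z1 z2 z3 : Q) : commute z1 z2 -> (z1 * z3 = 1 -> z1 * (z2 * z3) = z2)%g.
  by move=> z12 z13; rewrite mulgA z12 -mulgA z13 mulg1.
rewrite rE; exact: fin c Y1.
Qed.

End Fixed.

Section Pivot.
Variables (g : GL n A) (p i j : 'I_n) (s y a b : A).
Hypothesis Kg : GL_ideal n K g.
Hypotheses (ij : i != j) (ip : i != p) (jp : j != p).
Hypothesis sC : forall x, s * x = x * s.
Hypothesis gy : GL_mx g p p * y = s.
Hypotheses (Ia : ideal_set I a) (Jb : ideal_set J b).

(** [mu r] is chosen to cancel the [p]-th entry [g_pr s - g_pp y g_pr] of [qv r], and [hv r] is row
    [r] of the inverse of [g] without its [p]-th entry. Then [hv r] times [qv t] is [s] or 0
    according as [r = t]: away from [p] the two families behave like [e_r] and [e_t s], to which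
    they are congruent modulo [K]. *)
Let mu r := y * GL_mx g p r.
Let base r : 'cV[A]_n := colZ (ec r) s - colZ (ec p) (mu r).
Let qv r : 'cV[A]_n := GL_mx g *m base r.
Let eta r := GL_mx g^-1%g r p.
Let hv r : 'rV[A]_n := er r *m GL_mx g^-1%g - eta r *: er p.

Let gV_K : GL_ideal n K g^-1%g.
Proof. by have [_ _] := GL_ideal_subgroup n K; apply. Qed.

Let mu_K r : r != p -> ideal_set K (mu r).
Proof.
move=> rp; apply: idealMl; have [k Kk ->] := GL_ideal_congr p r Kg.
by rewrite eq_sym (negPf rp) add0r.
Qed.

Let eta_K r : r != p -> ideal_set K (eta r).
Proof.
move=> rp; have [k Kk E] := GL_ideal_congr r p gV_K.
by rewrite /eta E (negPf rp) add0r.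
Qed.

Let qvE r t : qv r t 0 = GL_mx g t r * s - GL_mx g t p * mu r.
Proof. by rewrite /qv /base mulmxBr !mul_colZ /ec -!colE !mxE. Qed.

Let hvE r t : hv r 0 t = GL_mx g^-1%g r t - eta r * (t == p)%:R.
Proof. by rewrite /hv /er -rowE !mxE eqxx. Qed.

Let qv_p r : qv r p 0 = 0.
Proof. by rewrite qvE /mu mulrA gy sC subrr. Qed.

Let hv_p r : hv r 0 p = 0.
Proof. by rewrite hvE eqxx mulr1 subrr. Qed.

Let qv_K r t : r != p -> ideal_set K (qv r t 0 - s * (t == r)%:R).
Proof.
move=> rp; rewrite qvE -sC addrAC -mulrBr; apply: idealB; last by apply/idealMl/mu_K.
by apply: idealMl; have [k Kk ->] := GL_ideal_congr t r Kg; rewrite addrC addKr.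
Qed.

Let hv_K r t : r != p -> ideal_set K (hv r 0 t - (t == r)%:R).
Proof.
move=> rp; rewrite hvE addrAC; apply: idealB; last by apply/Defs.idealMr/eta_K.
by have [k Kk ->] := GL_ideal_congr r t gV_K; rewrite eq_sym addrC addKr.
Qed.

Let hq r t : r != p -> t != p -> hv r *m qv t = (s * (r == t)%:R)%:M.
Proof.
move=> rp tp; rewrite /hv mulmxBl -scalemxAl er_mul qv_p scale_scalar_mx mulr0.
rewrite -(scalemx1 _ 0) scale0r subr0 /qv mulmxA -(mulmxA (er r)) GL_mxVl mulmx1 er_mul.
by rewrite !mxE (negPf rp) mul0r subr0 !andbT; case: (r == t); rewrite /= ?mul1r ?mul0r ?mulr1 ?mulr0.
Qed.

Let hq0 r t : r != p -> t != p -> r != t -> hv r *m qv t = 0.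
Proof. by move=> rp tp rt; rewrite hq // (negPf rt) mulr0 -scalemx1 scale0r. Qed.

Let er_qv r c : er p *m colZ (qv r) c = 0.
Proof. by rewrite row_colZ // er_mul qv_p -scalemx1 scale0r. Qed.

Let hv_ec r c : (c *: hv r) *m ec p = 0.
Proof. by rewrite rowZ_col // mul_ec hv_p -scalemx1 scale0r. Qed.

Let T r t c := transv (colZ (qv r) c) (hv t).
Let S r t c := transv (colZ (qv r) (c * eta t)) (er p).

(* Gauss elimination at the pivot p, with denominators cleared by s: T r t c has
   trivial p-th row and column, and the two remaining factors, which carry the
   p-th row and column of g, commute modulo the kernel of f with what they meet. *)
Let conj_base r t c : r != p -> t != p -> r != t ->
  (g * (elem r t (s * c) * elem p t (- (mu r * c))) * g^-1 = T r t c * S r t c)%g.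
Proof.
move=> rp tp rt; have pt : p != t by rewrite eq_sym.
have tr : t != r by rewrite eq_sym.
have tb : er t *m base r = 0.
  rewrite /base mulmxBr !colZE !mulmxA !er_ec (negPf tr) (negPf tp).
  by rewrite -!(scalemx1 _ 0) !scale0r !mul0mx subrr.
have -> : (elem r t (s * c) * elem p t (- (mu r * c)))%g = transv (colZ (base r) c) (er t).
  rewrite !elem_col // -transvDl ?row_colZ ?er_ec ?(negPf tr) ?(negPf tp) -?(scalemx1 _ 0) ?scale0r //.
  by congr transv; apply/matrixP => k l; rewrite !mxE mulrBl !mulrA mulrN !mulrA.
rewrite transvJ ?row_colZ // mul_colZ -/(qv r).
have -> : er t *m GL_mx g^-1%g = hv t + eta t *: er p by rewrite subrK.
have o1 : hv t *m colZ (qv r) c = 0 by rewrite row_colZ // hq0.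
have o2 : (eta t *: er p) *m colZ (qv r) c = 0 by rewrite -scalemxAl er_qv scaler0.
rewrite (transvDr o1 o2); congr (_ * _)%g; rewrite -transv_colZ ?er_qv //.
by congr transv; apply/matrixP => k l; rewrite !mxE mulrA.
Qed.

(** Conjugation by [T] changes [S] by a column multiple of [c s d] times [eta r], which lies in [P],
    as a product from [L] and [K]. *)
Let T_S_commute r t c d : r != p -> t != p -> r != t ->
  ideal_set L (c * (s * d)) -> commute (f (T r t c)) (f (S t r d)).
Proof.
move=> rp tp rt Lcd; have tr : t != r by rewrite eq_sym.
have Tm : hv t *m colZ (qv r) c = 0 by rewrite row_colZ // hq0.
have E : (T r t c * S t r d * (T r t c)^-1 =
    transv (colZ (qv r) (c * (s * d) * eta r)) (er p) * S t r d)%g.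
  rewrite /S transvJ ?er_qv // -transvDl ?er_qv //.
  rewrite /T -transvNr // !transvE ?mulNmx ?Tm ?oppr0 //.
  have -> : er p *m (1%:M + colZ (qv r) c *m - hv t) = er p.
    by rewrite mulmxDr mulmx1 mulmxA er_qv mul0mx addr0.
  congr transv; rewrite mulmxDl mul1mx addrC -mulmxA; congr (_ + _).
  rewrite !colZE [hv t *m (_ *m _)]mulmxA hq // eqxx mulr1 -[LHS]mulmxA; congr (_ *m _).
  by rewrite -!scalar_mxM !mulrA.
have fE : f (transv (colZ (qv r) (c * (s * d) * eta r)) (er p)) = 1%g.
  apply: f_col => [|k kp]; rewrite mxE ?qv_p ?mul0r //; apply: idealMl.
  exact: (LK Lcd (eta_K rp)).1.
by have /(congr1 f) := E; rewrite !fM fE mul1g fV => /(congr1 (fun z => z * f (T r t c)))%g; rewrite mulgVK.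
Qed.

Let congK g1 g2 := E_ideal n K (g1^-1 * g2)%g.

Let congKM g1 g2 h1 h2 : congK g1 g2 -> congK h1 h2 -> congK (g1 * h1)%g (g2 * h2)%g.
Proof.
have [[K1 KM KV] _ KJ] := E_ideal_normal_GL n3 relative_normality K.
rewrite /congK => H1 H2; have := KM _ _ (KJ h1^-1%g _ Logic.I H1) H2.
by free_group.
Qed.

Let congKV g1 g2 : congK g1 g2 -> congK g1^-1%g g2^-1%g.
Proof.
have [[K1 KM KV] _ KJ] := E_ideal_normal_GL n3 relative_normality K.
by rewrite /congK => H1; have := KJ g1 _ Logic.I (KV _ H1); free_group.
Qed.

Let f_conj_congr g1 g2 h : congK g1 g2 ->
  (forall e : GL n A, E_ideal n K e -> commute (f h) (f e)) ->
  f (g2 * h * g2^-1)%g = f (g1 * h * g1^-1)%g.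
Proof.
rewrite /congK => H1 hK; rewrite -[g2](mulVKg g1); move: (g1^-1 * g2)%g H1 => e Ke.
rewrite !fM !fV fM invgM !mulgA; congr (_ * _)%g.
rewrite -[(f g1 * f e * f h)%g]mulgA -(hK _ Ke).
by rewrite !mulgA mulgK.
Qed.

(** Compares two right-hand sides of [cmt_cmt_expand]. The inner commutators agree under [f] and
    commute there with E(K), so congruence modulo E(K) is enough for the conjugating elements. *)
Let expand_congr (x1 y1 l1 j1 x2 y2 l2 j2 : GL n A) :
  congK x1 x2 -> congK y1 y2 -> congK j1 j2 -> E_ideal n L l1 -> f l2 = f l1 ->
  f (cmt x2 j2) = f (cmt x1 j1) ->
  (forall e : GL n A, E_ideal n K e -> commute (f (cmt x1 j1)) (f e)) ->
  f ((x2 * y2 * x2^-1) * (cmt x2 j2)^-1 * (x2 * y2 * x2^-1)^-1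
                    * (x2 * (cmt l2 (y2 * j2))^-1 * x2^-1))%g =
  f ((x1 * y1 * x1^-1) * (cmt x1 j1)^-1 * (x1 * y1 * x1^-1)^-1
                    * (x1 * (cmt l1 (y1 * j1))^-1 * x1^-1))%g.
Proof.
move=> x12 y12 j12 Ll fl fxj cK.
have [[L1 LM LV] _ LJ] := E_ideal_normal_GL n3 relative_normality L.
have fd : f (cmt l2 (y2 * j2)) = f (cmt l1 (y1 * j1)).
  have := congKM y12 j12; move: (y2 * j2)%g (y1 * j1)%g => h2 h1 h12.
  rewrite fC fl -[h2](mulVKg h1) fM cmtMr.
  have /cmt_eq1 -> : commute (f l1) (f (h1^-1 * h2)%g) by apply: fLK.
  by rewrite mulg1 mulgV mulg1 -fC.
have Ld : E_ideal n L (cmt l1 (y1 * j1)).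
  move: (y1 * j1)%g => h; rewrite -cmtV; apply: (LV); rewrite /cmt; apply: LM; last exact: LV.
  exact: LJ.
rewrite [LHS]fM [RHS]fM; congr (_ * _)%g.
  have E : congK (x1 * y1 * x1^-1)%g (x2 * y2 * x2^-1)%g.
    by apply: congKM; [apply: congKM|apply: congKV].
  rewrite -(f_conj_congr E) => [|k Kk]; first by rewrite !fM !fV fxj.
  by rewrite fV; apply: commuteVl; apply: cK.
rewrite -(f_conj_congr x12) => [|k Kk]; first by rewrite !fM !fV fd.
by rewrite fV; apply: commuteVl; apply: fLK.
Qed.

Let congK_col v1 v2 : v1 p 0 = 0 -> v2 p 0 = 0 -> (forall r, ideal_set K (v2 r 0 - v1 r 0)) ->
  congK (transv v1 (er p)) (transv v2 (er p)).
Proof.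
move=> v1p v2p Kv; have o v' : v' p 0 = 0 -> er p *m v' = 0.
  by move=> v'p; rewrite er_mul v'p -scalemx1 scale0r.
rewrite /congK -transvNl ?o // -transvDl ?o ?mxE ?v1p ?oppr0 //.
apply: E_gen_ideal; apply: E_gen_col => [|r rp]; first by rewrite !mxE v1p v2p addr0 oppr0.
by rewrite mxE [X in X + _]mxE addrC; apply: Kv.
Qed.

Let congK_row u1 u2 : u1 0 p = 0 -> u2 0 p = 0 -> (forall r, ideal_set K (u2 0 r - u1 0 r)) ->
  congK (transv (ec p) u1) (transv (ec p) u2).
Proof.
move=> u1p u2p Ku; have o u' : u' 0 p = 0 -> u' *m ec p = 0.
  by move=> u'p; rewrite mul_ec u'p -scalemx1 scale0r.
rewrite /congK -transvNr ?o // -transvDr ?o ?mxE ?u1p ?oppr0 //.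
apply: E_gen_ideal; apply: E_gen_row => [|r rp]; first by rewrite !mxE u1p u2p addr0 oppr0.
by rewrite mxE [X in X + _]mxE addrC; apply: Ku.
Qed.

Let pi' : p != i. Proof. by rewrite eq_sym. Qed.
Let pj' : p != j. Proof. by rewrite eq_sym. Qed.
Let ji : j != i. Proof. by rewrite eq_sym. Qed.

(** These imitate [e_ip(s a)], [e_pj(s)], [e_ji(s b)] and the corrections produced by conjugating
    the first two by the third; [qv] and [hv] replace the standard columns and rows. *)
Let X2 := transv (colZ (qv i) a) (er p).
Let Y2 := transv (ec p) (s *: hv j).
Let W2 := T j i b.
Let L2 := transv (colZ (qv j) (b * (s * a))) (er p).
Let J2 := transv (ec p) (- (s * (s * b)) *: hv i).

Let T_cmt : T i j (s * a) = cmt X2 Y2.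
Proof.
rewrite /X2 /Y2 cmt_transv_block; last 3 first.
- by rewrite mxE qv_p mul0r.
- by rewrite mxE hv_p mulr0.
- by rewrite rowZ_col // row_colZ // hq0.
rewrite /T !transv_colZ ?rowZ_col ?hq0 //.
by rewrite scalerA -sC.
Qed.

Let WX2 : (W2 * X2 * W2^-1 = X2 * L2)%g.
Proof.
have o : hv i *m colZ (qv j) b = 0 by rewrite row_colZ // hq0.
rewrite /X2 /L2 transvJ ?er_qv // -transvDl ?er_qv //.
rewrite /W2 /T -transvNr // !transvE ?mulNmx ?o ?oppr0 //.
have -> : er p *m (1%:M + colZ (qv j) b *m - hv i) = er p.
  by rewrite mulmxDr mulmx1 mulmxA er_qv mul0mx addr0.
congr transv; rewrite mulmxDl mul1mx -mulmxA; congr (_ + _).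
rewrite !colZE [hv i *m (_ *m _)]mulmxA hq // eqxx mulr1 -[LHS]mulmxA; congr (_ *m _).
by rewrite -!scalar_mxM.
Qed.

Let WY2 : (W2 * Y2 * W2^-1 = Y2 * J2)%g.
Proof.
have o : hv i *m colZ (qv j) b = 0 by rewrite row_colZ // hq0.
rewrite /Y2 /J2 transvJ ?hv_ec // -transvDr ?hv_ec //.
rewrite /W2 /T -transvNr // !transvE ?mulNmx ?o ?oppr0 //.
have -> : (1%:M + colZ (qv j) b *m hv i) *m ec p = ec p.
  by rewrite mulmxDl mul1mx -mulmxA -[hv i]scale1r hv_ec mulmx0 addr0.
congr transv; rewrite mulmxDr mulmx1; congr (_ + _).
rewrite mulmxA -scalemxAl colZE [hv j *m (_ *m _)]mulmxA hq // eqxx mulr1.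
by rewrite -scalar_mxM scale_scalar_mx mulmxN mul_scalar_mx scaleNr.
Qed.

(** Both first entries are commutators through [p], so both sides expand by [cmt_cmt_expand]. The
    ingredients are congruent, and the one comparison that is not formal, [[X, J]], is
    [cmt_col_row_congr]. *)
Let T_cmt_elem : f (cmt (T i j (s * a)) (T j i b)) =
  f (cmt (elem i j (s * (s * a))) (elem j i (s * b))).
Proof.
pose X1 := elem i p (s * a); pose Y1 := elem p j s; pose W1 := elem j i (s * b).
pose L1 := elem j p (s * b * (s * a)); pose J1 := elem p i (- (s * (s * b))).
have Isa : ideal_set I (s * a) by apply: idealMl.
have Jsb : ideal_set J (s * b) by apply: idealMl.
have WX1 : (W1 * X1 * W1^-1 = X1 * L1)%g.
  rewrite mulg_cmt cmt_elem //; apply: elem_commute => //.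
have WY1 : (W1 * Y1 * W1^-1 = Y1 * J1)%g by rewrite elem_conjr.
have -> : elem i j (s * (s * a)) = cmt X1 Y1 by rewrite cmt_elem // -sC.
rewrite T_cmt (cmt_cmt_expand WX2 WY2) (cmt_cmt_expand WX1 WY1).
have X1E : X1 = transv (colZ (colZ (ec i) s) a) (er p).
  by rewrite /X1 elem_col //; congr transv; apply/matrixP => k l; rewrite !mxE mulrA.
have ecs r t : (colZ (ec r) s : 'cV[A]_n) t 0 = s * (t == r)%:R.
  by rewrite !mxE andbT; case: (t == r); rewrite /= ?mul1r ?mul0r ?mulr1 ?mulr0.
have ern r t : (er r : 'rV[A]_n) 0 t = (t == r)%:R by rewrite !mxE eqxx.
have Js : ideal_set J (- (s * (s * b))) by apply: idealN; apply: idealMl.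
have cXJ : f (cmt X2 J2) = f (zcmt i p (s * a) (- (s * (s * b)))).
  apply: (cmt_col_row_congr Ia Js) => // [r|r|]; [exact: qv_K|exact: hv_K|].
  by rewrite hq // eqxx mulr1 mxE eqxx.
apply: expand_congr.
- rewrite X1E; apply: congK_col => [||r].
  + by rewrite mxE ecs (negPf pi') mulr0 mul0r.
  + by rewrite mxE qv_p mul0r.
  by rewrite [X in X - _]mxE [X in _ - X]mxE ecs -mulrBl; apply: Defs.idealMr; exact: qv_K.
- apply: congK_row => [||r].
  + by rewrite mxE ern (negPf pj') mulr0.
  + by rewrite mxE hv_p mulr0.
  by rewrite [X in X - _]mxE [X in _ - X]mxE ern -mulrBr; apply: idealMl; exact: hv_K.
- apply: congK_row => [||r].
  + by rewrite mxE ern (negPf pi') mulr0.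
  + by rewrite mxE hv_p mulr0.
  by rewrite [X in X - _]mxE [X in _ - X]mxE ern -mulrBr; apply: idealMl; exact: hv_K.
- by apply: E_ideal_elem => //; exact: (IJ Isa Jsb).2.
- have L1E : L1 = transv (colZ (colZ (ec j) s) (b * (s * a))) (er p).
    by rewrite /L1 elem_col //; congr transv; apply/matrixP => k l; rewrite !mxE !mulrA.
  have o : er p *m colZ (colZ (ec j) s) (b * (s * a)) = 0.
    by rewrite !row_colZ // er_ec (negPf pj') -scalemx1 scale0r.
  have -> : L2 = (L1 * transv (colZ (qv j - colZ (ec j) s) (b * (s * a))) (er p))%g.
    have qE : qv j = colZ (ec j) s + (qv j - colZ (ec j) s) by rewrite addrC subrK.
    have o' : er p *m colZ (qv j - colZ (ec j) s) (b * (s * a)) = 0.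
      by rewrite row_colZ // mulmxBr er_mul qv_p -(scalemx1 _ 0) scale0r row_colZ ?subr0 // er_ec (negPf pj') -scalemx1 scale0r.
    by rewrite L1E -transvDl // -colZD -qE.
  rewrite fM f_col ?mulg1 // => [|r _]; rewrite mxE [X in X * _]mxE [X in (_ + X) * _]mxE ecs.
    by rewrite qv_p (negPf pj') mulr0 subr0 mul0r.
  exact: (LK (IJ Isa Jb).2 (qv_K r jp)).2.
- exact: cXJ.
- by move=> e; apply: zcmt_commute.
Qed.

(** By [conj_base], [g] conjugates the elementary matrices, corrected by [al] and [be], to [T] times
    [S]. All corrections are absorbed under [f], and [T_cmt_elem] shows that the conjugate has the
    same image as z. *)
Lemma zcmt_pivot_commute :
  commute (f (zcmt i j (s * (s * a)) (s * b))) (f g).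
Proof.
have Isa : ideal_set I (s * a) by apply: idealMl.
have Issa : ideal_set I (s * (s * a)) by apply: idealMl.
have Jsb : ideal_set J (s * b) by apply: idealMl.
have fcmt1 p1 p2 p3 (c d : A) : p1 != p2 -> p2 != p3 -> p1 != p3 -> ideal_set P (c * d) ->
    commute (f (elem p1 p2 c)) (f (elem p2 p3 d)).
  by move=> h1 h2 h3 Pcd; apply/cmt_eq1; rewrite -fC cmt_elem //; apply: fP.
pose A1 := elem i j (s * (s * a)); pose B1 := elem j i (s * b).
pose al := elem p j (- (mu i * (s * a))); pose be := elem p i (- (mu j * b)).
have E1 : f (cmt (A1 * al) (B1 * be))%g = f (cmt A1 B1).
  rewrite !fC !fM; apply: cmt_absorb.
  - apply: fcmt1 => //; rewrite mulNr; apply: idealN; rewrite -mulrA.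
    exact: (LK (IJ Isa Jsb).1 (mu_K ip)).2.
  - have := @elem_commute n A p j p i (- (mu i * (s * a))) (- (mu j * b)) pj' pi' jp pi'.
    by move/(congr1 f); rewrite !fM.
  - apply: fcmt1 => //; rewrite mulNr; apply: idealN; rewrite -mulrA.
    exact: (LK (IJ Issa Jb).2 (mu_K jp)).2.
have E2 : f (cmt (T i j (s * a) * S i j (s * a)) (T j i b * S j i b))%g =
    f (cmt (T i j (s * a)) (T j i b)).
  rewrite !fC !fM; apply: cmt_absorb.
  - apply: commute_sym; apply: T_S_commute => //; exact: (IJ Issa Jb).2.
  - by rewrite /commute /S -!fM -!transvDl ?er_qv // addrC.
  - apply: commute_sym; apply: T_S_commute => //; exact: (IJ Isa Jsb).1.
have : f (g * cmt (A1 * al) (B1 * be) * g^-1)%g = f (cmt A1 B1).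
  by rewrite cmtJ !conj_base // E2 T_cmt_elem.
rewrite fM [f (g * _)%g]fM fV E1 -/(zcmt i j (s * (s * a)) (s * b)) => /(congr1 (fun z => z * f g))%g.
by rewrite mulgVK.
Qed.

End Pivot.
End LocalCommutators.

(** * Commutators of z with GL(K) over module finite algebras *)

Section ModuleFiniteCommutators.
Variables (n : nat) (R : comPzRingType) (A : pzRingType) (alg : {rmorphism R -> A}).
Hypothesis n3 : (3 <= n)%N.
Hypothesis alg_central : central_morphism alg.
Hypothesis finA : module_finite alg [set: A].
Variables (I J K : ideal A).

Let relnorm := finite_relative_normality n3 alg_central finA.
Let L := sym_product I J.
Let N := commutator_subgroup (E_ideal n L) (E_ideal n K).

Let IJ a b : ideal_set I a -> ideal_set J b -> ideal_set L (a * b) /\ ideal_set L (b * a).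
Proof. by move=> Ia Jb; split; [exact: sym_productl|exact: sym_productr]. Qed.

(** [zcmt_shift] for the unit ideal in place of [K], so that [s] is arbitrary and [P] becomes
    [L]. *)
Let zcmt_balanced (i j : 'I_n) a b s : i != j -> ideal_set I a -> ideal_set J b ->
  E_ideal n L (zcmt i j (s * a) b * (zcmt i j a (b * s))^-1)%g.
Proof.
move=> ij Ia Jb; have [Q [f [fM fE]]] := exists_quotient_group (E_ideal_normal_GL n3 relnorm L).
have [U HU] := exists_unit_ideal A.
have f1 : f 1%g = 1%g by apply/fE; have [] := E_ideal_subgroup n L.
have fV x : f x^-1%g = (f x)^-1%g by apply/esym/mulg1_eq; rewrite -fM mulgV f1.
apply/fE; rewrite fM fV; apply/eqP; rewrite divg_eq1; apply/eqP.
apply: (@zcmt_shift n A n3 relnorm I J U L L IJ _ Q f fM) => //.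
- by move=> l k Ll _; split; [exact: (@Defs.idealMr _ L)|exact: (@idealMl _ L)].
- by move=> k l x kl Lx; apply/fE; apply: E_ideal_elem.
- by move=> x y Lx _; rewrite (proj2 (fE x) Lx); apply/commute_sym/commute1.
Qed.

Lemma zcmt_GL_commutator g (i j : 'I_n) a b : GL_ideal n K g -> i != j ->
  ideal_set I a -> ideal_set J b -> N (cmt (zcmt i j a b) g).
Proof.
move=> Kg ij Ia Jb.
have nN : is_normal_subgroup setT N by apply: E_commutator_normal.
have [[N1 NM NV] _ NJ] := nN.
have [Q [f [fM fN]]] := exists_quotient_group nN.
have f1 : f 1%g = 1%g by apply/fN.
have fV x : f x^-1%g = (f x)^-1%g by apply/esym/mulg1_eq; rewrite -fM mulgV f1.
have fC x y : f (cmt x y) = cmt (f x) (f y) by rewrite /cmt !fM !fV.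
have fcE x y : N (cmt x y) <-> commute (f x) (f y).
  by rewrite -fN fC; apply: cmt_eq1.
pose P := sym_product L K.
have LK l k : ideal_set L l -> ideal_set K k -> ideal_set P (l * k) /\ ideal_set P (k * l).
  by move=> Ll Kk; split; [exact: sym_productl|exact: sym_productr].
have fP (k l : 'I_n) x : k != l -> ideal_set P x -> f (elem k l x) = 1%g.
  by move=> kl Px; apply/fN; apply: E_commutator_elem.
have fLG x h : E_ideal n L x -> GL_ideal n K h -> commute (f x) (f h).
  by move=> Lx Kh; apply/fcE; apply: E_GL_commutator.
have fLK x y : E_ideal n L x -> E_ideal n K y -> commute (f x) (f y).
  by move=> Lx Ky; apply: fLG => //; apply: E_ideal_GL.
pose S := [set r | forall a b, ideal_set I a -> ideal_set J b ->
  commute (f (zcmt i j (alg r * a) b)) (f g)].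
have ji : j != i by rewrite eq_sym.
suff S1 : S 1 by apply/fcE; rewrite -[a]mul1r -(rmorph1 alg); apply: S1.
apply: local_global => [x y Ix Jy|r r' Sr Sr' x y Ix Jy|t r Sr x y Ix Jy|M maxM].
- rewrite rmorph0 mul0r /zcmt elem0 /cmt invg1 mulg1 mul1g mulgV f1.
  exact/commute_sym/commute1.
- rewrite rmorphD mulrDl /zcmt elemD // cmtMl -!/(zcmt i j _ _) fM; apply: commuteMl; last exact: Sr.
  (* z is additive in its first argument up to conjugation by [e]; the discrepancy [[z, e]] lies in
     E(L), whose commutators with GL(K) are in [N]. *)
  set z := zcmt i j _ _; set e := elem i j _.
  have -> : (e * z * e^-1 = (cmt z e)^-1 * z)%g by rewrite cmtV mulg_cmt.
  rewrite fM; apply: commuteMl; last exact: Sr'.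
  apply: fLG => //; have [_ _ LV] := E_ideal_subgroup n L; apply: LV; apply: relnorm.
    by apply: (zcmt_GL IJ) => //; apply: idealMl.
  exact: E_full_elem.
- by rewrite mulrC rmorphM -mulrA; apply: Sr => //; apply: idealMl.
have [p pi pj] := exists_third i j n3.
have [e [y [s [Ke Ms E1 E2]]]] := exists_pivot alg_central finA p maxM Kg.
have {}Ke : E_ideal n K e by apply: E_gen_ideal.
have Keg : GL_ideal n K (e * g)%g.
  have [_ GM _] := GL_ideal_subgroup n K; apply: GM => //; exact: E_ideal_GL.
(* [zcmt_pivot_commute] handles two factors [s] on the first argument and one on the second;
   [zcmt_balanced] carries the latter across, up to an element of E(L). *)
exists (s * s * s).
  by do 2?apply: maximal_ideal_prime.
move=> x z Ix Jz; set sg := alg s in E1 E2.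
have sC c : sg * c = c * sg by apply: alg_central.
have ip : i != p by rewrite eq_sym.
have jp : j != p by rewrite eq_sym.
have H : commute (f (zcmt i j (sg * (sg * x)) (sg * z))) (f (e * g)%g).
  exact: (zcmt_pivot_commute n3 relnorm IJ LK fM fP fLK Keg ij ip jp sC E1 Ix Jz).
have Jsz : ideal_set J (sg * z) by apply: idealMl.
have Issx : ideal_set I (sg * (sg * x)) by do 2!apply: idealMl.
have {}H : commute (f (zcmt i j (sg * (sg * x)) (sg * z))) (f g).
  rewrite -[g](mulKg e) fM; apply: commuteM => //.
  rewrite fV; apply: commuteV.
  exact: (zcmt_commute n3 relnorm IJ LK fM fP fLK ij Issx Jsz Ke).
have := zcmt_balanced sg ij Issx Jz; rewrite -sC.
rewrite !rmorphM -/sg -!mulrA; set z1 := zcmt i j (sg * _) z; set z2 := zcmt _ _ _ _ => Lz.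
rewrite -[z1](mulgVK z2) fM; apply: commuteMl => //; exact: fLG.
Qed.

End ModuleFiniteCommutators.

(** * Reduction of quasi-finite algebras to module finite ones *)

Section Subring.
Variables (A : pzRingType) (S : set A).
Hypotheses (S1 : S 1) (SB : forall x y, S x -> S y -> S (x - y))
  (SM : forall x y, S x -> S y -> S (x * y)).

Definition subring_pred : {pred A} := fun x => `[< S x >].

Fact subring_pred_closed : subring_closed subring_pred.
Proof.
split=> [|x y /asboolP Sx /asboolP Sy|x y /asboolP Sx /asboolP Sy]; apply/asboolP => //.
  exact: SB.
exact: SM.
Qed.

HB.instance Definition _ := GRing.isSubringClosed.Build A subring_pred subring_pred_closed.

Definition subring : Type := {x : A | x \in subring_pred}.
HB.instance Definition _ := [isSub of subring for @sval A (fun x => x \in subring_pred)].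
HB.instance Definition _ := [Choice of subring by <:].
HB.instance Definition _ := GRing.SubChoice_isSubPzRing.Build A _ subring subring_pred_closed.

Lemma exists_subring : exists (B : pzRingType) (f : {rmorphism B -> A}),
  injective f /\ forall x, S x <-> exists b, f b = x.
Proof.
exists subring, (val : {rmorphism subring -> A}); split; first exact: val_inj.
move=> x; split=> [Sx|[b <-]]; last by have /asboolP := valP b.
have xS : x \in subring_pred by apply/asboolP.
by exists (exist _ x xS).
Qed.
End Subring.

Section QuasiFiniteTransport.
Variables (R : comPzRingType) (A : pzRingType) (alg : {rmorphism R -> A}).
Hypothesis alg_central : central_morphism alg.
Hypothesis qfA : quasi_finite alg.

Lemma quasi_finite_subring (s : seq A) :
  exists (B : pzRingType) (algB : {rmorphism R -> B}) (f : {rmorphism B -> A}),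
    [/\ injective f, central_morphism algB, module_finite algB [set: B]
      & forall x, x \in s -> exists b, f b = x].
Proof.
have [T [le [S [[[j0 _] le_refl le_trans dir] mono subS cover]]]] := qfA.
have [j sj] : exists j, forall x, x \in s -> S j x.
  elim: s => [|x s [j sj]]; first by exists j0.
  have [k _ Skx] : (\bigcup_j S j) x by rewrite cover.
  have [l [jl kl]] := dir j k; exists l => y; rewrite inE => /orP[/eqP ->|ys].
    exact: mono kl _ Skx.
  by apply: (mono _ _ jl); apply: sj.
have [[S1 SB SM SZ] [m [b [Sb b_gen]]]] := subS j.
have [B [f [f_inj fS]]] := exists_subring S1 SB SM.
have /choice[g gE] r : exists c, f c = alg r.
  by apply/fS; rewrite -[alg r]mulr1; apply: SZ.
have gB : zmod_morphism g by move=> x y; apply: f_inj; rewrite rmorphB !gE rmorphB.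
have gM : monoid_morphism g.
  by split=> [|x y]; apply: f_inj; rewrite ?rmorph1 ?rmorphM !gE ?rmorph1 ?rmorphM.
pose gz := GRing.isZmodMorphism.Build R B g gB.
pose gm := GRing.isMonoidMorphism.Build R B g gM.
pose algB : {rmorphism R -> B} := HB.pack g gz gm.
exists B, algB, f; split => //.
- by move=> r c; apply: f_inj; rewrite !rmorphM /= !gE.
- have /choice[b' b'E] i : exists c, f c = b i by apply/fS.
  exists m, b'; split=> // x _.
  have [|c xE] := b_gen (f x); first by apply/fS; exists x.
  exists c; apply: f_inj; rewrite xE rmorph_sum; apply: eq_bigr => i _.
  by rewrite rmorphM /= gE b'E.
- by move=> x /sj /fS.
Qed.

End QuasiFiniteTransport.

Section MapElementary.
Variables (n : nat) (A B : pzRingType) (f : {rmorphism B -> A}).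

Lemma GL_map_elem (i j : 'I_n) x : i != j -> GL_map f (elem i j x) = elem i j (f x).
Proof.
move=> ij; rewrite -!(elementaryE _ ij); apply: GL_mx_inj; rewrite /GL_mx /= /elementary_mx.
by rewrite map_mxD map_mx1 map_mxZ map_delta_mx.
Qed.

Lemma E_full_map h : E_full n B h -> E_full n A (GL_map f h).
Proof.
have [F1 FM FV] := E_full_subgroup n A.
pose H := [set h | E_full n A (GL_map f h)]; suff sub : E_full n B `<=` H by move=> /sub.
apply: E_gen_sub => [|i j x ij _]; last by rewrite /H /= GL_map_elem //; apply: E_full_elem.
split=> [|x y Hx Hy|x Hx]; rewrite /H /=; first by rewrite GL_map1.
  by rewrite GL_mapM; apply: FM.
by rewrite GL_mapV; apply: FV.
Qed.

Lemma E_ideal_map (I : ideal A) (I' : ideal B) h :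
  (forall x, ideal_set I' x -> ideal_set I (f x)) ->
  E_ideal n I' h -> E_ideal n I (GL_map f h).
Proof.
move=> fI; have [F1 FM FV] := E_ideal_subgroup n I.
pose H := [set h | E_ideal n I (GL_map f h)]; suff sub : E_ideal n I' `<=` H by move=> /sub.
apply: E_ideal_sub => [|g k Fg Hk|i j x ij Ix].
- split=> [|x y Hx Hy|x Hx]; rewrite /H /=; first by rewrite GL_map1.
    by rewrite GL_mapM; apply: FM.
  by rewrite GL_mapV; apply: FV.
- by rewrite /H /= !GL_mapM GL_mapV; apply: E_ideal_conj => //; apply: E_full_map.
by rewrite /H /= GL_map_elem //; apply: E_ideal_elem => //; apply: fI.
Qed.

Lemma commutator_map (H K : set (GL n B)) (H' K' : set (GL n A)) h :
  (forall x, H x -> H' (GL_map f x)) -> (forall x, K x -> K' (GL_map f x)) ->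
  commutator_subgroup H K h -> commutator_subgroup H' K' (GL_map f h).
Proof.
move=> fH fK; have [C1 CM CV] : is_subgroup (commutator_subgroup H' K').
  exact: generated_subgroup.
pose C := [set h | commutator_subgroup H' K' (GL_map f h)].
suff sub : commutator_subgroup H K `<=` C by move=> /sub.
apply: commutator_sub => [|x y Hx Ky].
  split=> [|x y Hx Hy|x Hx]; rewrite /C /=; first by rewrite GL_map1.
    by rewrite GL_mapM; apply: CM.
  by rewrite GL_mapV; apply: CV.
rewrite /C /= /cmt !GL_mapM !GL_mapV; apply: commutator_in; [exact: fH|exact: fK].
Qed.

Lemma GL_lift g : injective f ->
  (forall i j, exists b, f b = GL_mx g i j) ->
  (forall i j, exists b, f b = GL_mx g^-1%g i j) -> exists h : GL n B, GL_map f h = g.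
Proof.
move=> f_inj lift liftV.
have mx (M : 'M[A]_n) : (forall i j, exists b, f b = M i j) -> exists M', map_mx f M' = M.
  move=> Ml; have /choice[F FE] (ij : 'I_n * 'I_n) := Ml ij.1 ij.2.
  by exists (\matrix_(i, j) F (i, j)); apply/matrixP => i j; rewrite !mxE FE.
have [M ME] := mx _ lift; have [N NE] := mx _ liftV.
have inj (X Y : 'M[B]_n) : map_mx f X = map_mx f Y -> X = Y.
  by move=> /matrixP E; apply/matrixP => i j; apply: f_inj; have := E i j; rewrite !mxE.
have MN : inverse_pair (M, N).
  apply/andP; split; apply/eqP; apply: inj; rewrite map_mxM map_mx1 ME NE.
    exact: GL_mxV.
  exact: GL_mxVl.
by exists (MkGL MN); apply: GL_mx_inj.
Qed.

Lemma preimage_ideal (I : ideal A) : exists I' : ideal B, I' = [set x | ideal_set I (f x)] :> set B.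
Proof.
apply: ideal_map => [|x y|a x|x a] /=; first by rewrite rmorph0; apply: ideal0.
- by rewrite rmorphB; apply: idealB.
- by rewrite rmorphM; apply: idealMl.
- by rewrite rmorphM; apply: Defs.idealMr.
Qed.

Lemma GL_ideal_preimage (I : ideal A) (I' : ideal B) (h : GL n B) :
  I' = [set x | ideal_set I (f x)] :> set B ->
  GL_ideal n I (GL_map f h) -> GL_ideal n I' h.
Proof.
move=> I'E /GL_idealP Ih; apply/GL_idealP => i j; rewrite I'E /=.
have := Ih i j; have -> : GL_mx (GL_map f h) i j = f (GL_mx h i j) by rewrite /GL_mx /= mxE.
by rewrite rmorphB [in X in _ -> X]mxE [(1%:M : 'M[A]_n) i j]mxE rmorph_nat.
Qed.

End MapElementary.

Section QuasiFinite.
Variables (n : nat) (R : comPzRingType) (A : pzRingType) (alg : {rmorphism R -> A}).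
Hypothesis n3 : (3 <= n)%N.
Hypothesis alg_central : central_morphism alg.
Hypothesis qfA : quasi_finite alg.

(** The entries of the inverse of [g] are collected too, so that [g] lifts to an invertible matrix
    over [B]. *)
Lemma quasi_finite_lift (g : GL n A) (s : seq A) :
  exists (B : pzRingType) (algB : {rmorphism R -> B}) (f : {rmorphism B -> A}),
    [/\ central_morphism algB, module_finite algB [set: B],
        exists h, GL_map f h = g & forall x, x \in s -> exists b, f b = x].
Proof.
pose t (M : 'M[A]_n) := codom (fun ij : 'I_n * 'I_n => M ij.1 ij.2).
have [B [algB [f [f_inj cB mB ft]]]] :=
  quasi_finite_subring alg_central qfA (t (GL_mx g) ++ t (GL_mx g^-1%g) ++ s).
exists B, algB, f; split=> //; last by move=> x xs; apply: ft; rewrite !mem_cat xs !orbT.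
apply: GL_lift f_inj _ _ => i j; apply: ft; rewrite !mem_cat; apply/orP; [left|right].
  exact: (codom_f (fun ij : 'I_n * 'I_n => GL_mx g ij.1 ij.2) (i, j)).
by apply/orP; left; exact: (codom_f (fun ij : 'I_n * 'I_n => GL_mx g^-1%g ij.1 ij.2) (i, j)).
Qed.

Lemma quasi_finite_relative_normality (I : ideal A) (g e : GL n A) :
  GL_ideal n I g -> E_full n A e -> E_ideal n I (cmt g e).
Proof.
move=> Ig; apply: E_full_cmt => i j x ij.
have [B [algB [f [cB mB [h hg] fx]]]] := quasi_finite_lift g [:: x].
have [y fy] : exists y, f y = x by apply: fx; rewrite inE.
have [I' I'E] := preimage_ideal f I.
have := @finite_relative_normality n R B algB n3 cB mB I' h (elem i j y).
rewrite -hg -fy -GL_map_elem // in Ig *.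
move=> /(_ (GL_ideal_preimage I'E Ig) (E_full_elem _ ij)).
move=> /(E_ideal_map (I := I) (f := f)); rewrite /cmt !GL_mapM !GL_mapV; apply.
by move=> z; rewrite I'E.
Qed.

Lemma sym_product_map (B : pzRingType) (f : {rmorphism B -> A}) (I J : ideal A) (I' J' : ideal B) :
  (forall x, ideal_set I' x -> ideal_set I (f x)) ->
  (forall x, ideal_set J' x -> ideal_set J (f x)) ->
  forall x, ideal_set (sym_product I' J') x -> ideal_set (sym_product I J) (f x).
Proof.
move=> fI fJ; have [L LE] := preimage_ideal f (sym_product I J).
suff sub : sym_product I' J' `<=` L by move=> x /sub; rewrite LE.
apply: span_sub => _ [a [b [Ia Jb [->|->]]]]; rewrite LE /= rmorphM.
  by apply: sym_productl; [exact: fI|exact: fJ].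
by apply: sym_productr; [exact: fI|exact: fJ].
Qed.

Lemma quasi_finite_zcmt_GL_commutator (I J K : ideal A) g (i j : 'I_n) a b :
  GL_ideal n K g -> i != j -> ideal_set I a -> ideal_set J b ->
  commutator_subgroup (E_ideal n (sym_product I J)) (E_ideal n K) (cmt (zcmt i j a b) g).
Proof.
move=> Kg ij Ia Jb; have ji : j != i by rewrite eq_sym.
have [B [algB [f [cB mB [h hg] fx]]]] := quasi_finite_lift g [:: a; b].
have [a' fa] : exists y, f y = a by apply: fx; rewrite !inE eqxx.
have [b' fb] : exists y, f y = b by apply: fx; rewrite !inE eqxx orbT.
have [I' I'E] := preimage_ideal f I; have [J' J'E] := preimage_ideal f J.
have [K' K'E] := preimage_ideal f K.
rewrite -hg -fa -fb in Kg Ia Jb *.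
have Ia' : ideal_set I' a' by rewrite I'E.
have Jb' : ideal_set J' b' by rewrite J'E.
have := @zcmt_GL_commutator n R B algB n3 cB mB I' J' K' h i j a' b'
  (GL_ideal_preimage K'E Kg) ij Ia' Jb'.
move=> /(commutator_map (f := f) (H' := E_ideal n (sym_product I J)) (K' := E_ideal n K)).
have -> : GL_map f (cmt (zcmt i j a' b') h) = cmt (zcmt i j (f a') (f b')) (GL_map f h).
  by rewrite /zcmt /cmt !(GL_mapM, GL_mapV, GL_map_elem).
apply=> x; apply: E_ideal_map; last by move=> z; rewrite K'E.
by apply: sym_product_map => z; rewrite ?I'E ?J'E.
Qed.

End QuasiFinite.

(** * Generators of the relative elementary subgroup *)

Section Generation.
Variables (n : nat) (A : pzRingType).
Hypothesis n3 : (3 <= n)%N.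
Implicit Types (i j k l h : 'I_n) (a b c d x : A).

Definition elem_conj i j b c : GL n A := (elem j i c * elem i j b * (elem j i c)^-1)%g.

Lemma er_elem_conj i j b c q : i != j -> q != i -> q != j ->
  er q *m GL_mx (elem_conj i j b c) = er q.
Proof.
move=> ij qi qj; have ji : j != i by rewrite eq_sym.
by rewrite /elem_conj -elemN // !GL_mxM !mulmxA !er_elem_mul.
Qed.

Lemma elem_conj_ec i j b c q : i != j -> q != i -> q != j ->
  GL_mx (elem_conj i j b c) *m ec q = ec q.
Proof.
move=> ij qi qj; have ji : j != i by rewrite eq_sym.
by rewrite /elem_conj -elemN // !GL_mxM -!mulmxA !elem_ec_mul.
Qed.

Variable J : ideal A.

Lemma elem_conj_GL i j b c : i != j -> ideal_set J b -> GL_ideal n J (elem_conj i j b c).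
Proof. by move=> ij Jb; apply/GL_ideal_conj/elem_GL_ideal. Qed.

Lemma elem_conj0 i j b : elem_conj i j b 0 = elem i j b.
Proof. by rewrite /elem_conj elem0 invg1 mulg1 mul1g. Qed.

Let G : set (GL n A) := generated
  [set g | exists i j b c, [/\ i != j, ideal_set J b & g = elem_conj i j b c]].

Let sG : is_subgroup G. Proof. exact: generated_subgroup. Qed.

Let G_gen i j b c : i != j -> ideal_set J b -> G (elem_conj i j b c).
Proof. by move=> ij Jb; apply: sub_generated; exists i, j, b, c. Qed.

Let G_elem i j b : i != j -> ideal_set J b -> G (elem i j b).
Proof. by move=> ij Jb; rewrite -elem_conj0; apply: G_gen. Qed.

Let G_other i j b c k l d : i != j -> ideal_set J b -> k != l ->
  (l != i) && (l != j) || (k != i) && (k != j) ->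
  G (elem k l d * elem_conj i j b c * (elem k l d)^-1)%g.
Proof.
move=> ij Jb kl cond; have [G1 GM GV] := sG.
have Gm := G_gen c ij Jb; have Jm := elem_conj_GL c ij Jb.
have Je s t : ideal_set J (GL_mx (elem_conj i j b c) s t - (s == t)%:R).
  by have [x Jx ->] := GL_ideal_congr s t Jm; rewrite addrC addKr.
have row := er_elem_conj b c ij; have col := elem_conj_ec b c ij.
move: (elem_conj i j b c) Gm Je row col {Jm} => m Gm Je row col.
case/orP: cond => /andP[h1 h2].
  have [v [vl vE E]] := cmt_elem_col d kl (row _ h1 h2).
  rewrite mulg_cmt -cmtV E; apply: (GM) => //; apply: (GV).
  apply: transv_col_mem => // s sl; apply: G_elem => //; rewrite vE.
  by apply: Defs.idealMr.
have [u [uk uE E]] := cmt_elem_row (- d) kl (col _ h1 h2).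
have Gu : G (transv (ec k) u).
  apply: transv_row_mem => // s ks; apply: G_elem => //; rewrite uE.
  by apply: idealMl.
rewrite -E elemN // invgK in Gu.
have := GV _ (GM _ _ Gu (GV _ Gm)); rewrite mulgK !invgM !invgK.
by rewrite mulgA.
Qed.

Let G_rev i j b c d : i != j -> ideal_set J b ->
  G (elem j i d * elem_conj i j b c * (elem j i d)^-1)%g.
Proof.
move=> ij Jb; have ji : j != i by rewrite eq_sym.
have := G_gen (d + c) ij Jb; rewrite /elem_conj elemD //.
by rewrite !invgM !mulgA.
Qed.

Let G_same i j b c d : i != j -> ideal_set J b ->
  G (elem i j d * elem_conj i j b c * (elem i j d)^-1)%g.
Proof.
move=> ij Jb; have ji : j != i by rewrite eq_sym.
have [h hi hj] := exists_third i j n3.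
have ih : i != h by rewrite eq_sym.
have jh : j != h by rewrite eq_sym.
have [G1 GM GV] := sG.
pose M : GL n A := (elem i j d * elem j i c)%g.
have -> : (elem i j d * elem_conj i j b c * (elem i j d)^-1 = M * elem i j b * M^-1)%g.
  by rewrite /M /elem_conj invgM !mulgA.
have erM q : q != i -> q != j -> er q *m GL_mx M = er q.
  by move=> qi qj; rewrite /M GL_mxM mulmxA !er_elem_mul.
have Mec q : q != i -> q != j -> GL_mx M^-1%g *m ec q = ec q.
  move=> qi qj; rewrite /M invgM -!elemN // GL_mxM -!mulmxA !elem_ec_mul //.
pose v : 'cV[A]_n := GL_mx M *m ec i; pose u : 'rV[A]_n := er j *m GL_mx M^-1%g.
have vq q : q != i -> q != j -> v q 0 = 0.
  move=> qi qj; have : er q *m v = 0.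
    by rewrite /v mulmxA erM // er_ec (negPf qi) -scalemx1 scale0r.
  by rewrite er_mul => /matrixP/(_ 0 0); rewrite !mxE.
have uq q : q != i -> q != j -> u 0 q = 0.
  move=> qi qj; have : u *m ec q = 0.
    by rewrite /u -mulmxA Mec // er_ec eq_sym (negPf qj) -scalemx1 scale0r.
  by rewrite mul_ec => /matrixP/(_ 0 0); rewrite !mxE.
have uv : u *m v = 0.
  by rewrite /u /v mulmxA -(mulmxA (er j)) GL_mxVl mulmx1 er_ec (negPf ji) -scalemx1 scale0r.
have colE' q k x : (colZ (ec k) x) q 0 = (q == k)%:R * x :> A by rewrite !mxE andbT.
have rowE' q k x : (x *: er k) 0 q = x * (q == k)%:R :> A by rewrite !mxE eqxx.
have vE : v = colZ (ec i) (v i 0) + colZ (ec j) (v j 0).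
  apply/matrixP => q z; rewrite ord1 {z} [RHS]mxE !colE'.
  have [->|qi] := eqVneq q i; first by rewrite (negPf ij) mul1r mul0r addr0.
  have [->|qj] := eqVneq q j; first by rewrite mul1r mul0r add0r.
  by rewrite vq // !mul0r addr0.
have uE : u = u 0 i *: er i + u 0 j *: er j.
  apply/matrixP => z q; rewrite ord1 {z} [RHS]mxE !rowE'.
  have [->|qi] := eqVneq q i; first by rewrite (negPf ij) mulr1 mulr0 addr0.
  have [->|qj] := eqVneq q j; first by rewrite mulr1 mulr0 add0r.
  by rewrite uq // !mulr0 addr0.
have -> : (M * elem i j b * M^-1 = cmt (transv (colZ v b) (er h)) (transv (ec h) u))%g.
  rewrite cmt_transv_block; last 3 first.
  - by rewrite mxE vq // mul0r.
  - exact: uq.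
  - exact: row_colZ.
  rewrite transv_colZ //.
  by rewrite {1}/elem transvJ ?elem_ortho // -scalemxAl.
have ho q : h != q -> er h *m colZ (ec q) (v q 0 * b) = 0.
  by move=> hq; rewrite row_colZ // er_ec (negPf hq) -scalemx1 scale0r.
have -> : transv (colZ v b) (er h) = (elem i h (v i 0 * b) * elem j h (v j 0 * b))%g.
  rewrite !elem_col // -transvDl ?ho //; congr transv; rewrite {1}vE colZD; congr (_ + _).
    by apply/matrixP => q z; rewrite !mxE mulrA.
  by apply/matrixP => q z; rewrite !mxE mulrA.
have -> : transv (ec h) u = (elem h i (u 0 i) * elem h j (u 0 j))%g.
  by rewrite /elem -transvDr ?elem_ortho // -uE.
have Jv q : ideal_set J (v q 0 * b) by apply: idealMl.
move: (v i 0 * b) (v j 0 * b) (Jv i) (Jv j) => x1 x2 Jx1 Jx2.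
move: (u 0 i) (u 0 j) => y1 y2.
(* Conjugating by [e_hj(y2)] first splits off [e_ij(-x y2)]. Then [e_hi(y1)] is opposite to
   [e_ih(x)], and for the other factor it has the index [h] outside [{i, j}]. *)
have conj1 x : ideal_set J x -> G (elem h i y1 * elem h j y2 * elem i h x * (elem h i y1 * elem h j y2)^-1)%g.
  move=> Jx; have -> : (elem h i y1 * elem h j y2 * elem i h x * (elem h i y1 * elem h j y2)^-1 =
      elem h i y1 * elem_conj i h x 0 * (elem h i y1)^-1 *
      (elem h i y1 * elem_conj i j (- (x * y2)) 0 * (elem h i y1)^-1))%g.
    rewrite !elem_conj0; have := elem_conjr x y2 ih hj ij; move: (elem h i y1) => e.
    by move=> E; rewrite invgM -mulgA !mulgA -!(mulgA e) E; free_group.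
  apply: GM; first exact: G_rev.
  apply: G_other => //; first by apply/idealN/Defs.idealMr.
  by rewrite hi hj orbT.
have conj2 x : ideal_set J x -> G (elem h i y1 * elem h j y2 * elem j h x * (elem h i y1 * elem h j y2)^-1)%g.
  move=> Jx; have -> : (elem h i y1 * elem h j y2 * elem j h x * (elem h i y1 * elem h j y2)^-1 =
      elem h i y1 * elem_conj j h x y2 * (elem h i y1)^-1)%g.
    by rewrite /elem_conj invgM !mulgA.
  by apply: G_other => //; rewrite ij ih.
have {conj1 conj2} := GM _ _ (conj2 _ (idealN Jx2)) (conj1 _ (idealN Jx1)).
move: (elem h i y1 * elem h j y2)%g => y.
have := GM _ _ (G_elem ih Jx1) (G_elem jh Jx2); rewrite !elemN //.
move: (elem i h x1) (elem j h x2) => e1 e2 Ge Gy.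
by have := GM _ _ Ge Gy; rewrite /cmt; free_group.
Qed.

(** The group [G] generated by the [elem_conj] is stable under conjugation by elementary matrices.
    An index outside [{i, j}] gives a column or row over [J]; the two remaining cases are [G_rev]
    and [G_same]. *)
Lemma E_ideal_generation H : is_subgroup H ->
  (forall i j b c, i != j -> ideal_set J b -> H (elem_conj i j b c)) -> E_ideal n J `<=` H.
Proof.
move=> sH Hgen; have [G1 GM GV] := sG.
suff EG : E_ideal n J `<=` G.
  move=> x /EG; apply: generated_sub => // _ [i [j [b [c [ij Jb ->]]]]].
  exact: Hgen.
have GE k l d (x : GL n A) : k != l -> G x -> G (elem k l d * x * (elem k l d)^-1)%g.
  move=> kl; move: x; apply: generated_sub => [|_ [i [j [b [c [ij Jb ->]]]]] /=].
    split=> [|x y /= Hx Hy|x /= Hx]; first by rewrite /= mulg1 mulgV.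
      by have := GM _ _ Hx Hy; free_group.
    by have := GV _ Hx; free_group.
  have [good|] := boolP ((l != i) && (l != j) || (k != i) && (k != j)); first exact: G_other.
  rewrite negb_or !negb_and !negbK => /andP[/orP lij /orP kij].
  case: lij => /eqP lE; case: kij => /eqP kE; subst l k; rewrite ?eqxx // in kl *.
    exact: G_rev.
  exact: G_same.
(* Both conjugations are required so that [E] is closed under inverses. *)
pose E : set (GL n A) := [set e | forall y : GL n A, G y -> G (e * y * e^-1)%g /\ G (e^-1 * y * e)%g].
have EE : E_full n A `<=` E.
  apply: E_gen_sub => [|i j d ij _ y Gy].
    split=> [y Gy|e e' He He' y Gy|e He y Gy]; first by rewrite invg1 mulg1 mul1g.
      have [h1 _] := He' _ Gy; have [h2 _] := He _ h1.
      have [_ h3] := He _ Gy; have [_ h4] := He' _ h3.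
      by split; [move: h2|move: h4]; free_group.
    by have [h1 h2] := He _ Gy; rewrite invgK.
  split; first exact: GE.
  by have := GE i j (- d) y ij Gy; rewrite elemN // invgK.
by apply: E_ideal_sub => // g x Fg Gx; have [] := EE _ Fg _ Gx.
Qed.

End Generation.

(** * Multiple commutators *)

Section MultipleCommutators.
Variables (n : nat) (R : comPzRingType) (A : pzRingType) (alg : {rmorphism R -> A}).
Hypothesis n3 : (3 <= n)%N.
Hypothesis alg_central : central_morphism alg.
Hypothesis qfA : quasi_finite alg.
Implicit Types (I J K L : ideal A).

Let relnorm := quasi_finite_relative_normality n3 alg_central qfA.

(** Let [C] consist of the elements commuting with GL(K) modulo [N]. It is normal and contains
    E(IoJ) and all z, so it suffices that E(I) and E(J) commute modulo [C], which is checked on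
    generators. *)
Lemma E_commutator_GL_commutator I J K x g :
  commutator_subgroup (E_ideal n I) (E_ideal n J) x -> GL_ideal n K g ->
  commutator_subgroup (E_ideal n (sym_product I J)) (E_ideal n K) (cmt x g).
Proof.
set L := sym_product I J; set N := commutator_subgroup (E_ideal n L) (E_ideal n K).
move=> Cx Kg.
have nN : is_normal_subgroup setT N by apply: E_commutator_normal.
have [Q [f [fM fN]]] := exists_quotient_group nN.
have f1 : f 1%g = 1%g by apply/fN; have [[]] := nN.
have fV y : f y^-1%g = (f y)^-1%g by apply/esym/mulg1_eq; rewrite -fM mulgV f1.
have fC y z : f (cmt y z) = cmt (f y) (f z) by rewrite /cmt !fM !fV.
have fcE y z : N (cmt y z) <-> commute (f y) (f z).
  by rewrite -fN fC; apply: cmt_eq1.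
pose C : set (GL n A) := [set y | forall h, GL_ideal n K h -> commute (f y) (f h)].
have nC : is_normal_subgroup setT C.
  split=> [|//|y z _ Cz h Kh].
    split=> [h Kh|y z Cy Cz h Kh|y Cy h Kh]; first by rewrite f1; apply/commute_sym/commute1.
      by rewrite fM; apply: commuteMl; [apply: Cy|apply: Cz].
    by rewrite fV; apply: commuteVl; apply: Cy.
  rewrite !fM fV; apply: commute_sym; apply/commuteJ; rewrite -fV -!fM.
  by apply/commute_sym/Cz; have := GL_ideal_conj y^-1%g Kh; rewrite invgK.
have LC y : E_ideal n L y -> C y.
  by move=> Ly h Kh; apply/fcE; apply: E_GL_commutator.
have zC (i j : 'I_n) a b : i != j -> ideal_set I a -> ideal_set J b -> C (zcmt i j a b).
  by move=> ij Ia Jb h Kh; apply/fcE; apply: quasi_finite_zcmt_GL_commutator Kh ij Ia Jb.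
suff: C x by move=> /(_ g Kg)/fcE.
have [sC _ _] := nC; move: x Cx; apply: commutator_sub => // x y Ix Jy.
have [Q2 [f2 [f2M f2C]]] := exists_quotient_group nC.
have f21 : f2 1%g = 1%g by apply/f2C; have [] := sC.
have f2V z : f2 z^-1%g = (f2 z)^-1%g by apply/esym/mulg1_eq; rewrite -f2M mulgV f21.
have f2cmt z w : f2 (cmt z w) = cmt (f2 z) (f2 w) by rewrite /cmt !f2M !f2V.
have f2L (i j : 'I_n) a : i != j -> ideal_set L a -> f2 (elem i j a) = 1%g.
  by move=> ij La; apply/f2C/LC; apply: E_ideal_elem.
apply/f2C; rewrite f2cmt; apply/cmt_eq1.
have elem_gen (k l i j : 'I_n) a b c : k != l -> ideal_set I a -> i != j -> ideal_set J b ->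
    commute (f2 (elem_conj i j b c)) (f2 (elem k l a)).
  move=> kl Ia ij Jb; have Jm := elem_conj_GL c ij Jb.
  have Je s t : ideal_set J (GL_mx (elem_conj i j b c) s t - (s == t)%:R).
    by have [z Jz ->] := GL_ideal_congr s t Jm; rewrite addrC addKr.
  have row := er_elem_conj b c ij; have col := elem_conj_ec b c ij.
  move: (elem_conj i j b c) Jm Je row col => m Jm Je row col.
  have good k' l' : k' != l' -> (l' != i) && (l' != j) || (k' != i) && (k' != j) ->
      commute (f2 m) (f2 (elem k' l' a)).
    move=> kl' /orP[/andP[h1 h2]|/andP[h1 h2]].
      apply: (commute_elem_col f2M f2L) => // [|s]; first exact: row.
      by apply: sym_productr.
    apply: (commute_elem_row f2M f2L) => // [|s]; first exact: col.
    by apply: sym_productl.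
  have [|] := boolP ((l != i) && (l != j) || (k != i) && (k != j)); first exact: good.
  (* Here [k] and [l] are the indices of the conjugated generator. Write [e_kl(a) =
     [e_kh(a), e_hl(1)]]: conjugating [m] by [e_hl(1)] changes it by a row at [h] over [J]. Against
     [e_kh(a)], the entry at [k] gives some z and the others elementary matrices over [L]. *)
  rewrite negb_or !negb_and !negbK => /andP[lij kij].
  have [h hi hj] := exists_third i j n3.
  have hl : h != l by case/orP: lij => /eqP ->.
  have hk : h != k by case/orP: kij => /eqP ->.
  have kh : k != h by rewrite eq_sym.
  rewrite -[a]mulr1 -(cmt_elem _ _ kh hl kl).
  set e := elem h l 1; set y1 := elem k h a.
  have my1 : commute (f2 m) (f2 y1) by apply: good => //; rewrite hi hj.
  have [u [uh uE E]] := cmt_elem_row 1 hl (col _ hi hj).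
  have uy1 : commute (f2 (transv (ec h) u)) (f2 y1).
    apply: commute_sym; apply: (transv_row_mem (H := [set z | commute (f2 y1) (f2 z)])) => // [|t ht].
      split=> [|z w /= Hz Hw|z /= Hz]; first by rewrite /= f21; apply: commute1.
        by rewrite f2M; apply: commuteM.
      by rewrite f2V; apply: commuteV.
    have Jt : ideal_set J (u 0 t) by rewrite uE; apply: idealMl.
    rewrite /=; apply/cmt_eq1; rewrite -f2cmt; have [tk|tk] := eqVneq t k.
      by rewrite tk in Jt *; apply/f2C; exact: (zC k h).
    have kt : k != t by rewrite eq_sym.
    by rewrite cmt_elem //; apply: f2L => //; apply: sym_productl.
  have -> : cmt y1 e = (y1 * (e * y1^-1 * e^-1))%g by rewrite /cmt !mulgA.
  rewrite f2M; apply: commuteM => //; rewrite !f2M !f2V.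
  apply/commuteJ/commuteV; rewrite -f2V -!f2M.
  have -> : (e^-1 * m * e = m * (transv (ec h) u)^-1)%g by rewrite -E; free_group.
  by rewrite f2M f2V; apply: commuteMl => //; apply: commuteVl.
have elem_E (k l : 'I_n) a z : k != l -> ideal_set I a -> E_ideal n J z ->
    commute (f2 z) (f2 (elem k l a)).
  move=> kl Ia; move: z.
  apply: (E_ideal_generation n3 (H := [set z | commute (f2 z) (f2 (elem k l a))])) => [|i j b c ij Jb]; last exact: elem_gen.
  split=> [|z w /= Hz Hw|z /= Hz]; first by rewrite /= f21; apply/commute_sym/commute1.
    by rewrite f2M; apply: commuteMl.
  by rewrite f2V; apply: commuteVl.
(* Since E(A) normalizes E(J), [D] is stable under conjugation by E(A). So for E(I) the plain
   [e_kl(a)] suffice, and conjugated generators are needed only for E(J). *)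
pose D : set (GL n A) := [set x | forall z, E_ideal n J z -> commute (f2 x) (f2 z)].
have DI : E_ideal n I `<=` D.
  apply: E_ideal_sub => [|e h Fe Dh z Jz|k l a kl Ia z Jz].
  - split=> [z _|z w Dz Dw v Jv|z Dz v Jv]; first by rewrite f21; apply/commute_sym/commute1.
      by rewrite f2M; apply: commuteMl; [apply: Dz|apply: Dw].
    by rewrite f2V; apply: commuteVl; apply: Dz.
  - have [_ FM FV] := E_full_subgroup n A.
    rewrite !f2M f2V; apply: commute_sym; apply/commuteJ; rewrite -f2V -!f2M.
    apply/commute_sym/Dh; have := E_ideal_conj (FV _ Fe) Jz.
    by rewrite invgK.
  by apply/commute_sym/elem_E.
exact: DI.
Qed.

Lemma E_ideal_GL_commutator I J :
  commutator_subgroup (E_ideal n I) (GL_ideal n J) =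
  commutator_subgroup (E_ideal n I) (E_ideal n J).
Proof.
rewrite eqEsubset; split; apply: commutator_sub; try exact: generated_subgroup.
  by move=> x y Ix Jy; apply: E_GL_commutator.
by move=> x y Ix Jy; apply: commutator_in => //; apply: E_ideal_GL.
Qed.

(** Applied to both extremes [H = E(K)] and [H = GL(K)]. *)
Lemma E_commutator_commutator I J K (H : set (GL n A)) :
  E_ideal n K `<=` H -> H `<=` GL_ideal n K ->
  commutator_subgroup (commutator_subgroup (E_ideal n I) (E_ideal n J)) H =
  commutator_subgroup (E_ideal n (sym_product I J)) (E_ideal n K).
Proof.
move=> KH HK; rewrite eqEsubset; split; apply: commutator_sub; try exact: generated_subgroup.
  by move=> x y Cx Hy; apply: E_commutator_GL_commutator => //; apply: HK.
move=> x y Lx Ky; apply: commutator_in; last exact: KH.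
exact: sym_product_commutator Lx.
Qed.

(** After one step both sides are [[E(IoJ), E(K t)]], again of the initial shape; this is why [I]
    and [J] vary in the induction. *)
Lemma foldl_commutator (T : Type) (s : seq T) (K : T -> ideal A) I J :
  foldl (@commutator_subgroup _) (commutator_subgroup (E_ideal n I) (E_ideal n J))
    [seq GL_ideal n (K t) | t <- s] =
  foldl (@commutator_subgroup _) (commutator_subgroup (E_ideal n I) (E_ideal n J))
    [seq E_ideal n (K t) | t <- s].
Proof.
elim: s I J => //= t s IH I J.
rewrite (@E_commutator_commutator I J (K t) (GL_ideal n (K t))) //; last exact: E_ideal_GL.
rewrite (@E_commutator_commutator I J (K t) (E_ideal n (K t))) //; exact: E_ideal_GL.
Qed.

End MultipleCommutators.

Theorem theorem17 (n : nat) (n_ge3 : (3 <= n)%N)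
  (R : comPzRingType) (A : pzRingType) (alg : {rmorphism R -> A})
  (alg_central : central_morphism alg) (A_quasi_finite : quasi_finite alg)
  (m : nat) (I : 'I_m.+1 -> ideal A) :
  multi_commutator (E_ideal n (I ord0))
      (fun i : 'I_m => GL_ideal n (I (lift ord0 i)))
    = multi_commutator (E_ideal n (I ord0))
      (fun i : 'I_m => E_ideal n (I (lift ord0 i))).
Proof.
(* The empty enumeration is the case [m = 0], where both sides are E(I_0). *)
rewrite /multi_commutator; case: (enum _) => //= i s.
rewrite (E_ideal_GL_commutator n_ge3 alg_central A_quasi_finite).
exact: (foldl_commutator n_ge3 alg_central A_quasi_finite s (fun i => I (lift ord0 i))).
Qed.
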